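(* Let $R$ be any $\Bbbk$-algebra over a commutative ring $\Bbbk$ with $1$, and $A=R\oplus Rt$ its trivial extension. Let $\mathcal{L}(A)$ be the coendomorphism left $R$-bialgebroid of $R\to A$, and $\overline{\mathcal{L}(A)}$ its quotient $R$-coring by the left ideal $\langle 1_{\mathcal{L}(A)}(r\otimes1^o-1\otimes r^o)\rangle_{r\in R}$. Then the functor $Q\otimes_C-$ (see context) establishes an equivalence between the category of chain complexes of left $R$-modules (concentrated in degrees $\ge0$) and the category of left $\overline{\mathcal{L}(A)}$-comodules. In particular, if $R$ is a commutative ring, then $Q\otimes_C-$ establishes in fact a monoidal equivalence.
   Context: Conventions: all rings are unital $\Bbbk$-algebras, bimodules are $\Bbbk$-central, $\otimes=\otimes_{\Bbbk}$. $R^{o}$ is the opposite ring of $R$ (the element $r$ regarded in $R^o$ is written $r^o$), $R^{e}=R\otimes R^{o}$. The trivial extension $A=R\oplus Rt$ is the $R$-ring free as left (and right) $R$-module on $1$ and $\mathfrak{t}=(0,t)$, with $r\mathfrak{t}=\mathfrak{t}r$ and $\mathfrak{t}^2=0$. The bialgebroid $\mathcal{L}=\mathcal{L}(A)$: ${}^*A=\mathrm{Hom}_{R-}(A,R)$ (left $R$-linear maps) with $R$-actions $(sf)(x)=f(xs)$, $(fs)(x)=f(x)s$ and left $A$-action $(b\varphi)(x)=\varphi(xb)$; $\{e_i,{}^*e_i\}_i$ is a dual basis of ${}_RA$. View $A\otimes{}^*A$ as an $R^e$-bimodule via $(r\otimes s^o)(a\otimes\varphi)(p\otimes q^o)=(rap)\otimes(q\varphi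 s)$, and let $\mathcal{L}$ be the quotient of the tensor ring $\bigoplus_{n\ge0}(A\otimes{}^*A)^{\otimes_{R^e}n}$ by the two-sided ideal generated by $\sum_i(a\otimes e_i\varphi)\otimes_{R^e}(a'\otimes{}^*e_i)-(aa'\otimes\varphi)$ and $1_R\otimes\varphi(1_A)^o-(1_A\otimes\varphi)$, for $a,a'\in A$, $\varphi\in{}^*A$; $\pi$ is the canonical projection. As $R$-bimodule $\mathcal{L}$ has actions $r\cdot x\cdot s=(r\otimes s^o)x$; it is an $R$-coring with $\Delta(\pi(a\otimes\varphi))=\sum_i\pi(a\otimes{}^*e_i)\otimes_R\pi(e_i\otimes\varphi)$, $\varepsilon(\pi(a\otimes\varphi))=\varphi(a)$, $\Delta(\pi(r\otimes s^o))=\pi(r\otimes1^o)\otimes_R\pi(1\otimes s^o)$, $\varepsilon(\pi(r\otimes s^o))=rs$, extended by $\Delta(xy)=\sum x_{(1)}y_{(1)}\otimes_Rx_{(2)}y_{(2)}$, $\varepsilon(xy)=\varepsilon(x(\varepsilon(y)\otimes1^o))$. Equivalently, for this $A$, $\mathcal{L}(A)$ is generated as a ring by the image of $R^e$ and two $R^e$-invariant elements $x,y$ with $xy+yx=0$, $x^2=0$, and $\Delta(x)=x\otimes_R1+y\otimes_Rx$, $\varepsilon(x)=0$, $\Delta(y)=y\otimes_Ry$, $\varepsilon(y)=1$. The left ideal in the claim is a coideal, and $\overline{\mathcal{L}(A)}$ has the induced coring structure. The complex $Q_\bullet$: $K=\ker(A\otimes_RA\to A)$ (multiplication), $\partial a=1\otimes_Ra-a\otimes_R1$;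 $Q_0=R$, $Q_1=A$, $Q_n=K\otimes_A\cdots\otimes_AK$ ($n-1$ factors) for $n\ge2$; $\partial_0:R\to A$ is the unit map, $\partial_1=\partial$, and for $n\ge2$, $\partial_n$ sends $a_0\partial a_1\otimes_A\cdots\otimes_A\partial a_{n-1}$ to $\partial a_0\otimes_A\partial a_1\otimes_A\cdots\otimes_A\partial a_{n-1}$. Each $Q_n$ is a left $\mathcal{L}$-comodule: for $n=0$ by $r\mapsto\pi(r\otimes1^o)$, for $n\ge1$ by $a_0\partial a_1\otimes_A\cdots\otimes_A\partial a_{n-1}\mapsto\sum\pi(a_0\otimes{}^*e_{i_0})\cdots\pi(a_{n-1}\otimes{}^*e_{i_{n-1}})\otimes_R(e_{i_0}\partial e_{i_1}\otimes_A\cdots\otimes_A\partial e_{i_{n-1}})$ (sum over $i_0,\dots,i_{n-1}$); composing with $\mathcal{L}\to\overline{\mathcal{L}}$ makes $Q=\bigoplus_nQ_n$ a left $\overline{\mathcal{L}}$-comodule. The ring $C=R^{(\mathbb{N})}\oplus R^{(\mathbb{N})}$: free left $R$-module on $\{h_n,u_n\}_{n\in\mathbb{N}}$, the generators commuting with $R$, with $h_nh_m=\delta_{n,m}h_n$, $u_nu_m=0$, $u_nh_{n+1}=u_n=h_nu_n$ (other products zero). Unital left $C$-modules ($M=\bigoplus_nh_nM$) are identified with chain complexes $\cdots\to M_1\to M_0$ of left $R$-modules ($M_n=h_nM$, differential $M_{n+1}\to M_n$ given by $u_n$). $Q$ is a right unital $C$-module: $q(rh_n)=q_nr$, $q(ru_n)=\partial_n(q_n)r$,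 $q_n$ the component of $q$ in $Q_n$. Monoidal structures when $R$ is commutative: $A$ is then an $R$-algebra, the left ideal $\langle 1_{\mathcal{L}(A)}(r\otimes1^o-1\otimes r^o)\rangle_{r\in R}$ of $\mathcal{L}(A)$ is two-sided, and $\overline{\mathcal{L}(A)}$ is an $R$-bialgebroid as a quotient of $\mathcal{L}(A)$. Chain complexes of $R$-modules have the usual tensor product over $R$ (with sign $(-1)^k$ in the Leibniz rule) and unit $R$ in degree $0$. A left $\overline{\mathcal{L}}$-comodule $X$ is an $R$-bimodule via $xr=\sum\varepsilon(x_{(-1)}(r\otimes1^o))x_{(0)}$; the product of comodules is $X\otimes_RY$ with coaction $x\otimes_Ry\mapsto\sum x_{(-1)}y_{(-1)}\otimes_R(x_{(0)}\otimes_Ry_{(0)})$, and the unit is $R$. *)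

(* Defs.v *)
From HB Require Import structures.
From mathcomp Require Import all_boot all_algebra.
From mathcomp Require Import boolp classical_sets.

Set Implicit Arguments.
Unset Strict Implicit.
Unset Printing Implicit Defensive.

Import GRing.Theory.

Local Open Scope ring_scope.

(* MathComp's algType requires 1 != 0; the zero algebra is allowed here. *)
Record kalgebra (k : comPzRingType) := KAlgebra {
  kring :> pzRingType;
  kstr : {rmorphism k -> kring};
  kstr_central : forall (c : k) (r : kring), kstr c * r = r * kstr c
}.

(* The additive map U -> V sending g i to v i for all i.  It is used only
   with families g that generate the group U, so that there is at most one
   such map; when there is none, the value is the zero map. *)
Definition extend (I : Type) (U V : zmodType) (g : I -> U) (v : I -> V) :
    U -> V :=
  xget (fun=> 0) [set f | zmod_morphism f /\ forall i, f (g i) = v i]%classic.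

Lemma zmod_morph0 (U V : zmodType) (f : U -> V) : zmod_morphism f -> f 0 = 0.
Proof. by move=> fD; rewrite -[X in f X](subrr 0) fD subrr. Qed.

Lemma zmod_morphD (U V : zmodType) (f : U -> V) :
  zmod_morphism f -> {morph f : x y / x + y}.
Proof.
move=> fD x y; have f0 := zmod_morph0 fD.
by rewrite -[y in LHS]opprK fD -[- y]add0r fD f0 add0r opprK.
Qed.

Lemma extend_additive (I : Type) (U V : zmodType) (g : I -> U) (v : I -> V) :
  zmod_morphism (extend g v).
Proof.
rewrite /extend; case: xgetP => [f _ []|_] //.
by move=> x y; rewrite subr0.
Qed.

Lemma extendE (I : Type) (U V : zmodType) (g : I -> U) (v : I -> V) (f : U -> V) :
  zmod_morphism f -> (forall i, f (g i) = v i) -> forall i, extend g v (g i) = v i.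
Proof.
move=> fD fg; rewrite /extend.
by case: xgetP => [h _ []|/(_ f) []].
Qed.

Section Quotient.
Variables (T : Type) (E : T -> T -> Prop).

Definition quo := {c : T -> Prop | exists t, c = E t}.

HB.instance Definition _ := gen_eqMixin quo.
HB.instance Definition _ := gen_choiceMixin quo.

Definition cls (t : T) : quo := exist _ (E t) (ex_intro _ t erefl).
Definition repr (q : quo) : T := projT1 (cid (projT2 q)).

Lemma reprK q : cls (repr q) = q.
Proof.
rewrite /repr; case: cid => t; case: q => c e /= ct.
by apply: eq_exist; rewrite ct.
Qed.

Lemma quo_ind (P : quo -> Prop) : (forall t, P (cls t)) -> forall q, P q.
Proof. by move=> Pcls q; rewrite -[q]reprK. Qed.

Hypothesis E_refl : forall t, E t t.
Hypothesis E_sym : forall s t, E s t -> E t s.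
Hypothesis E_trans : forall s t u, E s t -> E t u -> E s u.

Lemma clsP s t : E s t -> cls s = cls t.
Proof.
move=> st; apply: eq_exist; apply/funext => u; apply/propext.
by split; [apply: E_trans (E_sym st)|apply: E_trans st].
Qed.

Lemma repr_cls t : E (repr (cls t)) t.
Proof.
have : E (repr (cls t)) = E t by have /(congr1 (@proj1_sig _ _)) := reprK (cls t).
by move=> ->.
Qed.

End Quotient.

Inductive mterm (S X : Type) : Type :=
| MGen of X | MZero | MAdd of mterm S X & mterm S X
| MOpp of mterm S X | MScale of S & mterm S X.
Arguments MGen {S X}.
Arguments MZero {S X}.

Section PresentedModule.
Variables (S : pzRingType) (X : Type) (rel : mterm S X -> mterm S X -> Prop).
Local Notation term := (mterm S X).

Inductive mcong : term -> term -> Prop :=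
| mc_rel s t : rel s t -> mcong s t
| mc_refl t : mcong t t
| mc_sym s t : mcong s t -> mcong t s
| mc_trans s t u : mcong s t -> mcong t u -> mcong s u
| mc_add s s' t t' : mcong s s' -> mcong t t' -> mcong (MAdd s t) (MAdd s' t')
| mc_opp s s' : mcong s s' -> mcong (MOpp s) (MOpp s')
| mc_scale a s s' : mcong s s' -> mcong (MScale a s) (MScale a s')
| mc_addA s t u : mcong (MAdd s (MAdd t u)) (MAdd (MAdd s t) u)
| mc_addC s t : mcong (MAdd s t) (MAdd t s)
| mc_add0 t : mcong (MAdd MZero t) t
| mc_addN t : mcong (MAdd (MOpp t) t) MZero
| mc_scaleA a b t : mcong (MScale a (MScale b t)) (MScale (a * b) t)
| mc_scale1 t : mcong (MScale 1 t) t
| mc_scaleDr a s t : mcong (MScale a (MAdd s t)) (MAdd (MScale a s) (MScale a t))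
| mc_scaleDl a b t : mcong (MScale (a + b) t) (MAdd (MScale a t) (MScale b t)).

(* The left S-module generated by X subject to the relations rel. *)
Definition pmod := quo mcong.
Local Notation "[ t ]" := (cls mcong t : pmod).

HB.instance Definition _ := Choice.on pmod.

Definition pmod_zero : pmod := [MZero].
Definition pmod_add (p q : pmod) : pmod := [MAdd (repr p) (repr q)].
Definition pmod_opp (p : pmod) : pmod := [MOpp (repr p)].
Definition pmod_scale (a : S) (p : pmod) : pmod := [MScale a (repr p)].

Lemma mcong_cls s t : mcong s t -> [s] = [t].
Proof. exact: clsP mc_sym mc_trans _ _. Qed.

Lemma mrepr_cls t : mcong (repr [t]) t.
Proof. exact: (repr_cls mc_refl). Qed.

Lemma pmod_addE s t : pmod_add [s] [t] = [MAdd s t].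
Proof. by apply: mcong_cls; apply: mc_add; apply: mrepr_cls. Qed.

Lemma pmod_oppE s : pmod_opp [s] = [MOpp s].
Proof. by apply: mcong_cls; apply: mc_opp; apply: mrepr_cls. Qed.

Lemma pmod_scaleE a s : pmod_scale a [s] = [MScale a s].
Proof. by apply: mcong_cls; apply: mc_scale; apply: mrepr_cls. Qed.

Lemma pmod_addA : associative pmod_add.
Proof.
by elim/quo_ind => s; elim/quo_ind => t; elim/quo_ind => u;
   rewrite !pmod_addE; apply: mcong_cls; apply: mc_addA.
Qed.

Lemma pmod_addC : commutative pmod_add.
Proof.
by elim/quo_ind => s; elim/quo_ind => t; rewrite !pmod_addE; apply: mcong_cls; apply: mc_addC.
Qed.

Lemma pmod_add0 : left_id pmod_zero pmod_add.
Proof. by elim/quo_ind => s; rewrite !pmod_addE; apply: mcong_cls; apply: mc_add0. Qed.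

Lemma pmod_addN : left_inverse pmod_zero pmod_opp pmod_add.
Proof.
by elim/quo_ind => s; rewrite !pmod_oppE !pmod_addE; apply: mcong_cls; apply: mc_addN.
Qed.

HB.instance Definition _ :=
  GRing.isZmodule.Build pmod pmod_addA pmod_addC pmod_add0 pmod_addN.

Lemma pmod_scaleA a b p : pmod_scale a (pmod_scale b p) = pmod_scale (a * b) p.
Proof.
by elim/quo_ind: p => t; rewrite !pmod_scaleE; apply: mcong_cls; apply: mc_scaleA.
Qed.

Lemma pmod_scale1 : left_id 1 pmod_scale.
Proof. by elim/quo_ind => t; rewrite !pmod_scaleE; apply: mcong_cls; apply: mc_scale1. Qed.

Lemma pmod_scaleDr : right_distributive pmod_scale +%R.
Proof.
move=> a; elim/quo_ind => s; elim/quo_ind => t.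
by rewrite /GRing.add /= !(pmod_scaleE, pmod_addE); apply: mcong_cls; apply: mc_scaleDr.
Qed.

Lemma pmod_scaleDl p : {morph pmod_scale^~ p : a b / a + b}.
Proof.
move=> a b; elim/quo_ind: p => t.
rewrite [RHS]/GRing.add /= !(pmod_scaleE, pmod_addE).
by apply: mcong_cls; apply: mc_scaleDl.
Qed.

HB.instance Definition _ := GRing.Zmodule_isLmodule.Build S pmod
  pmod_scaleA pmod_scale1 pmod_scaleDr pmod_scaleDl.

Definition pgen (x : X) : pmod := [MGen x].

Section Eval.
Variables (V : lmodType S) (v : X -> V).

Fixpoint meval (t : term) : V :=
  match t with
  | MGen x => v x
  | MZero => 0
  | MAdd s t => meval s + meval t
  | MOpp s => - meval s
  | MScale a s => a *: meval s
  end.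

Hypothesis v_rel : forall s t, rel s t -> meval s = meval t.

Lemma meval_cong s t : mcong s t -> meval s = meval t.
Proof.
elim=> {s t} //=; try by [move=> *; congruence].
- by move=> ? ? ?; rewrite addrA.
- by move=> ? ?; rewrite addrC.
- by move=> ?; rewrite add0r.
- by move=> ?; rewrite addNr.
- by move=> ? ? ?; rewrite scalerA.
- by move=> ?; rewrite scale1r.
- by move=> ? ? ?; rewrite scalerDr.
- by move=> ? ? ?; rewrite scalerDl.
Qed.

Lemma pmod_lift : exists f : pmod -> V, linear f /\ forall x, f (pgen x) = v x.
Proof.
pose f (p : pmod) := meval (repr p).
have fE t : f [t] = meval t by apply: meval_cong; apply: mrepr_cls.
exists f; split=> [a p q|x]; last by rewrite fE.
elim/quo_ind: p => s; elim/quo_ind: q => t.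
by rewrite /GRing.add /GRing.scale /= pmod_scaleE pmod_addE !fE.
Qed.

End Eval.

Lemma pmod_rel s t : rel s t -> meval pgen s = meval pgen t.
Proof.
suff mE u : meval pgen u = [u] by move=> st; rewrite !mE; apply/mcong_cls/mc_rel.
elim: u => //= [s' -> t' ->|s' ->|a s' ->].
- exact: pmod_addE.
- exact: pmod_oppE.
- exact: pmod_scaleE.
Qed.

Lemma pmod_ind (P : pmod -> Prop) :
    P 0 -> (forall p q, P p -> P q -> P (p + q)) ->
    (forall a x, P (a *: pgen x)) -> forall p, P p.
Proof.
move=> P0 PD Pg; elim/quo_ind => t.
have mE u : meval pgen u = [u].
  elim: u => //= [s' -> t' ->|s' ->|a s' ->].
  - exact: pmod_addE.
  - exact: pmod_oppE.
  - exact: pmod_scaleE.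
suff H a : P (a *: [t]) by rewrite -[X in P X](scale1r ([t] : pmod)).
rewrite -mE; elim: t a => [x||s IHs t IHt|s IHs|b s IHs] a /=.
- exact: Pg.
- by rewrite scaler0.
- by rewrite scalerDr; apply: PD.
- by rewrite scalerN -scaleNr.
- by rewrite scalerA.
Qed.

Lemma extend_pgen (V : lmodType S) (v : X -> V) :
    (forall s t, rel s t -> meval v s = meval v t) ->
  forall x, extend pgen v (pgen x) = v x.
Proof.
move=> v_rel x; have [f [flin fE]] := pmod_lift v_rel.
apply: (extendE (f := f)) => //.
exact: (GRing.zmod_morphism_linear flin).
Qed.

Section AdditiveLift.
Variables (V : zmodType) (v : S -> X -> V).

Fixpoint maeval (a : S) (t : term) : V :=
  match t with
  | MGen x => v a x
  | MZero => 0
  | MAdd s t => maeval a s + maeval a t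
  | MOpp s => - maeval a s
  | MScale b s => maeval (a * b) s
  end.

Hypothesis vD : forall a b x, v (a + b) x = v a x + v b x.
Hypothesis v_rel : forall s t, rel s t -> forall a, maeval a s = maeval a t.

Lemma maevalD a b t : maeval (a + b) t = maeval a t + maeval b t.
Proof.
elim: t a b => [x||s IHs t IHt|s IHs|c s IHs] a b /=.
- exact: vD.
- by rewrite addr0.
- by rewrite IHs IHt addrACA.
- by rewrite IHs opprD.
- by rewrite mulrDl.
Qed.

Lemma maeval_cong s t : mcong s t -> forall a, maeval a s = maeval a t.
Proof.
elim=> {s t} /=.
- exact: v_rel.
- by [].
- by move=> s t _ IH a; rewrite IH.
- by move=> s t u _ IH1 _ IH2 a; rewrite IH1.
- by move=> s s' t t' _ IH1 _ IH2 a; rewrite IH1 IH2.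
- by move=> s s' _ IH a; rewrite IH.
- by move=> b s s' _ IH a; rewrite IH.
- by move=> s t u a; rewrite addrA.
- by move=> s t a; rewrite addrC.
- by move=> t a; rewrite add0r.
- by move=> t a; rewrite addNr.
- by move=> a b t c; rewrite mulrA.
- by move=> t a; rewrite mulr1.
- by [].
- by move=> a b t c; rewrite mulrDr maevalD.
Qed.

Lemma extend_pgen_add x : extend pgen (v 1) (pgen x) = v 1 x.
Proof.
pose f (p : pmod) := maeval 1 (repr p).
have fE t : f [t] = maeval 1 t by apply: maeval_cong; apply: mrepr_cls.
apply: (extendE (f := f)) => [p q|y]; last by rewrite fE.
elim/quo_ind: p => s; elim/quo_ind: q => t.
by rewrite [- [t]]pmod_oppE [_ + _]pmod_addE !fE.
Qed.

End AdditiveLift.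

End PresentedModule.

Inductive rterm (X : Type) : Type :=
| RGen of X | RZero | ROne | RAdd of rterm X & rterm X | ROpp of rterm X
| RMul of rterm X & rterm X.
Arguments RZero {X}.
Arguments ROne {X}.

Section PresentedRing.
Variables (X : Type) (rel : rterm X -> rterm X -> Prop).
Local Notation term := (rterm X).

Inductive rcong : term -> term -> Prop :=
| rc_rel s t : rel s t -> rcong s t
| rc_refl t : rcong t t
| rc_sym s t : rcong s t -> rcong t s
| rc_trans s t u : rcong s t -> rcong t u -> rcong s u
| rc_add s s' t t' : rcong s s' -> rcong t t' -> rcong (RAdd s t) (RAdd s' t')
| rc_opp s s' : rcong s s' -> rcong (ROpp s) (ROpp s')
| rc_mul s s' t t' : rcong s s' -> rcong t t' -> rcong (RMul s t) (RMul s' t')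
| rc_addA s t u : rcong (RAdd s (RAdd t u)) (RAdd (RAdd s t) u)
| rc_addC s t : rcong (RAdd s t) (RAdd t s)
| rc_add0 t : rcong (RAdd RZero t) t
| rc_addN t : rcong (RAdd (ROpp t) t) RZero
| rc_mulA s t u : rcong (RMul s (RMul t u)) (RMul (RMul s t) u)
| rc_mul1l t : rcong (RMul ROne t) t
| rc_mul1r t : rcong (RMul t ROne) t
| rc_mulDl s t u : rcong (RMul (RAdd s t) u) (RAdd (RMul s u) (RMul t u))
| rc_mulDr s t u : rcong (RMul s (RAdd t u)) (RAdd (RMul s t) (RMul s u)).

(* The ring generated by X subject to the relations rel. *)
Definition pring := quo rcong.
Local Notation "[ t ]" := (cls rcong t : pring).

HB.instance Definition _ := Choice.on pring.

Definition pring_zero : pring := [RZero].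
Definition pring_one : pring := [ROne].
Definition pring_add (p q : pring) : pring := [RAdd (repr p) (repr q)].
Definition pring_opp (p : pring) : pring := [ROpp (repr p)].
Definition pring_mul (p q : pring) : pring := [RMul (repr p) (repr q)].

Lemma rcong_cls s t : rcong s t -> [s] = [t].
Proof. exact: clsP rc_sym rc_trans _ _. Qed.

Lemma rrepr_cls t : rcong (repr [t]) t.
Proof. exact: (repr_cls rc_refl). Qed.

Lemma pring_addE s t : pring_add [s] [t] = [RAdd s t].
Proof. by apply: rcong_cls; apply: rc_add; apply: rrepr_cls. Qed.

Lemma pring_oppE s : pring_opp [s] = [ROpp s].
Proof. by apply: rcong_cls; apply: rc_opp; apply: rrepr_cls. Qed.

Lemma pring_mulE s t : pring_mul [s] [t] = [RMul s t].
Proof. by apply: rcong_cls; apply: rc_mul; apply: rrepr_cls. Qed.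

Lemma pring_addA : associative pring_add.
Proof.
by elim/quo_ind => s; elim/quo_ind => t; elim/quo_ind => u;
   rewrite !pring_addE; apply: rcong_cls; apply: rc_addA.
Qed.

Lemma pring_addC : commutative pring_add.
Proof.
by elim/quo_ind => s; elim/quo_ind => t;
   rewrite !pring_addE; apply: rcong_cls; apply: rc_addC.
Qed.

Lemma pring_add0 : left_id pring_zero pring_add.
Proof.
by elim/quo_ind => s; rewrite !pring_addE; apply: rcong_cls; apply: rc_add0.
Qed.

Lemma pring_addN : left_inverse pring_zero pring_opp pring_add.
Proof.
by elim/quo_ind => s; rewrite !pring_oppE !pring_addE; apply: rcong_cls; apply: rc_addN.
Qed.

HB.instance Definition _ :=
  GRing.isZmodule.Build pring pring_addA pring_addC pring_add0 pring_addN.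

Lemma pring_mulA : associative pring_mul.
Proof.
by elim/quo_ind => s; elim/quo_ind => t; elim/quo_ind => u;
   rewrite !pring_mulE; apply: rcong_cls; apply: rc_mulA.
Qed.

Lemma pring_mul1l : left_id pring_one pring_mul.
Proof. by elim/quo_ind => s; rewrite !pring_mulE; apply: rcong_cls; apply: rc_mul1l. Qed.

Lemma pring_mul1r : right_id pring_one pring_mul.
Proof. by elim/quo_ind => s; rewrite !pring_mulE; apply: rcong_cls; apply: rc_mul1r. Qed.

Lemma pring_mulDl : left_distributive pring_mul +%R.
Proof.
elim/quo_ind => s; elim/quo_ind => t; elim/quo_ind => u.
by rewrite /GRing.add /= !(pring_mulE, pring_addE); apply: rcong_cls; apply: rc_mulDl.
Qed.

Lemma pring_mulDr : right_distributive pring_mul +%R.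
Proof.
elim/quo_ind => s; elim/quo_ind => t; elim/quo_ind => u.
by rewrite /GRing.add /= !(pring_mulE, pring_addE); apply: rcong_cls; apply: rc_mulDr.
Qed.

HB.instance Definition _ := GRing.Zmodule_isPzRing.Build pring
  pring_mulA pring_mul1l pring_mul1r pring_mulDl pring_mulDr.

Definition rgen (x : X) : pring := [RGen x].

Fixpoint reval (T : pzRingType) (v : X -> T) (t : term) : T :=
  match t with
  | RGen x => v x
  | RZero => 0
  | ROne => 1
  | RAdd s t => reval v s + reval v t
  | ROpp s => - reval v s
  | RMul s t => reval v s * reval v t
  end.

Lemma pring_rel s t : rel s t -> reval rgen s = reval rgen t.
Proof.
suff rE u : reval rgen u = [u] by move=> st; rewrite !rE; apply/rcong_cls/rc_rel.
elim: u => //= [s' -> t' ->|s' ->|s' -> t' ->].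
- exact: pring_addE.
- exact: pring_oppE.
- exact: pring_mulE.
Qed.

End PresentedRing.

(* The quotient of the ring T by the two-sided ideal generated by the
   differences x - y with rel x y. *)
Section RingQuotient.
Variables (T : pzRingType) (rel : T -> T -> Prop).

Inductive rquot_rel : rterm T -> rterm T -> Prop :=
| rq_one : rquot_rel (RGen 1) ROne
| rq_add x y : rquot_rel (RGen (x + y)) (RAdd (RGen x) (RGen y))
| rq_mul x y : rquot_rel (RGen (x * y)) (RMul (RGen x) (RGen y))
| rq_rel x y : rel x y -> rquot_rel (RGen x) (RGen y).

Definition rquot : pzRingType := pring rquot_rel.
Definition rproj (x : T) : rquot := rgen rquot_rel x.

Lemma rproj1 : rproj 1 = 1.
Proof. exact: (pring_rel rq_one). Qed.

Lemma rprojM x y : rproj (x * y) = rproj x * rproj y.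
Proof. exact: (pring_rel (rq_mul x y)). Qed.

Lemma rprojD x y : rproj (x + y) = rproj x + rproj y.
Proof. exact: (pring_rel (rq_add x y)). Qed.

Lemma rproj_rel x y : rel x y -> rproj x = rproj y.
Proof. by move=> xy; exact: (pring_rel (rq_rel xy)). Qed.

End RingQuotient.

(* The tensor ring \bigoplus_n M \otimes_S ... \otimes_S M of an S-bimodule M,
   given by its presentation as the ring generated by S and M subject to: S is
   mapped by a ring morphism and M by an S-bimodule morphism. *)
Section TensorRing.
Variables (S : pzRingType) (M : zmodType) (la : S -> M -> M) (ra : M -> S -> M).

Local Notation scal := (fun s : S => RGen (inl M s)).
Local Notation vect := (fun m : M => RGen (inr S m)).

Inductive tring_rel : rterm (S + M)%type -> rterm (S + M)%type -> Prop :=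
| tr_one : tring_rel (scal 1) ROne
| tr_sadd s s' : tring_rel (scal (s + s')) (RAdd (scal s) (scal s'))
| tr_smul s s' : tring_rel (scal (s * s')) (RMul (scal s) (scal s'))
| tr_vadd m m' : tring_rel (vect (m + m')) (RAdd (vect m) (vect m'))
| tr_lact s m : tring_rel (vect (la s m)) (RMul (scal s) (vect m))
| tr_ract m s : tring_rel (vect (ra m s)) (RMul (vect m) (scal s)).

Definition tring : pzRingType := pring tring_rel.
Definition tscal (s : S) : tring := rgen tring_rel (inl M s).
Definition tvect (m : M) : tring := rgen tring_rel (inr S m).

Lemma tscal1 : tscal 1 = 1.
Proof. exact: (pring_rel tr_one). Qed.

Lemma tscalM s t : tscal (s * t) = tscal s * tscal t.
Proof. exact: (pring_rel (tr_smul s t)). Qed.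

Lemma tscalD s t : tscal (s + t) = tscal s + tscal t.
Proof. exact: (pring_rel (tr_sadd s t)). Qed.

End TensorRing.

(* M \otimes_T N for a left S-module M with a right T-action ra and a left
   T-action la on N, as the left S-module generated by the symbols m \otimes n.
   When M is an (S, T)-bimodule the relation tens_scale only records the
   S-module structure that M induces on the tensor product over T. *)
Section Tensor.
Variables (S : pzRingType) (T : Type) (M : lmodType S) (N : zmodType).
Variables (ra : M -> T -> M) (la : T -> N -> N).

Inductive tens_rel : mterm S (M * N) -> mterm S (M * N) -> Prop :=
| tens_addl m m' n :
    tens_rel (MGen (m + m', n)) (MAdd (MGen (m, n)) (MGen (m', n)))
| tens_addr m n n' :
    tens_rel (MGen (m, n + n')) (MAdd (MGen (m, n)) (MGen (m, n')))
| tens_scale s m n : tens_rel (MGen (s *: m, n)) (MScale s (MGen (m, n)))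
| tens_bal m t n : tens_rel (MGen (ra m t, n)) (MGen (m, la t n)).

Definition tens : lmodType S := pmod tens_rel.
Definition tmk (m : M) (n : N) : tens := pgen tens_rel (m, n).

Lemma tmkDl m m' n : tmk (m + m') n = tmk m n + tmk m' n.
Proof. exact: (pmod_rel (tens_addl m m' n)). Qed.

Lemma tmkDr m n n' : tmk m (n + n') = tmk m n + tmk m n'.
Proof. exact: (pmod_rel (tens_addr m n n')). Qed.

Lemma tmkZ s m n : tmk (s *: m) n = s *: tmk m n.
Proof. exact: (pmod_rel (tens_scale s m n)). Qed.

Lemma tmk_bal m t n : tmk (ra m t) n = tmk m (la t n).
Proof. exact: (pmod_rel (tens_bal m t n)). Qed.

Lemma tens_ind (P : tens -> Prop) :
    P 0 -> (forall x y, P x -> P y -> P (x + y)) ->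
    (forall m n, P (tmk m n)) -> forall x, P x.
Proof.
move=> P0 PD Pm; elim/pmod_ind => // a [m n].
by rewrite -[pgen _ _]/(tmk m n) -tmkZ.
Qed.

Definition tlift (V : zmodType) (h : M -> N -> V) : tens -> V :=
  extend (fun p : M * N => tmk p.1 p.2) (fun p => h p.1 p.2).

Lemma tliftD V h : zmod_morphism (@tlift V h).
Proof. exact: extend_additive. Qed.

Lemma tliftE (V : lmodType S) (h : M -> N -> V) :
    (forall m m' n, h (m + m') n = h m n + h m' n) ->
    (forall m n n', h m (n + n') = h m n + h m n') ->
    (forall s m n, h (s *: m) n = s *: h m n) ->
    (forall m t n, h (ra m t) n = h m (la t n)) ->
  forall m n, tlift h (tmk m n) = h m n.
Proof.
move=> hDl hDr hZ hb m n; rewrite /tlift /tmk.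
have E : (fun p : M * N => pgen tens_rel (p.1, p.2)) = pgen tens_rel.
  by apply/funext => -[].
rewrite -[pgen tens_rel (m, n)]/((fun p : M * N => pgen tens_rel (p.1, p.2)) (m, n)).
rewrite E (extend_pgen (v := fun p => h p.1 p.2)) // => s t [] /= *.
- exact: hDl.
- exact: hDr.
- exact: hZ.
- exact: hb.
Qed.

Lemma tlift_addE (V : zmodType) (h : M -> N -> V) :
    (forall m m' n, h (m + m') n = h m n + h m' n) ->
    (forall m n n', h m (n + n') = h m n + h m n') ->
    (forall s m t n, h (s *: ra m t) n = h (s *: m) (la t n)) ->
  forall m n, tlift h (tmk m n) = h m n.
Proof.
move=> hDl hDr hb m n; rewrite /tlift /tmk.
have E : (fun p : M * N => pgen tens_rel (p.1, p.2)) = pgen tens_rel.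
  by apply/funext => -[].
have E1 : (fun p : M * N => h p.1 p.2) = (fun p => h (1 *: p.1) p.2).
  by apply/funext => p; rewrite scale1r.
rewrite E E1 (extend_pgen_add (v := fun a p => h (a *: p.1) p.2)) /= ?scale1r //.
- by move=> a b x; rewrite scalerDl hDl.
- move=> s t [] /= *.
  + by rewrite scalerDr hDl.
  + exact: hDr.
  + by rewrite scalerA.
  + exact: hb.
Qed.

End Tensor.

Section DirectSum.
Variables (S : pzRingType) (I : eqType) (V : I -> lmodType S).

Record dsum := DSum {
  dsum_fun :> forall i, V i;
  dsum_fin : exists s : seq I, forall i, i \notin s -> dsum_fun i = 0
}.

HB.instance Definition _ := gen_eqMixin dsum.
HB.instance Definition _ := gen_choiceMixin dsum.

Lemma dsumP (x y : dsum) : (forall i, x i = y i) -> x = y.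
Proof.
case: x y => [f pf] [g pg] /= fg.
have E : f = g by apply: functional_extensionality_dep.
by subst g; rewrite (Prop_irrelevance pf pg).
Qed.

Fact dsum_zero_fin : exists s : seq I, forall i, i \notin s -> 0 = 0 :> V i.
Proof. by exists [::]. Qed.
Definition dsum_zero := DSum dsum_zero_fin.

Fact dsum_opp_fin (x : dsum) :
  exists s : seq I, forall i, i \notin s -> - x i = 0.
Proof. by have [s xs] := dsum_fin x; exists s => i /xs ->; rewrite oppr0. Qed.
Definition dsum_opp x := DSum (dsum_opp_fin x).

Fact dsum_add_fin (x y : dsum) :
  exists s : seq I, forall i, i \notin s -> x i + y i = 0.
Proof.
have [[s xs] [t yt]] := (dsum_fin x, dsum_fin y); exists (s ++ t) => i.
by rewrite mem_cat negb_or => /andP[/xs -> /yt ->]; rewrite addr0.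
Qed.
Definition dsum_add x y := DSum (dsum_add_fin x y).

Fact dsum_scale_fin (a : S) (x : dsum) :
  exists s : seq I, forall i, i \notin s -> a *: x i = 0.
Proof. by have [s xs] := dsum_fin x; exists s => i /xs ->; rewrite scaler0. Qed.
Definition dsum_scale a x := DSum (dsum_scale_fin a x).

Fact dsum_addA : associative dsum_add.
Proof. by move=> x y z; apply: dsumP => i; rewrite /= addrA. Qed.
Fact dsum_addC : commutative dsum_add.
Proof. by move=> x y; apply: dsumP => i; rewrite /= addrC. Qed.
Fact dsum_add0 : left_id dsum_zero dsum_add.
Proof. by move=> x; apply: dsumP => i; rewrite /= add0r. Qed.
Fact dsum_addN : left_inverse dsum_zero dsum_opp dsum_add.
Proof. by move=> x; apply: dsumP => i; rewrite /= addNr. Qed.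

HB.instance Definition _ :=
  GRing.isZmodule.Build dsum dsum_addA dsum_addC dsum_add0 dsum_addN.

Fact dsum_scaleA a b x : dsum_scale a (dsum_scale b x) = dsum_scale (a * b) x.
Proof. by apply: dsumP => i; rewrite /= scalerA. Qed.
Fact dsum_scale1 : left_id 1 dsum_scale.
Proof. by move=> x; apply: dsumP => i; rewrite /= scale1r. Qed.
Fact dsum_scaleDr : right_distributive dsum_scale +%R.
Proof. by move=> a x y; apply: dsumP => i; rewrite /= scalerDr. Qed.
Fact dsum_scaleDl x : {morph dsum_scale^~ x : a b / a + b}.
Proof. by move=> a b; apply: dsumP => i; rewrite /= scalerDl. Qed.

HB.instance Definition _ := GRing.Zmodule_isLmodule.Build S dsum
  dsum_scaleA dsum_scale1 dsum_scaleDr dsum_scaleDl.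

Fact din_fin i (v : V i) :
  exists s : seq I, forall j, j \notin s -> dfwith (fun j => 0 : V j) v j = 0.
Proof.
exists [:: i] => j; rewrite inE; case: dfwithP => //; first by rewrite eqxx.
Qed.

Definition din i (v : V i) : dsum := DSum (din_fin v).

End DirectSum.

Record bimod (S T : pzRingType) := Bimod {
  bcar :> lmodType S;
  bract : bcar -> T -> bcar;
  bractDl : forall m m' t, bract (m + m') t = bract m t + bract m' t;
  bractDr : forall m t t', bract m (t + t') = bract m t + bract m t';
  bractA : forall m t t', bract (bract m t) t' = bract m (t * t');
  bract1 : forall m, bract m 1 = m;
  bractZ : forall s m t, bract (s *: m) t = s *: bract m t
}.

(* M \otimes_T N for an (S, T)-bimodule M and a left T-module N. *)
Notation btens M N := (tens (@bract _ _ M) (@GRing.scale _ N)).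

Section BimoduleTensor.
Variables (S T U : pzRingType) (M : bimod S T) (N : bimod T U).

Definition tens_ract (z : btens M N) (u : U) : btens M N :=
  tlift (fun m n => tmk _ _ m (bract n u)) z.

Lemma tens_ractE m n u : tens_ract (tmk _ _ m n) u = tmk _ _ m (bract n u).
Proof.
rewrite /tens_ract tliftE // => *.
- exact: tmkDl.
- by rewrite bractDl tmkDr.
- exact: tmkZ.
- by rewrite bractZ tmk_bal.
Qed.

Lemma tens_ractDl z z' u : tens_ract (z + z') u = tens_ract z u + tens_ract z' u.
Proof.
have fD : zmod_morphism (tens_ract^~ u) by move=> x y; exact: tliftD.
pose f := HB.pack (tens_ract^~ u) (GRing.isZmodMorphism.Build _ _ _ fD) : {additive _ -> _}.
exact: (raddfD f).
Qed.

Lemma tens_ract0 u : tens_ract 0 u = 0.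
Proof. by apply: (addrI (tens_ract 0 u)); rewrite -tens_ractDl !addr0. Qed.

Fact tens_ractDr z t t' : tens_ract z (t + t') = tens_ract z t + tens_ract z t'.
Proof.
elim/tens_ind: z => [|x y IHx IHy|m n]; first by rewrite !tens_ract0 addr0.
  by rewrite !tens_ractDl IHx IHy addrACA.
by rewrite !tens_ractE bractDr tmkDr.
Qed.

Fact tens_ractA z t t' : tens_ract (tens_ract z t) t' = tens_ract z (t * t').
Proof.
elim/tens_ind: z => [|x y IHx IHy|m n]; first by rewrite !tens_ract0.
  by rewrite !tens_ractDl IHx IHy.
by rewrite !tens_ractE bractA.
Qed.

Fact tens_ract1 z : tens_ract z 1 = z.
Proof.
elim/tens_ind: z => [|x y IHx IHy|m n]; first by rewrite !tens_ract0.
  by rewrite !tens_ractDl IHx IHy.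
by rewrite !tens_ractE bract1.
Qed.

Fact tens_ractZ s z t : tens_ract (s *: z) t = s *: tens_ract z t.
Proof.
elim/tens_ind: z => [|x y IHx IHy|m n]; first by rewrite !(scaler0, tens_ract0).
  by rewrite scalerDr !tens_ractDl IHx IHy scalerDr.
by rewrite -tmkZ !tens_ractE tmkZ.
Qed.

Definition tens_bimod : bimod S U :=
  Bimod tens_ractDl tens_ractDr tens_ractA tens_ract1 tens_ractZ.

End BimoduleTensor.

Section TrivialExtension.
Variable R : pzRingType.

(* (a, b) stands for a + b t. *)
Definition triv : Type := (R * R)%type.

HB.instance Definition _ := GRing.Zmodule.on triv.

Definition triv_one : triv := (1, 0).
Definition triv_mul (x y : triv) : triv := (x.1 * y.1, x.1 * y.2 + x.2 * y.1).

Fact triv_mulA : associative triv_mul.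
Proof.
move=> [a b] [c d] [e f]; congr pair => /=; first by rewrite mulrA.
by rewrite !mulrDl !mulrDr !mulrA addrA.
Qed.
Fact triv_mul1l : left_id triv_one triv_mul.
Proof. by move=> [a b]; rewrite /triv_mul /= !mul1r mul0r addr0. Qed.
Fact triv_mul1r : right_id triv_one triv_mul.
Proof. by move=> [a b]; rewrite /triv_mul /= !mulr1 mulr0 add0r. Qed.
Fact triv_mulDl : left_distributive triv_mul +%R.
Proof.
by move=> [a b] [c d] [e f]; congr pair; rewrite /= !mulrDl // addrACA.
Qed.
Fact triv_mulDr : right_distributive triv_mul +%R.
Proof.
by move=> [a b] [c d] [e f]; congr pair; rewrite /= !mulrDr // addrACA.
Qed.

HB.instance Definition _ := GRing.Zmodule_isPzRing.Build triv
  triv_mulA triv_mul1l triv_mul1r triv_mulDl triv_mulDr.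

End TrivialExtension.

Definition triv_in (R : pzRingType) (r : R) : triv R := (r, 0).

Section TrivialExtensionTheory.
Variable R : pzRingType.
Local Notation A := (triv R).

Fact triv_in1 : triv_in 1 = 1 :> A. Proof. by []. Qed.
Fact triv_inD (r s : R) : triv_in (r + s) = triv_in r + triv_in s :> A.
Proof. by congr pair; rewrite /= addr0. Qed.
Fact triv_inM (r s : R) : triv_in (r * s) = triv_in r * triv_in s :> A.
Proof. by congr pair; rewrite /= mulr0 mul0r addr0. Qed.

(* Restriction of scalars along R -> A. *)
Definition restr (V : lmodType A) : Type := V.

HB.instance Definition _ V := GRing.Zmodule.on (restr V).

Definition restr_scale V (r : R) (v : restr V) : restr V :=
  (triv_in r : A) *: (v : V).

Fact restr_scaleA V a b (v : restr V) :
  restr_scale a (restr_scale b v) = restr_scale (a * b) v.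
Proof. by rewrite /restr_scale scalerA triv_inM. Qed.
Fact restr_scale1 V : left_id 1 (@restr_scale V).
Proof. by move=> v; rewrite /restr_scale triv_in1 scale1r. Qed.
Fact restr_scaleDr V : right_distributive (@restr_scale V) +%R.
Proof. by move=> a u v; rewrite /restr_scale -scalerDr. Qed.
Fact restr_scaleDl V v : {morph (@restr_scale V)^~ v : a b / a + b}.
Proof. by move=> a b; rewrite /restr_scale triv_inD scalerDl. Qed.

HB.instance Definition _ V := GRing.Zmodule_isLmodule.Build R (restr V)
  (@restr_scaleA V) (@restr_scale1 V) (@restr_scaleDr V) (@restr_scaleDl V).

End TrivialExtensionTheory.

Section LeftDual.
Variable R : pzRingType.
Local Notation A := (triv R).

Record dual := Dual {
  dual_fun :> A -> R;
  dual_lin : linear (dual_fun : restr A^o -> R^o)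
}.

HB.instance Definition _ := gen_eqMixin dual.
HB.instance Definition _ := gen_choiceMixin dual.

Lemma dualP (f g : dual) : (forall x, f x = g x) -> f = g.
Proof.
case: f g => [f pf] [g pg] /= /funext fg.
by subst g; rewrite (Prop_irrelevance pf pg).
Qed.

Lemma dualZ (f : dual) r x : f (triv_in r * x) = r * f x.
Proof.
have f0 : f 0 = 0.
  have := dual_lin f 1 0 0; rewrite !scale1r addr0 => /(congr1 (+%R^~ (- f 0))).
  by rewrite addrK subrr.
by have := dual_lin f r x 0; rewrite addr0 [f 0]f0 addr0.
Qed.

Lemma dualD (f : dual) x y : f (x + y) = f x + f y.
Proof. by have := dual_lin f 1 x y; rewrite !scale1r. Qed.

Fact dual_zero_lin : linear ((fun=> 0) : restr A^o -> R^o).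
Proof. by move=> r x y; rewrite scaler0 addr0. Qed.
Definition dual_zero := Dual dual_zero_lin.

Fact dual_opp_lin (f : dual) : linear ((fun x => - f x) : restr A^o -> R^o).
Proof. by move=> r x y; rewrite dual_lin opprD scalerN. Qed.
Definition dual_opp f := Dual (dual_opp_lin f).

Fact dual_add_lin (f g : dual) :
  linear ((fun x => f x + g x) : restr A^o -> R^o).
Proof. by move=> r x y; rewrite !dual_lin scalerDr addrACA. Qed.
Definition dual_add f g := Dual (dual_add_lin f g).

Fact dual_addA : associative dual_add.
Proof. by move=> f g h; apply: dualP => x; rewrite /= addrA. Qed.
Fact dual_addC : commutative dual_add.
Proof. by move=> f g; apply: dualP => x; rewrite /= addrC. Qed.
Fact dual_add0 : left_id dual_zero dual_add.
Proof. by move=> f; apply: dualP => x; rewrite /= add0r. Qed.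
Fact dual_addN : left_inverse dual_zero dual_opp dual_add.
Proof. by move=> f; apply: dualP => x; rewrite /= addNr. Qed.

HB.instance Definition _ :=
  GRing.isZmodule.Build dual dual_addA dual_addC dual_add0 dual_addN.

(* b f : x |-> f (x b), for b in A *)
Fact dual_lact_lin (b : A) (f : dual) :
  linear ((fun x => f (x * b)) : restr A^o -> R^o).
Proof.
move=> r x y.
have -> : (r *: (x : restr A^o) + y : A) * b = triv_in r * (x * b) + y * b.
  by rewrite mulrDl -mulrA.
by rewrite dualD dualZ.
Qed.
Definition dual_lact b f := Dual (dual_lact_lin b f).

(* f s : x |-> f (x) s, for s in R *)
Fact dual_ract_lin (f : dual) (s : R) :
  linear ((fun x => f x * s) : restr A^o -> R^o).
Proof. by move=> r x y; rewrite dual_lin mulrDl /GRing.scale /= mulrA. Qed.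
Definition dual_ract f s := Dual (dual_ract_lin f s).

(* The dual basis {e_i, *e_i} of A: e_false = 1 and e_true = t. *)
Definition ebase (i : bool) : A := if i then (0, 1) else (1, 0).

Fact edual_lin (i : bool) :
  linear ((fun x : A => if i then x.2 else x.1) : restr A^o -> R^o).
Proof. by case: i => r [a b] [c d] //=; rewrite mul0r addr0. Qed.
Definition edual i := Dual (edual_lin i).

Lemma dual_basis (x : A) : x = \sum_i triv_in (edual i x) * ebase i.
Proof.
rewrite big_bool /= addrC; case: x => a b; congr pair;
  by rewrite /= ?mulr1 ?mulr0 ?mul0r ?addr0 ?add0r.
Qed.

End LeftDual.

(* R \otimes_k R^o; the second factor is written as R, with the product
   reversed in renv_mul. *)
Section Enveloping.
Variables (k : comPzRingType) (R : kalgebra k).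

Definition renv_tens : lmodType R :=
  tens (fun (r : R^o) (c : k) => (r : R) * kstr R c : R^o)
       (fun (c : k) (s : R) => kstr R c * s).
Definition renv : Type := renv_tens.
Definition rmk (r s : R) : renv := tmk _ _ (r : R^o) s.

HB.instance Definition _ := GRing.Zmodule.on renv.

Definition rlift (V : zmodType) (h : R -> R -> V) (u : renv) : V :=
  tlift (h : R^o -> R -> V) (u : renv_tens).

Lemma rliftE (V : zmodType) (h : R -> R -> V) :
    (forall r r' s, h (r + r') s = h r s + h r' s) ->
    (forall r s s', h r (s + s') = h r s + h r s') ->
    (forall r c s, h (r * kstr R c) s = h r (kstr R c * s)) ->
  forall r s, rlift h (rmk r s) = h r s.
Proof.
move=> hDl hDr hb r s; rewrite /rlift /rmk.
apply: (@tlift_addE R k R^o R _ _ V h) => // a x c y.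
by rewrite /GRing.scale /= mulrA hb.
Qed.

Lemma rliftD (V : zmodType) (h : R -> R -> V) : zmod_morphism (rlift h).
Proof. by move=> u v; exact: tliftD. Qed.

Definition renv_mul (u v : renv) : renv :=
  rlift (fun r s => rlift (fun r' s' => rmk (r * r') (s' * s)) v) u.

Lemma rmkDl r r' s : rmk (r + r') s = rmk r s + rmk r' s.
Proof. exact: tmkDl. Qed.
Lemma rmkDr r s s' : rmk r (s + s') = rmk r s + rmk r s'.
Proof. exact: tmkDr. Qed.
Lemma rmk_bal r c s : rmk (r * kstr R c) s = rmk r (kstr R c * s).
Proof. exact: tmk_bal. Qed.

Lemma renv_ind (P : renv -> Prop) :
    P 0 -> (forall x y, P x -> P y -> P (x + y)) ->
    (forall r s, P (rmk r s)) -> forall x, P x.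
Proof. exact: tens_ind. Qed.

Definition renv_inn (r s : R) : renv -> renv := rlift (fun r' s' => rmk (r * r') (s' * s)).

Lemma renv_innE r s r' s' : renv_inn r s (rmk r' s') = rmk (r * r') (s' * s).
Proof.
apply: rliftE => *.
- by rewrite mulrDr rmkDl.
- by rewrite mulrDl rmkDr.
- by rewrite mulrA rmk_bal mulrA.
Qed.

Lemma renv_inn0 r s : renv_inn r s 0 = 0.
Proof. exact: (zmod_morph0 (@rliftD _ _)). Qed.

Lemma renv_innD r s : {morph renv_inn r s : v w / v + w}.
Proof. exact: (zmod_morphD (@rliftD _ _)). Qed.

Lemma renv_mul_rmk r s v : renv_mul (rmk r s) v = renv_inn r s v.
Proof.
rewrite /renv_mul; apply: (rliftE (h := fun r s => renv_inn r s v)) => [x y z|x y z|x c y];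
  elim/renv_ind: v => [|u u' IH IH'|r' s']; rewrite ?renv_inn0 ?addr0 //.
- by rewrite !renv_innD IH IH' addrACA.
- by rewrite !renv_innE mulrDl rmkDl.
- by rewrite !renv_innD IH IH' addrACA.
- by rewrite !renv_innE mulrDr rmkDr.
- by rewrite !renv_innD IH IH'.
by rewrite !renv_innE -mulrA kstr_central mulrA rmk_bal mulrA kstr_central mulrA.
Qed.

Lemma renv_mulE r s r' s' :
  renv_mul (rmk r s) (rmk r' s') = rmk (r * r') (s' * s).
Proof. by rewrite renv_mul_rmk renv_innE. Qed.

Lemma renv_mul0l v : renv_mul 0 v = 0.
Proof. exact: (zmod_morph0 (@rliftD _ _)). Qed.

Fact renv_mulDl : left_distributive renv_mul +%R.
Proof. by move=> u u' v; exact: (zmod_morphD (@rliftD _ _)). Qed.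

Fact renv_mulDr : right_distributive renv_mul +%R.
Proof.
move=> u v w; elim/renv_ind: u => [|u u' IH IH'|r s]; first by rewrite !renv_mul0l addr0.
  by rewrite !renv_mulDl IH IH' addrACA.
by rewrite !renv_mul_rmk renv_innD.
Qed.

Lemma renv_mul0r u : renv_mul u 0 = 0.
Proof. by apply: (addrI (renv_mul u 0)); rewrite -renv_mulDr !addr0. Qed.

Fact renv_mulA : associative renv_mul.
Proof.
move=> u v w.
elim/renv_ind: u => [|u u' IH IH'|r s]; first by rewrite !renv_mul0l.
  by rewrite !renv_mulDl IH IH'.
elim/renv_ind: v => [|v v' IH IH'|r' s']; first by rewrite !(renv_mul0r, renv_mul0l).
  by rewrite !(renv_mulDl, renv_mulDr) IH IH'.
elim/renv_ind: w => [|w w' IH IH'|r'' s'']; first by rewrite !renv_mul0r.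
  by rewrite !renv_mulDr IH IH'.
by rewrite !renv_mulE !mulrA.
Qed.

Fact renv_mul1l : left_id (rmk 1 1) renv_mul.
Proof.
move=> u; elim/renv_ind: u => [|u u' IH IH'|r s]; first by rewrite !renv_mul0r.
  by rewrite !renv_mulDr IH IH'.
by rewrite !renv_mulE mul1r mulr1.
Qed.

Fact renv_mul1r : right_id (rmk 1 1) renv_mul.
Proof.
move=> u; elim/renv_ind: u => [|u u' IH IH'|r s]; first by rewrite !renv_mul0l.
  by rewrite !renv_mulDl IH IH'.
by rewrite !renv_mulE mul1r mulr1.
Qed.

HB.instance Definition _ := GRing.Zmodule_isPzRing.Build renv
  renv_mulA renv_mul1l renv_mul1r renv_mulDl renv_mulDr.

End Enveloping.

Section Coendomorphisms.
Variables (k : comPzRingType) (R : kalgebra k).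
Local Notation A := (triv R).

(* A \otimes_k *A, where (c f)(x) = c f(x) = f(x) c for c in k. *)
Definition adual : lmodType A :=
  tens (fun (a : A^o) (c : k) => (a : A) * triv_in (kstr R c) : A^o)
       (fun (c : k) (f : dual R) => dual_ract f (kstr R c)).
Definition amk (a : A) (f : dual R) : adual := tmk _ _ (a : A^o) f.
Definition alift (V : zmodType) (h : A -> dual R -> V) (m : adual) : V :=
  tlift (h : A^o -> dual R -> V) m.

(* (r \otimes s^o) (a \otimes f) = ra \otimes fs *)
Definition adual_lact (u : renv R) (m : adual) : adual :=
  rlift (fun r s =>
    alift (fun a f => amk (triv_in r * a) (dual_ract f s)) m) u.

(* (a \otimes f) (p \otimes q^o) = ap \otimes qf, where (qf)(x) = f(xq) *)
Definition adual_ract (m : adual) (u : renv R) : adual :=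
  rlift (fun p q =>
    alift (fun a f => amk (a * triv_in p) (dual_lact (triv_in q) f)) m) u.

Definition adual_tring : pzRingType := tring adual_lact adual_ract.
Local Notation "[ a , f ]" := (tvect adual_lact adual_ract (amk a f)).

Inductive coend_rel : adual_tring -> adual_tring -> Prop :=
| coend_mul (a a' : A) (f : dual R) :
    coend_rel (\sum_i [a, dual_lact (ebase R i) f] * [a', edual R i]) [a * a', f]
| coend_unit (f : dual R) :
    coend_rel (tscal adual_lact adual_ract (rmk 1 (f 1))) [1, f].

(* The quotient of the tensor ring by these relations is L(A); the e_i are the
   dual basis fixed above. *)
Definition coend : Type := rquot coend_rel.

HB.instance Definition _ := GRing.PzRing.on coend.

Definition cproj (x : adual_tring) : coend := rproj coend_rel x.
(* pi (a \otimes f) and pi (r \otimes s^o) *)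
Definition cpi (a : A) (f : dual R) : coend := cproj [a, f].
Definition cio (r s : R) : coend :=
  cproj (tscal adual_lact adual_ract (rmk r s)).

Lemma cioM r s r' s' : cio r s * cio r' s' = cio (r * r') (s' * s).
Proof.
by rewrite /cio -renv_mulE -[renv_mul _ _]/(rmk r s * rmk r' s') tscalM /cproj rprojM.
Qed.
Lemma cio1 : cio 1 1 = 1.
Proof. by rewrite /cio -[rmk 1 1]/(1 : renv R) tscal1 /cproj rproj1. Qed.
Lemma cioDl r r' s : cio (r + r') s = cio r s + cio r' s.
Proof. by rewrite /cio rmkDl tscalD /cproj rprojD. Qed.
Lemma cioDr r s s' : cio r (s + s') = cio r s + cio r s'.
Proof. by rewrite /cio rmkDr tscalD /cproj rprojD. Qed.

(* L(A) as an R-bimodule: r x s = (r \otimes s^o) x. *)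
Definition coend_scale (r : R) (x : coend) : coend := cio r 1 * x.

Fact coend_scaleA a b x : coend_scale a (coend_scale b x) = coend_scale (a * b) x.
Proof. by rewrite /coend_scale mulrA cioM mul1r. Qed.
Fact coend_scale1 : left_id 1 coend_scale.
Proof. by move=> x; rewrite /coend_scale cio1 mul1r. Qed.
Fact coend_scaleDr : right_distributive coend_scale +%R.
Proof. by move=> a x y; rewrite /coend_scale mulrDr. Qed.
Fact coend_scaleDl x : {morph coend_scale^~ x : a b / a + b}.
Proof. by move=> a b; rewrite /coend_scale cioDl mulrDl. Qed.

HB.instance Definition _ := GRing.Zmodule_isLmodule.Build R coend
  coend_scaleA coend_scale1 coend_scaleDr coend_scaleDl.

Definition coend_ract (x : coend) (s : R) : coend := cio 1 s * x.

Fact coend_ractDl x y s : coend_ract (x + y) s = coend_ract x s + coend_ract y s.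
Proof. by rewrite /coend_ract mulrDr. Qed.
Fact coend_ractDr x s s' : coend_ract x (s + s') = coend_ract x s + coend_ract x s'.
Proof. by rewrite /coend_ract cioDr mulrDl. Qed.
Fact coend_ractA x s s' : coend_ract (coend_ract x s) s' = coend_ract x (s * s').
Proof. by rewrite /coend_ract mulrA cioM mul1r. Qed.
Fact coend_ract1 x : coend_ract x 1 = x.
Proof. by rewrite /coend_ract cio1 mul1r. Qed.
Fact coend_ractZ r x s : coend_ract (r *: x) s = r *: coend_ract x s.
Proof.
by rewrite [LHS]mulrA [RHS]mulrA !cioM !mulr1 !mul1r.
Qed.

Definition coend_bimod : bimod R R :=
  Bimod coend_ractDl coend_ractDr coend_ractA coend_ract1 coend_ractZ.
Local Notation L := coend_bimod.
Local Notation LL := (btens L L).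
Local Notation lmk x y := (tmk _ _ (x : L) (y : L) : LL).

Definition is_comult (D : coend -> LL) : Prop :=
  [/\ zmod_morphism D,
      forall a f, D (cpi a f) =
        \sum_i lmk (cpi a (edual R i)) (cpi (ebase R i) f),
      forall r s, D (cio r s) = lmk (cio r 1) (cio 1 s) &
      forall (x y : coend) (xs ys : seq (coend * coend)),
        D x = \sum_(p <- xs) lmk p.1 p.2 ->
        D y = \sum_(q <- ys) lmk q.1 q.2 ->
        D (x * y) = \sum_(p <- xs) \sum_(q <- ys) lmk (p.1 * q.1) (p.2 * q.2)].

Definition is_counit (e : coend -> R) : Prop :=
  [/\ zmod_morphism e,
      forall a f, e (cpi a f) = f a,
      forall r s, e (cio r s) = r * s &
      forall x y, e (x * y) = e (x * cio (e y) 1)].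

(* There is exactly one map with each of these properties. *)
Definition comult : coend -> LL := xget (fun=> 0) is_comult.
Definition counit : coend -> R := xget (fun=> 0) is_counit.

(* The quotient of L(A) by the left ideal generated by the elements
   (r \otimes 1^o) - (1 \otimes r^o). *)
Inductive cbar_rel : mterm R coend -> mterm R coend -> Prop :=
| cbar_add x y : cbar_rel (MGen (x + y)) (MAdd (MGen x) (MGen y))
| cbar_scale r x : cbar_rel (MGen (r *: x)) (MScale r (MGen x))
| cbar_ideal x r : cbar_rel (MGen (x * cio r 1)) (MGen (x * cio 1 r)).

Definition cbar : lmodType R := pmod cbar_rel.
Definition bproj (x : coend) : cbar := pgen cbar_rel x.

Lemma bprojD x y : bproj (x + y) = bproj x + bproj y.
Proof. exact: (pmod_rel (cbar_add x y)). Qed.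
Lemma bprojZ r x : bproj (r *: x) = r *: bproj x.
Proof. exact: (pmod_rel (cbar_scale r x)). Qed.
Lemma bproj_ideal x r : bproj (x * cio r 1) = bproj (x * cio 1 r).
Proof. exact: (pmod_rel (cbar_ideal x r)). Qed.

Lemma cbar_ind (P : cbar -> Prop) : (forall x, P (bproj x)) -> forall z, P z.
Proof.
move=> Pb z; suff [x ->] : exists x, z = bproj x by [].
elim/pmod_ind: z => [|_ _ [x ->] [y ->]|a x].
- by exists 0; apply: (addrI (bproj 0)); rewrite -bprojD !addr0.
- by exists (x + y); rewrite bprojD.
- by exists (a *: x); rewrite bprojZ.
Qed.

Definition cbar_ract (z : cbar) (s : R) : cbar :=
  extend bproj (fun x => bproj (coend_ract x s)) z.

Lemma cbar_ractE x s : cbar_ract (bproj x) s = bproj (coend_ract x s).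
Proof.
rewrite /cbar_ract (extend_pgen (v := fun x => bproj (coend_ract x s))) //.
move=> _ _ [y z|r y|y r] /=.
- by rewrite coend_ractDl bprojD.
- by rewrite coend_ractZ bprojZ.
- by rewrite /coend_ract !mulrA bproj_ideal.
Qed.

Fact cbar_ractDl x y s : cbar_ract (x + y) s = cbar_ract x s + cbar_ract y s.
Proof.
elim/cbar_ind: x => x; elim/cbar_ind: y => y.
by rewrite -bprojD !cbar_ractE coend_ractDl bprojD.
Qed.
Fact cbar_ractDr x s s' : cbar_ract x (s + s') = cbar_ract x s + cbar_ract x s'.
Proof. by elim/cbar_ind: x => x; rewrite !cbar_ractE coend_ractDr bprojD. Qed.
Fact cbar_ractA x s s' : cbar_ract (cbar_ract x s) s' = cbar_ract x (s * s').
Proof. by elim/cbar_ind: x => x; rewrite !cbar_ractE coend_ractA. Qed.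
Fact cbar_ract1 x : cbar_ract x 1 = x.
Proof. by elim/cbar_ind: x => x; rewrite !cbar_ractE coend_ract1. Qed.
Fact cbar_ractZ r x s : cbar_ract (r *: x) s = r *: cbar_ract x s.
Proof.
by elim/cbar_ind: x => x; rewrite -bprojZ !cbar_ractE coend_ractZ bprojZ.
Qed.

Definition cbar_bimod : bimod R R :=
  Bimod cbar_ractDl cbar_ractDr cbar_ractA cbar_ract1 cbar_ractZ.
Local Notation Lb := cbar_bimod.

Definition bar_comult : cbar -> btens Lb Lb :=
  extend bproj (fun x =>
    tlift (fun l l' : L => tmk _ _ (bproj l : Lb) (bproj l' : Lb)) (comult x)).

Definition bar_counit : cbar -> R := extend bproj counit.

(* When R is commutative the left ideal above is two-sided, and this is the
   product of the quotient ring. *)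
Definition bar_mul (u v : cbar) : cbar :=
  extend bproj (fun x => extend bproj (fun y => bproj (x * y)) v) u.

End Coendomorphisms.

Section RegularBimodules.
Variable R : pzRingType.
Local Notation A := (triv R).

Definition ring_bimod (S : pzRingType) : bimod S S :=
  @Bimod S S S^o (fun x y => (x : S) * y) (@mulrDl S) (@mulrDr S)
    (fun m t t' => esym (mulrA m t t')) (@mulr1 S) (fun s m t => esym (mulrA s m t)).

Definition restr_ract (S : pzRingType) (M : bimod S A) (m : M) (r : R) : M :=
  bract m (triv_in r : A).

Section Restriction.
Variables (S : pzRingType) (M : bimod S A).

Fact restrr_Dl (m m' : M) r :
  restr_ract (m + m') r = restr_ract m r + restr_ract m' r.
Proof. exact: bractDl. Qed.
Fact restrr_Dr (m : M) r r' :
  restr_ract m (r + r') = restr_ract m r + restr_ract m r'.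
Proof. by rewrite /restr_ract triv_inD bractDr. Qed.
Fact restrr_A (m : M) r r' :
  restr_ract (restr_ract m r) r' = restr_ract m (r * r').
Proof. by rewrite /restr_ract bractA triv_inM. Qed.
Fact restrr_1 (m : M) : restr_ract m 1 = m.
Proof. by rewrite /restr_ract triv_in1 bract1. Qed.
Fact restrr_Z s (m : M) r : restr_ract (s *: m) r = s *: restr_ract m r.
Proof. exact: bractZ. Qed.

(* Restriction of the right action along R -> A. *)
Definition restrr : bimod S R :=
  Bimod restrr_Dl restrr_Dr restrr_A restrr_1 restrr_Z.

End Restriction.

(* Restriction of the left action along R -> A. *)
Definition restrl (T : pzRingType) (M : bimod A T) : bimod R T :=
  @Bimod R T (restr M) (@bract A T M) (@bractDl A T M) (@bractDr A T M)
    (@bractA A T M) (@bract1 A T M) (fun r m t => bractZ (triv_in r : A) m t).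

End RegularBimodules.

Section ComplexQ.
Variable R : pzRingType.
Local Notation A := (triv R).

Definition AtA : bimod A A := tens_bimod (restrr (ring_bimod A)) (restrl (ring_bimod A)).
Definition amul : AtA -> A^o :=
  tlift (fun (a : restrr (ring_bimod A)) (b : restrl (ring_bimod A)) =>
    (a : A) * (b : A) : A^o).
Definition ata (a b : A) : AtA := tmk _ _ (a : restrr (ring_bimod A)) (b : restrl (ring_bimod A)).

Lemma amulE a b : amul (ata a b) = a * b.
Proof.
rewrite /amul /ata tliftE //= => *.
- exact: mulrDl.
- exact: mulrDr.
- exact: (esym (mulrA _ _ _)).
- exact: (esym (mulrA _ _ _)).
Qed.

Lemma amulD : {morph amul : x y / x + y}.
Proof. exact: (zmod_morphD (@tliftD _ _ _ _ _ _ _ _)). Qed.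
Lemma amul0 : amul 0 = 0.
Proof. exact: (zmod_morph0 (@tliftD _ _ _ _ _ _ _ _)). Qed.

Lemma amulZ (a : A) z : amul (a *: z) = a *: amul z.
Proof.
elim/tens_ind: z => [|x y IHx IHy|m n]; first by rewrite scaler0 amul0 scaler0.
  by rewrite scalerDr !amulD IHx IHy scalerDr.
by rewrite -tmkZ [LHS]amulE [amul _]amulE; exact: (esym (mulrA _ _ _)).
Qed.

Lemma amul_ract z (a : A) : amul (bract z a) = (amul z : A) * a.
Proof.
elim/tens_ind: z => [|x y IHx IHy|m n].
- by rewrite [bract _ _]tens_ract0 amul0 mul0r.
- by rewrite bractDl !amulD IHx IHy mulrDl.
- by rewrite [bract _ _]tens_ractE [LHS]amulE [amul _]amulE; exact: mulrA.
Qed.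

Definition kerA_pred : {pred AtA} := fun z => amul z == 0.
Record kerA := KerA { kerA_val :> AtA; kerA_valP : kerA_val \in kerA_pred }.

HB.instance Definition _ := [isSub for kerA_val].
HB.instance Definition _ := [Choice of kerA by <:].

Fact kerA_closed : GRing.subsemimod_closed kerA_pred.
Proof.
split=> [|a z]; last by move=> /eqP z0; apply/eqP; rewrite amulZ z0 scaler0.
split=> [|x y /eqP x0 /eqP y0]; apply/eqP; first exact: amul0.
by rewrite amulD x0 y0 addr0.
Qed.

HB.instance Definition _ :=
  GRing.SubChoice_isSubLmodule.Build A AtA kerA_pred kerA kerA_closed.

Fact kerA_ract_subproof (z : kerA) (a : A) : bract (z : AtA) a \in kerA_pred.
Proof.
case: z => z /= /eqP z0; apply/eqP.
by rewrite [LHS]amul_ract z0 mul0r.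
Qed.
Definition kerA_ract (z : kerA) (a : A) : kerA := KerA (kerA_ract_subproof z a).

Lemma kerA_ractE z a : val (kerA_ract z a) = bract (val z : AtA) a. Proof. by []. Qed.
Fact kerA_ractDl x y a : kerA_ract (x + y) a = kerA_ract x a + kerA_ract y a.
Proof. by apply: val_inj; rewrite Algebra.valD !kerA_ractE Algebra.valD bractDl. Qed.
Fact kerA_ractDr x a b : kerA_ract x (a + b) = kerA_ract x a + kerA_ract x b.
Proof. by apply: val_inj; rewrite Algebra.valD !kerA_ractE bractDr. Qed.
Fact kerA_ractA x a b : kerA_ract (kerA_ract x a) b = kerA_ract x (a * b).
Proof. by apply: val_inj; rewrite !kerA_ractE bractA. Qed.
Fact kerA_ract1 x : kerA_ract x 1 = x.
Proof. by apply: val_inj; rewrite !kerA_ractE bract1. Qed.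
Fact kerA_ractZ (s : A) x a : kerA_ract (s *: x) a = s *: kerA_ract x a.
Proof.
by apply: val_inj; rewrite linearZ !kerA_ractE [val _]linearZ; exact: (@bractZ _ _ AtA).
Qed.

Definition K : bimod A A :=
  Bimod kerA_ractDl kerA_ractDr kerA_ractA kerA_ract1 kerA_ractZ.

Fact bd_subproof (a : A) : ata 1 a - ata a 1 \in kerA_pred.
Proof.
apply/eqP; apply: (addIr (amul (ata a 1))).
by rewrite -amulD subrK add0r !amulE mul1r mulr1.
Qed.
Definition bd (a : A) : K := KerA (bd_subproof a).

(* QA n is the A-bimodule Q_(n+1). *)
Fixpoint QA (n : nat) : bimod A A :=
  if n is n'.+1 then (if n' is _.+1 then tens_bimod K (QA n') else K)
  else ring_bimod A.

(* \partial a_1 \otimes_A ... \otimes_A \partial a_n, which is 1 if n = 0 *)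
Fixpoint bdt (n : nat) : n.-tuple A -> QA n :=
  match n with
  | 0 => fun _ => (1 : A)
  | n'.+1 =>
    match n' return (n'.-tuple A -> QA n') -> n'.+1.-tuple A -> QA n'.+1 with
    | 0 => fun _ t => bd (thead t)
    | _.+1 => fun rec t => tmk _ _ (bd (thead t)) (rec (behead_tuple t))
    end (bdt (n := n'))
  end.

Definition Q (n : nat) : bimod R R :=
  if n is n'.+1 then restrl (restrr (QA n')) else ring_bimod R.

(* a_0 \partial a_1 \otimes_A ... \otimes_A \partial a_n in Q_(n+1) *)
Definition qgen (n : nat) (p : A * n.-tuple A) : Q n.+1 := (p.1 : A) *: bdt p.2.

Definition Qd (n : nat) : Q n -> Q n.+1 :=
  match n with
  | 0 => fun r => triv_in (r : R) : A
  | _.+1 => extend (@qgen _) (fun p => qgen (1, [tuple of p.1 :: p.2]))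
  end.

End ComplexQ.

Section CoactionOnQ.
Variables (k : comPzRingType) (R : kalgebra k).
Local Notation A := (triv R).
Local Notation L := (coend_bimod R).
Local Notation Lb := (cbar_bimod R).

Definition Q_coact (n : nat) : Q R n -> btens L (Q R n) :=
  match n with
  | 0 => fun r => tmk _ _ (cio (r : R) 1 : L) (1 : R)
  | n'.+1 => extend (@qgen R n') (fun p =>
      \sum_(i0 : bool) \sum_(i : n'.-tuple bool)
        tmk _ _
          (cpi p.1 (edual R i0) *
             \prod_(j < n') cpi (tnth p.2 j) (edual R (tnth i j)) : L)
          (qgen (ebase R i0, map_tuple (ebase R) i)))
  end.

Definition Q_bar_coact (n : nat) (q : Q R n) : btens Lb (Q R n) :=
  tlift (fun (l : L) (q : Q R n) => tmk _ _ (bproj l : Lb) q) (Q_coact q).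

Definition Qtot : lmodType R := dsum (fun n => Q R n : lmodType R).

Definition Qtot_coact : Qtot -> btens Lb Qtot :=
  extend (fun p : {n & Q R n} => din (V := fun n => Q R n : lmodType R) (tagged p))
    (fun p : {n & Q R n} =>
       tlift (fun (l : Lb) (q : Q R (tag p)) =>
           tmk _ _ l (din (V := fun n => Q R n : lmodType R) q : Qtot))
         (Q_bar_coact (tagged p))).

End CoactionOnQ.

Section ChainComplexes.
Variable R : pzRingType.

(* The underlying data of a chain complex of left R-modules; cdiff n is the
   differential from degree n+1 to degree n. *)
Record complex := Complex {
  cob :> nat -> lmodType R;
  cdiff : forall n, cob n.+1 -> cob n
}.

Definition is_complex (M : complex) : Prop :=
  (forall n, linear (@cdiff M n)) /\
  (forall n x, cdiff (cdiff x : M n.+1) = 0 :> M n).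

Definition is_chain_map (M N : complex) (f : forall n, M n -> N n) : Prop :=
  (forall n, linear (f n)) /\
  (forall n (x : M n.+1), f n (cdiff x) = cdiff (f n.+1 x)).

Definition ctot (M : complex) : lmodType R := dsum M.

(* C = R^(N) (+) R^(N), with first components the coefficients of the h_n and
   second components those of the u_n.  Only its actions on Q and on
   \bigoplus_n M_n enter the tensor product over C. *)
Definition Cring : zmodType :=
  (dsum (fun _ : nat => R^o) * dsum (fun _ : nat => R^o))%type.

Inductive Csym := Csym_h of R & nat | Csym_u of R & nat.

(* r h_n and r u_n *)
Definition Cgen (c : Csym) : Cring :=
  match c with
  | Csym_h r n => (din (V := fun _ => R^o) (i := n) r, 0)
  | Csym_u r n => (0, din (V := fun _ => R^o) (i := n) r)
  end.

Definition ctot_Cact (M : complex) (c : Cring) (m : ctot M) : ctot M :=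
  extend Cgen (fun s =>
    match s with
    | Csym_h r n => din (r *: (m : dsum M) n)
    | Csym_u r n => din (r *: cdiff ((m : dsum M) n.+1))
    end : ctot M) c.

End ChainComplexes.

Section FunctorQ.
Variables (k : comPzRingType) (R : kalgebra k).
Local Notation Lb := (cbar_bimod R).
Local Notation qin := (din (V := fun n => Q R n : lmodType R)).

Definition Qtot_Cact (q : Qtot R) (c : Cring R) : Qtot R :=
  extend (@Cgen R) (fun s =>
    match s with
    | Csym_h r n => qin (bract ((q : dsum _) n) r)
    | Csym_u r n => qin (bract (Qd ((q : dsum _) n)) r)
    end : Qtot R) c.

(* The underlying data of a left comodule over the quotient coring. *)
Record comodule := Comodule {
  coob :> lmodType R;
  coact : coob -> btens Lb coob
}.

(* Lb \otimes X -> Lb \otimes (Lb \otimes X) induced by the comultiplication *)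
Definition comult_tens (X : lmodType R) : btens Lb X -> btens Lb (btens Lb X) :=
  tlift (fun (l : Lb) (x : X) =>
    tlift (fun l1 l2 : Lb => tmk _ _ l1 (tmk _ _ l2 x : btens Lb X)) (bar_comult l)).

Definition tens_map (X Y : lmodType R) (f : X -> Y) : btens Lb X -> btens Lb Y :=
  tlift (fun (l : Lb) (x : X) => tmk _ _ l (f x)).

Definition is_comodule (X : comodule) : Prop :=
  [/\ linear (@coact X),
      forall x : X, comult_tens (coact x) = tens_map (@coact X) (coact x) &
      forall x : X,
        tlift (fun (l : Lb) (y : X) => bar_counit l *: y) (coact x) = x].

Definition is_comodule_map (X Y : comodule) (f : X -> Y) : Prop :=
  linear f /\ forall x, coact (f x) = tens_map f (coact x).

Definition QC_ob (M : complex R) : comodule :=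
  @Comodule (tens Qtot_Cact (@ctot_Cact R M))
    (tlift (fun (q : Qtot R) (m : ctot M) =>
      tlift (fun (l : Lb) (q' : Qtot R) =>
          tmk _ _ l (tmk Qtot_Cact (@ctot_Cact R M) q' m)) (Qtot_coact q))).

Definition QC_map (M N : complex R) (f : forall n, M n -> N n) :
    QC_ob M -> QC_ob N :=
  tlift (fun (q : Qtot R) (m : ctot M) =>
    tmk Qtot_Cact (@ctot_Cact R N) q
      (extend (fun p : {n & M n} => din (tagged p) : ctot M)
              (fun p => din (f _ (tagged p)) : ctot N) m)).

End FunctorQ.

(* A category whose objects are the X : ob with isob X and whose morphisms
   X -> Y are the f : mor X Y with ismor f. *)
Record category := Category {
  ob : Type;
  isob : ob -> Prop;
  mor : ob -> ob -> Type;
  ismor : forall X Y, mor X Y -> Prop;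
  idm : forall X, mor X X;
  comp : forall X Y Z, mor Y Z -> mor X Y -> mor X Z;
  ismor_id : forall X, isob X -> ismor (idm X);
  ismor_comp : forall X Y Z (g : mor Y Z) (f : mor X Y),
    isob X -> isob Y -> isob Z -> ismor g -> ismor f -> ismor (comp g f);
  comp_idl : forall X Y (f : mor X Y), comp (idm Y) f = f;
  comp_idr : forall X Y (f : mor X Y), comp f (idm X) = f;
  compA : forall X Y Z W (h : mor Z W) (g : mor Y Z) (f : mor X Y),
    comp h (comp g f) = comp (comp h g) f
}.

Notation "g \oc f" := (comp g f) (at level 50, left associativity).

Definition is_iso (C : category) (X Y : ob C) (f : mor X Y) : Prop :=
  ismor f /\ exists g : mor Y X, [/\ ismor g, g \oc f = idm X & f \oc g = idm Y].

Record functor (C D : category) := Functor {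
  fob :> ob C -> ob D;
  fmor : forall X Y, mor X Y -> mor (fob X) (fob Y)
}.
Arguments fmor {C D} f {X Y}.

Definition is_functor (C D : category) (F : functor C D) : Prop :=
  [/\ forall X, isob X -> isob (F X),
      forall X Y (f : mor X Y), isob X -> isob Y -> ismor f -> ismor (fmor F f),
      forall X, isob X -> fmor F (idm X) = idm (F X) &
      forall X Y Z (g : mor Y Z) (f : mor X Y),
        isob X -> isob Y -> isob Z -> ismor g -> ismor f ->
        fmor F (g \oc f) = fmor F g \oc fmor F f].

Definition idF (C : category) : functor C C := @Functor C C id (fun X Y => id).
Definition compF (C D E : category) (G : functor D E) (F : functor C D) :
    functor C E :=
  @Functor C E (G \o F) (fun X Y f => fmor G (fmor F f)).

Definition is_natiso (C D : category) (F G : functor C D)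
    (a : forall X, mor (F X) (G X)) : Prop :=
  (forall X, isob X -> is_iso (a X)) /\
  (forall X Y (f : mor X Y), isob X -> isob Y -> ismor f ->
     a Y \oc fmor F f = fmor G f \oc a X).

Definition is_equivalence (C D : category) (F : functor C D) : Prop :=
  is_functor F /\
  exists G : functor D C,
    [/\ is_functor G,
        exists a, @is_natiso C C (idF C) (compF G F) a &
        exists b, @is_natiso D D (compF F G) (idF D) b].

Record mon_data (C : category) := MonData {
  tob : ob C -> ob C -> ob C;
  tmor : forall X X' Y Y', mor X X' -> mor Y Y' -> mor (tob X Y) (tob X' Y');
  tunit : ob C;
  tassoc : forall X Y Z, mor (tob (tob X Y) Z) (tob X (tob Y Z));
  tlunit : forall X, mor (tob tunit X) X;
  trunit : forall X, mor (tob X tunit) X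
}.
Arguments tmor {C} m {X X' Y Y'}.

Definition is_monoidal (C : category) (T : mon_data C) : Prop :=
  let t := tob T in let m := @tmor C T in
  [/\ [/\ forall X Y, isob X -> isob Y -> isob (t X Y),
          forall X X' Y Y' (f : mor X X') (g : mor Y Y'),
            isob X -> isob X' -> isob Y -> isob Y' -> ismor f -> ismor g ->
            ismor (m _ _ _ _ f g),
          forall X Y, isob X -> isob Y ->
            m _ _ _ _ (idm X) (idm Y) = idm (t X Y),
          forall X X' X'' Y Y' Y'' (f' : mor X' X'') (f : mor X X')
              (g' : mor Y' Y'') (g : mor Y Y'),
            isob X -> isob X' -> isob X'' -> isob Y -> isob Y' -> isob Y'' ->
            ismor f' -> ismor f -> ismor g' -> ismor g ->
            m _ _ _ _ (f' \oc f) (g' \oc g) =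
              m _ _ _ _ f' g' \oc m _ _ _ _ f g &
          isob (tunit T)],
      [/\ forall X Y Z, isob X -> isob Y -> isob Z -> is_iso (tassoc T X Y Z),
          forall X, isob X -> is_iso (tlunit T X) &
          forall X, isob X -> is_iso (trunit T X)],
      [/\ forall X X' Y Y' Z Z' (f : mor X X') (g : mor Y Y') (h : mor Z Z'),
            isob X -> isob X' -> isob Y -> isob Y' -> isob Z -> isob Z' ->
            ismor f -> ismor g -> ismor h ->
            tassoc T X' Y' Z' \oc m _ _ _ _ (m _ _ _ _ f g) h =
              m _ _ _ _ f (m _ _ _ _ g h) \oc tassoc T X Y Z,
          forall X Y (f : mor X Y), isob X -> isob Y -> ismor f ->
            tlunit T Y \oc m _ _ _ _ (idm (tunit T)) f = f \oc tlunit T X &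
          forall X Y (f : mor X Y), isob X -> isob Y -> ismor f ->
            trunit T Y \oc m _ _ _ _ f (idm (tunit T)) = f \oc trunit T X],
      forall X Y Z W, isob X -> isob Y -> isob Z -> isob W ->
        tassoc T X Y (t Z W) \oc tassoc T (t X Y) Z W =
          m _ _ _ _ (idm X) (tassoc T Y Z W) \oc tassoc T X (t Y Z) W
            \oc m _ _ _ _ (tassoc T X Y Z) (idm W) &
      forall X Y, isob X -> isob Y ->
        m _ _ _ _ (idm X) (tlunit T Y) \oc tassoc T X (tunit T) Y =
          m _ _ _ _ (trunit T X) (idm Y)].

(* phi and phi0 make F a (strong) monoidal functor. *)
Definition is_monoidal_functor (C D : category) (TC : mon_data C)
    (TD : mon_data D) (F : functor C D)
    (phi : forall X Y, mor (tob TD (F X) (F Y)) (F (tob TC X Y)))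
    (phi0 : mor (tunit TD) (F (tunit TC))) : Prop :=
  [/\ is_functor F,
      forall X Y, isob X -> isob Y -> is_iso (phi X Y),
      is_iso phi0,
      forall X X' Y Y' (f : mor X X') (g : mor Y Y'),
        isob X -> isob X' -> isob Y -> isob Y' -> ismor f -> ismor g ->
        phi X' Y' \oc tmor TD (fmor F f) (fmor F g) =
          fmor F (tmor TC f g) \oc phi X Y &
      [/\ forall X Y Z, isob X -> isob Y -> isob Z ->
            fmor F (tassoc TC X Y Z) \oc phi (tob TC X Y) Z
                \oc tmor TD (phi X Y) (idm (F Z)) =
              phi X (tob TC Y Z) \oc tmor TD (idm (F X)) (phi Y Z)
                \oc tassoc TD (F X) (F Y) (F Z),
          forall X, isob X ->
            fmor F (tlunit TC X) \oc phi (tunit TC) X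
                \oc tmor TD phi0 (idm (F X)) = tlunit TD (F X) &
          forall X, isob X ->
            fmor F (trunit TC X) \oc phi X (tunit TC)
                \oc tmor TD (idm (F X)) phi0 = trunit TD (F X)]].

Definition is_monoidal_equivalence (C D : category) (TC : mon_data C)
    (TD : mon_data D) (F : functor C D) : Prop :=
  [/\ is_monoidal TC, is_monoidal TD, is_equivalence F &
      exists phi phi0, @is_monoidal_functor C D TC TD F phi phi0].

Section ChainCategory.
Variable R : pzRingType.

Definition chain_idm (M : complex R) (n : nat) (x : M n) : M n := x.
Definition chain_comp (M N P : complex R) (g : forall n, N n -> P n)
  (f : forall n, M n -> N n) (n : nat) (x : M n) : P n := g n (f n x).

Fact chain_map_id (M : complex R) : is_complex M -> is_chain_map (@chain_idm M).
Proof. by []. Qed.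

Fact chain_map_comp (M N P : complex R) (g : forall n, N n -> P n)
    (f : forall n, M n -> N n) :
  is_complex M -> is_complex N -> is_complex P ->
  is_chain_map g -> is_chain_map f -> is_chain_map (chain_comp g f).
Proof.
move=> _ _ _ [glin gd] [flin fd]; split=> [n a x y|n x].
  by rewrite /chain_comp flin glin.
by rewrite /chain_comp fd gd.
Qed.

Definition chain_category : category :=
  @Category (complex R) (@is_complex R) (fun M N => forall n, M n -> N n)
    (@is_chain_map R) chain_idm chain_comp chain_map_id chain_map_comp
    (fun _ _ _ => erefl) (fun _ _ _ => erefl) (fun _ _ _ _ _ _ _ => erefl).

End ChainCategory.

Section ChainMonoidal.
Variable R : pzRingType.
Implicit Types M N P : complex R.

(* M_p \otimes_R N_q, for R commutative *)
Definition ctens M N (p q : nat) : lmodType R :=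
  tens (fun (x : M p) (r : R) => r *: x) (@GRing.scale R (N q)).

Definition bideg (n : nat) : Type := {pq : nat * nat | (pq.1 + pq.2 == n)%N}.

Definition ctens_ob M N (n : nat) : lmodType R :=
  dsum (fun i : bideg n => ctens M N (val i).1 (val i).2).

Definition cmk M N n p q (e : (p + q == n)%N) (x : M p) (y : N q) : ctens_ob M N n :=
  din (V := fun i : bideg n => ctens M N (val i).1 (val i).2)
    (i := exist _ (p, q) e) (tmk _ _ x y).

Inductive cgen M N (n : nat) : Type :=
  CGen p q of (p + q == n)%N & M p & N q.

Definition cgen_elt M N n (g : cgen M N n) : ctens_ob M N n :=
  let: CGen p q e x y := g in cmk e x y.

Fact bideg_predr p q n : (p + q.+1 == n.+1)%N -> (p + q == n)%N.
Proof. by rewrite addnS. Qed.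

(* dx \otimes y, which is 0 for x in degree 0 *)
Definition ctens_diffl M N n p q (e : (p + q == n.+1)%N) (x : M p) (y : N q) :
    ctens_ob M N n :=
  match p return (p + q == n.+1)%N -> M p -> ctens_ob M N n with
  | 0 => fun _ _ => 0
  | _.+1 => fun e x => cmk (e : (_ + q == n)%N) (cdiff x) y
  end e x.

(* x \otimes dy, which is 0 for y in degree 0 *)
Definition ctens_diffr M N n p q (e : (p + q == n.+1)%N) (x : M p) (y : N q) :
    ctens_ob M N n :=
  match q return (p + q == n.+1)%N -> N q -> ctens_ob M N n with
  | 0 => fun _ _ => 0
  | _.+1 => fun e y => cmk (bideg_predr e) x (cdiff y)
  end e y.

Definition ctens_diff M N n : ctens_ob M N n.+1 -> ctens_ob M N n :=
  extend (@cgen_elt M N n.+1) (fun g =>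
    let: CGen p q e x y := g in
    ctens_diffl e x y + (-1) ^+ p *: ctens_diffr e x y).

Definition complex_tens M N : complex R := @Complex R (ctens_ob M N) (@ctens_diff M N).

Definition complex_tens_map M M' N N' (f : forall n, M n -> M' n)
    (g : forall n, N n -> N' n) (n : nat) :
    complex_tens M N n -> complex_tens M' N' n :=
  extend (@cgen_elt M N n) (fun c =>
    let: CGen p q e x y := c in cmk e (f p x) (g q y) : ctens_ob M' N' n).

Definition complex_unit : complex R :=
  @Complex R (fun n => if n is 0 then R^o : lmodType R else 'rV[R]_0) (fun _ _ => 0).

Inductive cgen3 M N P (n : nat) : Type :=
  CGen3 p q r of (p + q + r == n)%N & M p & N q & P r.

Fact bideg_assoc p q r n : (p + q + r == n)%N -> (p + (q + r) == n)%N.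
Proof. by rewrite addnA. Qed.

(* (x \otimes y) \otimes z |-> x \otimes (y \otimes z) *)
Definition complex_assoc M N P (n : nat) :
    complex_tens (complex_tens M N) P n -> complex_tens M (complex_tens N P) n :=
  extend
    (fun c : cgen3 M N P n => let: CGen3 p q r e x y z := c in
      cmk (M := complex_tens M N) e (cmk (eqxx (p + q)%N) x y) z : ctens_ob _ _ n)
    (fun c => let: CGen3 p q r e x y z := c in
      cmk (N := complex_tens N P) (bideg_assoc e) x (cmk (eqxx (q + r)%N) y z)
        : ctens_ob _ _ n).

Fact bideg_0r n : (n + 0 == n)%N. Proof. by rewrite addn0. Qed.

(* r \otimes x |-> r x  and  x \otimes r |-> r x, where r is in degree 0 *)
Definition complex_lunit M (n : nat) : complex_tens complex_unit M n -> M n :=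
  extend
    (fun g : R * M n => cmk (M := complex_unit) (p := 0) (eqxx n) (g.1 : R^o) g.2
      : ctens_ob _ _ n)
    (fun g => g.1 *: g.2).

Definition complex_runit M (n : nat) : complex_tens M complex_unit n -> M n :=
  extend
    (fun g : M n * R => cmk (N := complex_unit) (q := 0) (bideg_0r n) g.1 (g.2 : R^o)
      : ctens_ob _ _ n)
    (fun g => g.2 *: g.1).

Definition chain_mon_data : mon_data (chain_category R) :=
  @MonData (chain_category R) complex_tens complex_tens_map complex_unit
    complex_assoc complex_lunit complex_runit.

End ChainMonoidal.

Section ComoduleCategory.
Variables (k : comPzRingType) (R : kalgebra k).
Local Notation Lb := (cbar_bimod R).
Implicit Types X Y Z : comodule R.

Lemma tens_mapE (X Y : lmodType R) (f : X -> Y) (l : Lb) (x : X) :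
  linear f -> tens_map f (tmk _ _ l x : btens Lb X) = tmk _ _ l (f x).
Proof.
move=> flin; rewrite /tens_map tliftE // => [m m' n|m n n'|s m n|m t n].
- exact: tmkDl.
- by rewrite (zmod_morphD (GRing.zmod_morphism_linear flin)) tmkDr.
- exact: tmkZ.
- by rewrite (GRing.scalable_linear flin) tmk_bal.
Qed.

Lemma tens_map_comp (X Y Z : lmodType R) (g : Y -> Z) (f : X -> Y) z :
  linear g -> linear f ->
  tens_map (fun x => g (f x)) z = tens_map g (tens_map f z : btens Lb Y).
Proof.
move=> glin flin; have gflin : linear (fun x => g (f x)).
  by move=> a x y; rewrite flin glin.
have t0 (U V : lmodType R) (h : U -> V) : tens_map (R := R) h 0 = 0.
  exact: (zmod_morph0 (@tliftD _ _ _ _ _ _ _ _)).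
have tD (U V : lmodType R) (h : U -> V) : {morph tens_map (R := R) h : x y / x + y}.
  exact: (zmod_morphD (@tliftD _ _ _ _ _ _ _ _)).
elim/tens_ind: z => [|u v IHu IHv|l x]; first by rewrite !t0.
  by rewrite !tD IHu IHv.
by rewrite !tens_mapE.
Qed.

Lemma tens_map_id (X : lmodType R) (z : btens Lb X) : tens_map id z = z.
Proof.
elim/tens_ind: z => [|u v IHu IHv|l x].
- exact: (zmod_morph0 (@tliftD _ _ _ _ _ _ _ _)).
- by rewrite -{2}IHu -{2}IHv; exact: (zmod_morphD (@tliftD _ _ _ _ _ _ _ _)).
- exact: tens_mapE.
Qed.

Definition comodule_idm X (x : X) : X := x.
Definition comodule_comp X Y Z (g : Y -> Z) (f : X -> Y) (x : X) : Z := g (f x).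

Fact comodule_map_id X : is_comodule X -> is_comodule_map (@comodule_idm X).
Proof. by move=> _; split=> // x; rewrite tens_map_id. Qed.

Fact comodule_map_comp X Y Z (g : Y -> Z) (f : X -> Y) :
  is_comodule X -> is_comodule Y -> is_comodule Z ->
  is_comodule_map g -> is_comodule_map f -> is_comodule_map (comodule_comp g f).
Proof.
move=> _ _ _ [glin gc] [flin fc]; split=> [a x y|x].
  by rewrite /comodule_comp flin glin.
by rewrite /comodule_comp gc fc; exact: esym (tens_map_comp _ glin flin).
Qed.

Definition comodule_category : category :=
  @Category (comodule R) (@is_comodule k R) (fun X Y => X -> Y)
    (@is_comodule_map k R) comodule_idm comodule_comp comodule_map_id
    comodule_map_comp (fun _ _ _ => erefl) (fun _ _ _ => erefl)
    (fun _ _ _ _ _ _ _ => erefl).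

Definition QC_functor : functor (chain_category R) comodule_category :=
  @Functor (chain_category R) comodule_category (@QC_ob k R) (@QC_map k R).

(* x r = \sum e(x_(-1) (r \otimes 1^o)) x_(0) *)
Definition comodule_ract X (x : X) (r : R) : X :=
  tlift (fun (l : Lb) (y : X) => bar_counit (bar_mul l (bproj (cio r 1))) *: y)
    (coact x).

Definition comodule_tens_ob X Y : lmodType R :=
  tens (@comodule_ract X) (@GRing.scale R Y).

Local Notation "x \ox y" := (tmk (@comodule_ract _) (@GRing.scale _ _) x y)
  (at level 40, left associativity).

Definition comodule_tens X Y : comodule R :=
  @Comodule k R (comodule_tens_ob X Y)
    (tlift (fun (x : X) (y : Y) =>
      tlift (fun (l : Lb) (x' : X) =>
        tlift (fun (l' : Lb) (y' : Y) =>
            tmk _ _ (bar_mul l l' : Lb) (x' \ox y' : comodule_tens_ob X Y))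
          (coact y)) (coact x))).

Definition comodule_tens_map X X' Y Y' (f : X -> X') (g : Y -> Y') :
    comodule_tens X Y -> comodule_tens X' Y' :=
  tlift (fun (x : X) (y : Y) => f x \ox g y : comodule_tens_ob X' Y').

Definition comodule_unit : comodule R :=
  @Comodule k R R^o
    (fun r => tmk _ _ (bproj (cio (r : R) 1) : Lb) (1 : R^o)).

Definition comodule_assoc X Y Z :
    comodule_tens (comodule_tens X Y) Z -> comodule_tens X (comodule_tens Y Z) :=
  extend (fun p : X * Y * Z => (p.1.1 \ox p.1.2 : comodule_tens X Y) \ox p.2)
    (fun p => p.1.1 \ox (p.1.2 \ox p.2 : comodule_tens Y Z)).

Definition comodule_lunit X : comodule_tens comodule_unit X -> X :=
  tlift (fun (r : comodule_unit) (x : X) => (r : R) *: x).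

Definition comodule_runit X : comodule_tens X comodule_unit -> X :=
  tlift (fun (x : X) (r : comodule_unit) => comodule_ract x (r : R)).

Definition comodule_mon_data : mon_data comodule_category :=
  @MonData comodule_category comodule_tens comodule_tens_map comodule_unit
    comodule_assoc comodule_lunit comodule_runit.

End ComoduleCategory.

(* Main.v *)
From HB Require Import structures.
Require Import Defs.
From mathcomp Require Import all_boot all_algebra.
From mathcomp Require Import boolp classical_sets.

(* The coring of L(A) modulo the left ideal is free over R on the elements y^n
   and x y^n, with R-bilinear comultiplication y^n |-> y^n (x) y^n and
   x y^n |-> x y^n (x) y^n + y^(n+1) (x) x y^n.  Hence a left comodule X is a
   graded module X = \bigoplus_n X_n with an operator d : X_(n+1) -> X_n of
   square zero, the coaction of v in X_n being y^n (x) v + x y^(n-1) (x) dv.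
   On the other side Q_n is free on a_n = t (dt)^(n-1) and b_n = (dt)^(n-1)
   (with a_0 = 1 and no b_0), and its differential sends a_n to b_(n+1) and b_n
   to 0, so that Q (x)_C M is the direct sum of the groups a_n (x) M_n, with
   b_(n+1) (x) m = a_n (x) dm.  The coaction of Q gives a_n (x) m the coaction
   displayed above.
   The sign (-1)^k of the Leibniz rule is that of y^k x = (-1)^k x y^k. *)

Set Implicit Arguments.
Unset Strict Implicit.
Unset Printing Implicit Defensive.

Import GRing.Theory.

Local Open Scope ring_scope.

(** * Additive and linear maps, balanced tensor products and direct sums *)

Section Additive.

(** L(A), its quotient and the tensor products are given by generators and relations, and maps on
    them by [extend], which is 0 when no map has the prescribed values. A map therefore comes with a
    lemma that produces a candidate from a universal property and identifies it with [extend];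
    equalities are then checked on generators. Only the independence of the monomials x^i y^n
    requires more, namely an action on a free module. Coordinates in this basis turn coassociativity
    into the homogeneity of the components of a coaction, with d d = 0. From then on comodule axioms
    and comodule maps are checked on homogeneous elements. Write F for Q (x)_C -. That the structure
    maps of complexes commute with the differentials is not computed over triples of degrees: it is
    transported from comodules, where it follows from the Leibniz rule on homogeneous elements,
    along surjective comodule maps built from F M (x) F N -> F (M (x) N). *)

Lemma zmod_morphN (U V : zmodType) (f : U -> V) :
  zmod_morphism f -> {morph f : x / - x}.
Proof. by move=> fB x; rewrite -[- x]sub0r fB (zmod_morph0 fB) sub0r. Qed.

Lemma zmod_morph_sum (U V : zmodType) (f : U -> V) (I : Type) (r : seq I)
    (P : pred I) (F : I -> U) :
  zmod_morphism f -> f (\sum_(i <- r | P i) F i) = \sum_(i <- r | P i) f (F i).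
Proof.
by move=> fB; apply: (big_morph f); [apply: zmod_morphD|apply: zmod_morph0].
Qed.

Lemma zmod_morphismP (U V : zmodType) (f : U -> V) :
  {morph f : x y / x + y} -> zmod_morphism f.
Proof.
move=> fD x y; have f0 : f 0 = 0 by apply: (addrI (f 0)); rewrite -fD !addr0.
by rewrite fD; congr (_ + _); apply: (addrI (f y)); rewrite -fD !subrr.
Qed.

Lemma linear_zmod (R : pzRingType) (U V : lmodType R) (f : U -> V) :
  linear f -> zmod_morphism f.
Proof. exact: GRing.zmod_morphism_linear. Qed.

Lemma linear_at0 (R : pzRingType) (U V : lmodType R) (f : U -> V) : linear f -> f 0 = 0.
Proof. by move=> /linear_zmod/zmod_morph0. Qed.

Lemma linear_atD (R : pzRingType) (U V : lmodType R) (f : U -> V) :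
  linear f -> {morph f : x y / x + y}.
Proof. by move=> /linear_zmod/zmod_morphD. Qed.

Lemma linear_scale (R : pzRingType) (U V : lmodType R) (f : U -> V) :
  linear f -> forall a x, f (a *: x) = a *: f x.
Proof. by move=> fL a x; rewrite (GRing.scalable_linear fL). Qed.

Lemma linearI (R : pzRingType) (U V : lmodType R) (f : U -> V) :
  zmod_morphism f -> (forall a x, f (a *: x) = a *: f x) -> linear f.
Proof. by move=> fB fZ a x y; rewrite (zmod_morphD fB) fZ. Qed.

Lemma zmod_morph_comp (U V W : zmodType) (f : V -> W) (g : U -> V) :
  zmod_morphism f -> zmod_morphism g -> zmod_morphism (fun x => f (g x)).
Proof. by move=> fB gB x y; rewrite gB fB. Qed.

Lemma linear_comp (R : pzRingType) (U V W : lmodType R) (f : V -> W) (g : U -> V) :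
  linear f -> linear g -> linear (fun x => f (g x)).
Proof. by move=> fL gL a x y; rewrite gL fL. Qed.

Lemma zmod_morph_add (U V : zmodType) (f g : U -> V) :
  zmod_morphism f -> zmod_morphism g -> zmod_morphism (fun x => f x + g x).
Proof. by move=> fB gB x y; rewrite fB gB opprD addrACA. Qed.

Lemma linear_add (R : pzRingType) (U V : lmodType R) (f g : U -> V) :
  linear f -> linear g -> linear (fun x => f x + g x).
Proof. by move=> fL gL a x y; rewrite fL gL scalerDr addrACA. Qed.

(** Finite sums of elements of [G], without opposites. The generating families used below are stable
    under opposites, so these sums already fill the group, and inductions over them have one case
    less. *)
Inductive aspan (V : zmodType) (G : V -> Prop) : V -> Prop :=
| aspan0 : aspan G 0
| aspanD x y : aspan G x -> aspan G y -> aspan G (x + y)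
| aspan_gen x : G x -> aspan G x.

Lemma aspan_eq (U V : zmodType) (G : U -> Prop) (f g : U -> V) :
    zmod_morphism f -> zmod_morphism g -> (forall x, G x -> f x = g x) ->
  forall x, aspan G x -> f x = g x.
Proof.
move=> fB gB fg x; elim=> {x} [|x y _ IHx _ IHy|x /fg //].
  by rewrite !zmod_morph0.
by rewrite !(zmod_morphD fB, zmod_morphD gB) IHx IHy.
Qed.

Lemma aspan_map (U V : zmodType) (G : U -> Prop) (H : V -> Prop) (f : U -> V) :
    zmod_morphism f -> (forall x, G x -> aspan H (f x)) ->
  forall x, aspan G x -> aspan H (f x).
Proof.
move=> fB GH x; elim=> {x} [|x y _ IHx _ IHy|x /GH //].
  by rewrite zmod_morph0 //; exact: aspan0.
by rewrite (zmod_morphD fB); exact: aspanD.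
Qed.

Lemma aspan_bind (V : zmodType) (G H : V -> Prop) :
  (forall y, G y -> aspan H y) -> forall x, aspan G x -> aspan H x.
Proof. exact: (aspan_map (f := id)). Qed.

Lemma aspan_sum (V : zmodType) (G : V -> Prop) (I : Type) (r : seq I) (F : I -> V) :
  (forall i, aspan G (F i)) -> aspan G (\sum_(i <- r) F i).
Proof. by move=> FG; elim/big_ind: _ => //; [exact: aspan0|exact: aspanD]. Qed.

End Additive.

(** * Endomorphism rings and presented rings *)

Section Endomorphisms.
Variable V : zmodType.

(** An action of a ring given by generators and relations is a ring morphism to [aend], hence is
    given by operators attached to the generators and satisfying the relations. *)
Record aend := AEnd { aend_fun :> V -> V; aend_morph : zmod_morphism aend_fun }.

HB.instance Definition _ := gen_eqMixin aend.
HB.instance Definition _ := gen_choiceMixin aend.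

Lemma aendP (f g : aend) : (forall x, f x = g x) -> f = g.
Proof.
case: f g => [f pf] [g pg] /= /funext fg.
by subst g; rewrite (Prop_irrelevance pf pg).
Qed.

Fact aend_zero_subproof : zmod_morphism (fun _ : V => 0 : V).
Proof. by move=> x y; rewrite subrr. Qed.
Definition aend_zero := AEnd aend_zero_subproof.
Fact aend_opp_subproof (f : aend) : zmod_morphism (fun x => - f x).
Proof. by move=> x y; rewrite (aend_morph f) opprD. Qed.
Definition aend_opp f := AEnd (aend_opp_subproof f).
Definition aend_add (f g : aend) :=
  AEnd (zmod_morph_add (aend_morph f) (aend_morph g)).
Fact aend_one_subproof : zmod_morphism (fun x : V => x).
Proof. by []. Qed.
Definition aend_one := AEnd aend_one_subproof.
Definition aend_mul (f g : aend) :=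
  AEnd (zmod_morph_comp (aend_morph f) (aend_morph g)).

Fact aend_addA : associative aend_add.
Proof. by move=> f g h; apply: aendP => x; rewrite /= addrA. Qed.
Fact aend_addC : commutative aend_add.
Proof. by move=> f g; apply: aendP => x; rewrite /= addrC. Qed.
Fact aend_add0 : left_id aend_zero aend_add.
Proof. by move=> f; apply: aendP => x; rewrite /= add0r. Qed.
Fact aend_addN : left_inverse aend_zero aend_opp aend_add.
Proof. by move=> f; apply: aendP => x; rewrite /= addNr. Qed.

HB.instance Definition _ :=
  GRing.isZmodule.Build aend aend_addA aend_addC aend_add0 aend_addN.

Fact aend_mulA : associative aend_mul. Proof. by move=> f g h; apply: aendP. Qed.
Fact aend_mul1l : left_id aend_one aend_mul. Proof. by move=> f; apply: aendP. Qed.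
Fact aend_mul1r : right_id aend_one aend_mul. Proof. by move=> f; apply: aendP. Qed.
Fact aend_mulDl : left_distributive aend_mul +%R.
Proof. by move=> f g h; apply: aendP. Qed.
Fact aend_mulDr : right_distributive aend_mul +%R.
Proof. by move=> f g h; apply: aendP => x /=; rewrite (zmod_morphD (aend_morph f)). Qed.

HB.instance Definition _ := GRing.Zmodule_isPzRing.Build aend
  aend_mulA aend_mul1l aend_mul1r aend_mulDl aend_mulDr.

Lemma aendD (f g : aend) x : (f + g) x = f x + g x. Proof. by []. Qed.
Lemma aendM (f g : aend) x : (f * g) x = f (g x). Proof. by []. Qed.

End Endomorphisms.

Definition is_rmorph (S T : pzRingType) (f : S -> T) : Prop :=
  zmod_morphism f /\ monoid_morphism f.

Section PresentedRingTheory.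
Variables (X : Type) (rel : rterm X -> rterm X -> Prop).

Lemma pring_lift (T : pzRingType) (v : X -> T) :
    (forall s t, rel s t -> reval v s = reval v t) ->
  exists f : pring rel -> T, is_rmorph f /\ forall x, f (rgen rel x) = v x.
Proof.
move=> v_rel.
have vE s t : rcong rel s t -> reval v s = reval v t.
  elim=> {s t} //=; try by [move=> *; congruence].
  - by move=> *; rewrite addrA.
  - by move=> *; rewrite addrC.
  - by move=> *; rewrite add0r.
  - by move=> *; rewrite addNr.
  - by move=> *; rewrite mulrA.
  - by move=> *; rewrite mul1r.
  - by move=> *; rewrite mulr1.
  - by move=> *; rewrite mulrDl.
  - by move=> *; rewrite mulrDr.
pose f (p : pring rel) := reval v (Defs.repr p).
have fE t : f (cls (rcong rel) t) = reval v t by apply: vE; apply: rrepr_cls.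
exists f; split=> [|x]; last by rewrite fE.
split; first apply: zmod_morphismP; last split.
- elim/quo_ind => s; elim/quo_ind => t.
  by rewrite /GRing.add /= pring_addE !fE.
- by rewrite fE.
- elim/quo_ind => s; elim/quo_ind => t.
  by rewrite /GRing.mul /= pring_mulE !fE.
Qed.

Lemma pring_ind (P : pring rel -> Prop) :
    P 0 -> P 1 -> (forall x y, P x -> P y -> P (x + y)) ->
    (forall x, P x -> P (- x)) -> (forall x y, P x -> P y -> P (x * y)) ->
    (forall x, P (rgen rel x)) -> forall x, P x.
Proof.
move=> P0 P1 PD PN PM Pg; elim/quo_ind; elim=> //= [s IHs t IHt|s IHs|s IHs t IHt].
- by rewrite -pring_addE; exact: PD.
- by rewrite -pring_oppE; exact: PN.
- by rewrite -pring_mulE; exact: PM.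
Qed.

End PresentedRingTheory.

Section TensorTheory.
Variables (S : pzRingType) (T : Type) (M : lmodType S) (N : zmodType).
Variables (ra : M -> T -> M) (la : T -> N -> N).
Local Notation MN := (tens ra la).

Lemma tmkBl n : zmod_morphism (fun m => tmk ra la m n).
Proof. by apply: zmod_morphismP => m m'; exact: tmkDl. Qed.
Lemma tmkBr m : zmod_morphism (tmk ra la m).
Proof. by apply: zmod_morphismP => n n'; exact: tmkDr. Qed.
Lemma tmk0l n : tmk ra la 0 n = 0. Proof. exact: (zmod_morph0 (tmkBl n)). Qed.
Lemma tmk0r m : tmk ra la m 0 = 0. Proof. exact: (zmod_morph0 (tmkBr m)). Qed.

Lemma tens_span (z : MN) : aspan (fun z => exists m n, z = tmk ra la m n) z.
Proof.
elim/tens_ind: z => [|x y|m n]; [exact: aspan0|exact: aspanD|].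
by apply: aspan_gen; exists m, n.
Qed.

Lemma tens_eq (V : zmodType) (f g : MN -> V) :
    zmod_morphism f -> zmod_morphism g ->
    (forall m n, f (tmk ra la m n) = g (tmk ra la m n)) -> forall z, f z = g z.
Proof.
move=> fB gB fg z.
by apply: (aspan_eq fB gB) (tens_span z) => _ [m [n ->]].
Qed.

(** Serves [is_comult], where multiplicativity is expressed through finite sums of pure tensors. *)
Lemma tens_seq (z : MN) :
  exists s : seq (M * N), z = \sum_(p <- s) tmk ra la p.1 p.2.
Proof.
elim/tens_ind: z => [|_ _ [s ->] [s' ->]|m n].
- by exists [::]; rewrite big_nil.
- by exists (s ++ s'); rewrite big_cat.
- by exists [:: (m, n)]; rewrite big_seq1.
Qed.

Lemma tlift_linear (V : lmodType S) (h : M -> N -> V) :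
    (forall m, zmod_morphism (h m)) -> (forall n, linear (h^~ n)) ->
    (forall m t n, h (ra m t) n = h m (la t n)) ->
  linear (tlift h : MN -> V) /\ forall m n, (tlift h : MN -> V) (tmk ra la m n) = h m n.
Proof.
move=> hr hl hb; have hE m n : (tlift h : MN -> V) (tmk ra la m n) = h m n.
  apply: tliftE => // [m' m'' n'|m' n' n''|s m' n'].
  - exact: (linear_atD (hl n')).
  - exact: (zmod_morphD (hr m')).
  - exact: (linear_scale (hl n') s m').
split=> //; apply: linearI => [|a z]; first exact: tliftD.
pose tB := @tliftD S T M N ra la V h.
elim/tens_ind: z => [|x y IHx IHy|m n].
- by rewrite scaler0 (zmod_morph0 tB) scaler0.
- by rewrite scalerDr !(zmod_morphD tB) IHx IHy scalerDr.
- by rewrite -tmkZ !hE (linear_scale (hl n)).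
Qed.

End TensorTheory.

Section DirectSumTheory.
Variables (S : pzRingType) (I : eqType) (V : I -> lmodType S).
Local Notation D := (dsum V).

Lemma din_same i (v : V i) : din v i = v.
Proof. exact: dfwith_in. Qed.

Lemma din_ne i j (v : V i) : i != j -> din v j = 0.
Proof. by move=> ij; rewrite /= dfwith_out. Qed.

Lemma dsum_addE (x y : D) i : (x + y) i = x i + y i. Proof. by []. Qed.
Lemma dsum_scaleE a (x : D) i : (a *: x) i = a *: x i. Proof. by []. Qed.

Lemma dsum_proj_linear i : linear ((fun x => x i) : D -> V i).
Proof. by []. Qed.

Lemma din_linear i : linear (@din S I V i).
Proof.
move=> a x y; apply: dsumP => j; rewrite dsum_addE dsum_scaleE.
have [<-|ij] := eqVneq i j; first by rewrite !din_same.
by rewrite !(din_ne _ ij) scaler0 addr0.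
Qed.

Lemma dsum_sumE (r : seq I) (F : I -> D) i : (\sum_(j <- r) F j) i = \sum_(j <- r) F j i.
Proof. exact: (zmod_morph_sum r xpredT F (linear_zmod (dsum_proj_linear i))). Qed.

Lemma dsum_decomp (x : D) (s : seq I) :
  uniq s -> (forall i, i \notin s -> x i = 0) -> x = \sum_(i <- s) din (x i).
Proof.
move=> us xs; apply: dsumP => i; rewrite dsum_sumE.
have [is_|nis] := boolP (i \in s).
  rewrite (bigD1_seq i) // din_same big1 => [|j ji]; first by rewrite /= addr0.
  exact: din_ne.
rewrite xs // big_seq big1 // => j js; apply: din_ne.
by apply: contraNneq nis => <-.
Qed.

Lemma dsum_supp (x : D) : exists2 s, uniq s & forall i, i \notin s -> x i = 0.
Proof.
have [s xs] := dsum_fin x; exists (undup s); first exact: undup_uniq.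
by move=> i; rewrite mem_undup; exact: xs.
Qed.

Lemma dsum_span (x : D) : aspan (fun x => exists i (v : V i), x = din v) x.
Proof.
have [s us xs] := dsum_supp x; rewrite (dsum_decomp us xs).
by apply: aspan_sum => i; apply: aspan_gen; exists i, (x i).
Qed.

Lemma dsum_eq (W : zmodType) (f g : D -> W) :
    zmod_morphism f -> zmod_morphism g ->
    (forall i (v : V i), f (din v) = g (din v)) -> forall x, f x = g x.
Proof.
by move=> fB gB fg x; apply: (aspan_eq fB gB) (dsum_span x) => _ [i [v ->]].
Qed.

Lemma dsum_lift_add (W : zmodType) (h : forall i, V i -> W) :
    (forall i, zmod_morphism (h i)) ->
  exists f : D -> W, zmod_morphism f /\ forall i v, f (din v) = h i v.
Proof.
move=> hB.
pose supp x := s2val (cid2 (dsum_supp x)).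
pose f (x : D) := \sum_(i <- supp x) h i (x i).
have h0 i : h i 0 = 0 := zmod_morph0 (hB i).
have fE (x : D) (s : seq I) : uniq s -> (forall i, i \notin s -> x i = 0) ->
    f x = \sum_(i <- s) h i (x i).
  rewrite /f /supp; case: cid2 => t /= ut xt us xs.
  (* Terms outside [b] vanish, so the sums over two supports reduce to their common part; the value
     does not depend on the chosen support. *)
  have key (a b : seq I) : (forall i, i \notin b -> x i = 0) ->
      \sum_(i <- a) h i (x i) = \sum_(i <- a | i \in b) h i (x i).
    move=> xb; rewrite [RHS]big_mkcond; apply: eq_bigr => i _.
    by case: ifPn => // /xb ->.
  rewrite (key t s) // (key s t) // -[LHS]big_filter -[RHS]big_filter.
  apply: perm_big; apply: uniq_perm; rewrite ?filter_uniq // => i.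
  by rewrite !mem_filter andbC.
exists f; split=> [|i v].
  apply: zmod_morphismP => x y.
  have [[s us xs] [t ut yt]] := (dsum_supp x, dsum_supp y).
  pose u := undup (s ++ t).
  have uu : uniq u by exact: undup_uniq.
  have xu i : i \notin u -> x i = 0.
    by rewrite mem_undup mem_cat negb_or => /andP[/xs].
  have yu i : i \notin u -> y i = 0.
    by rewrite mem_undup mem_cat negb_or => /andP[_ /yt].
  have xyu i : i \notin u -> (x + y) i = 0.
    by move=> iu; rewrite dsum_addE xu // yu // addr0.
  rewrite (fE _ u) // (fE x u) // (fE y u) // -big_split /=.
  by apply: eq_bigr => i _; rewrite (zmod_morphD (hB i)).
rewrite (fE _ [:: i]) // ?big_seq1 ?din_same // => j; rewrite inE eq_sym.
exact: din_ne.
Qed.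

Lemma dsum_lift (W : lmodType S) (h : forall i, V i -> W) :
    (forall i, linear (h i)) ->
  exists f : D -> W, linear f /\ forall i v, f (din v) = h i v.
Proof.
move=> hL; have [i|f [fB fE]] := @dsum_lift_add W h; first exact: linear_zmod.
exists f; split=> //; apply: linearI => // a x.
pose g (x : D) := f (a *: x); pose g' (x : D) := a *: f x.
have gB : zmod_morphism g by move=> y z; rewrite /g scalerBr fB.
have g'B : zmod_morphism g' by move=> y z; rewrite /g' fB scalerBr.
apply: (dsum_eq gB g'B) => i v.
by rewrite /g /g' -(linear_scale (din_linear (i := i))) !fE (linear_scale (hL i)).
Qed.

End DirectSumTheory.

Lemma bract_zmod (S T : pzRingType) (M : bimod S T) t :
  zmod_morphism (fun m : M => bract m t).
Proof. by apply: zmod_morphismP => x y; exact: bractDl. Qed.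

Lemma scale_linear (R : pzRingType) (Rc : forall x y : R, x * y = y * x)
  (V : lmodType R) a : linear (fun x : V => a *: x).
Proof. by move=> b x y; rewrite scalerDr !scalerA Rc. Qed.

(** * The coendomorphism bialgebroid and its generators x, y *)

Section RingLifts.

Lemma rquot_lift (S T : pzRingType) (rel : S -> S -> Prop) (v : S -> T) :
    is_rmorph v -> (forall x y, rel x y -> v x = v y) ->
  exists f : rquot rel -> T, is_rmorph f /\ forall x, f (rproj rel x) = v x.
Proof.
move=> [vB [v1 vM]] v_rel; apply: pring_lift => _ _ [|x y|x y|x y /v_rel] //=.
exact: (zmod_morphD vB).
Qed.

Lemma tring_lift (S T : pzRingType) (M : zmodType) (la : S -> M -> M)
    (ra : M -> S -> M) (q : S -> T) (p : M -> T) :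
    is_rmorph q -> zmod_morphism p ->
    (forall s m, p (la s m) = q s * p m) -> (forall m s, p (ra m s) = p m * q s) ->
  exists f : tring la ra -> T,
    [/\ is_rmorph f, forall s, f (tscal la ra s) = q s &
        forall m, f (tvect la ra m) = p m].
Proof.
move=> [qB [q1 qM]] pB pl pr.
pose v x := match x with inl s => q s | inr m => p m end.
have [_ _ []|f [fR fE]] := @pring_lift _ (tring_rel la ra) T v; rewrite /v //=.
- exact: (zmod_morphD qB).
- exact: (zmod_morphD pB).
by exists f; split=> // x; exact: fE.
Qed.

(** The image of [rproj] contains the generators of the quotient and is stable under the ring
    operations, so [rproj] is onto. *)
Lemma rmorph_comp_ind (S : pzRingType) (rel : S -> S -> Prop)
    (P : rquot rel -> Prop) :
    (forall x, P (rproj rel x)) -> forall z, P z.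
Proof.
move=> Pr z; suff [x ->] : exists x, z = rproj rel x by [].
have rB : zmod_morphism (rproj rel) by apply: zmod_morphismP; exact: rprojD.
elim/pring_ind: z => [||_ _ [x ->] [y ->]|_ [x ->]|_ _ [x ->] [y ->]|x].
- by exists 0; rewrite zmod_morph0.
- by exists 1; rewrite rproj1.
- by exists (x + y); rewrite rprojD.
- by exists (- x); rewrite zmod_morphN.
- by exists (x * y); rewrite rprojM.
- by exists x.
Qed.

End RingLifts.

Section CoendStructure.
Variables (k : comPzRingType) (R : kalgebra k).
Local Notation A := (triv R).
Local Notation L := (coend R).

(** The action is a lift over R^e around a lift over the tensor product of A and its dual. The outer
    lift is legitimate because k is central in R: a scalar c passes from r to s through the inner
    tensor product over k. *)
Lemma adual_lact_rmk r s (m : adual R) :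
  adual_lact (rmk r s) m =
  alift (fun a f => amk (triv_in r * a) (dual_ract f s)) m.
Proof.
have aB (h : A -> dual R -> adual R) : zmod_morphism (alift h).
  by move=> x y; exact: tliftD.
have aE (r' s' : R) (a : A) (f : dual R) : alift (fun a f => amk (triv_in r' * a)
  (dual_ract f s')) (amk a f)
    = amk (triv_in r' * a) (dual_ract f s').
  apply: (@tlift_addE A k A^o (dual R) _ _ _
    (fun a f => amk (triv_in r' * a) (dual_ract f s'))) => [x y g|x g h|x y c g].
  - by rewrite mulrDr; exact: tmkDl.
  - have -> : dual_ract (g + h) s' = dual_ract g s' + dual_ract h s'.
      by apply: dualP => z /=; rewrite mulrDl.
    exact: tmkDr.
  - have -> : triv_in r' * (x *: (y * triv_in (kstr R c) : A^o) : A^o)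
      = (triv_in r' * (x * y)) * triv_in (kstr R c) by rewrite /GRing.scale /= !mulrA.
    rewrite /amk [LHS]tmk_bal; congr tmk; apply: dualP => z /=.
    by rewrite -!mulrA kstr_central.
rewrite /adual_lact (rliftE (h := fun r s =>
  alift (fun a f => amk (triv_in r * a) (dual_ract f s)) m)) // => [x y z|x y z|x c y];
  elim/tens_ind: m => [|u u' IH IH'|a f]; rewrite ?(zmod_morph0 (aB _)) ?addr0 //;
  rewrite ?(zmod_morphD (aB _)) ?IH ?IH' 1?addrACA // -/(amk a f) !aE.
- by rewrite triv_inD mulrDl; exact: tmkDl.
- have -> : dual_ract f (y + z) = dual_ract f y + dual_ract f z.
    by apply: dualP => w /=; rewrite mulrDr.
  exact: tmkDr.
- have -> : triv_in (x * kstr R c) * a = triv_in x * a * triv_in (kstr R c).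
    rewrite triv_inM -!mulrA; congr (_ * _).
    by congr pair; rewrite /= ?mul0r ?mulr0 ?addr0 ?add0r kstr_central.
  rewrite /amk [LHS]tmk_bal; congr tmk; apply: dualP => w /=.
  by rewrite -mulrA kstr_central.
Qed.

Lemma amkBl f : zmod_morphism ((@amk k R)^~ f).
Proof. by apply: zmod_morphismP => x y; exact: tmkDl. Qed.
Lemma amkBr a : zmod_morphism (@amk k R a).
Proof. by apply: zmod_morphismP => x y; exact: tmkDr. Qed.
Lemma amk_bal a c f :
  amk (a * triv_in (kstr R c)) f = amk a (dual_ract f (kstr R c)) :> adual R.
Proof. exact: tmk_bal. Qed.

Lemma adual_ind (P : adual R -> Prop) :
    P 0 -> (forall x y, P x -> P y -> P (x + y)) ->
    (forall a f, P (amk a f)) -> forall m, P m.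
Proof. exact: tens_ind. Qed.

Lemma alift_zmod (V : zmodType) (h : A -> dual R -> V) : zmod_morphism (alift h).
Proof. by move=> x y; exact: tliftD. Qed.

Lemma aliftE (V : zmodType) (h : A -> dual R -> V) :
    (forall f, zmod_morphism (h^~ f)) -> (forall a, zmod_morphism (h a)) ->
    (forall a c f, h (a * triv_in (kstr R c)) f = h a (dual_ract f (kstr R c))) ->
  forall a f, alift h (amk a f) = h a f.
Proof.
move=> hl hr hb a f.
apply: (@tlift_addE A k A^o (dual R) _ _ V (h : A^o -> dual R -> V))
  => [x y g|x g h'|x y c g].
- exact: (zmod_morphD (hl g)).
- exact: (zmod_morphD (hr x)).
- by rewrite -hb /GRing.scale /= mulrA.
Qed.

Lemma dual_lactDl a b (f : dual R) : dual_lact (a + b) f = dual_lact a f + dual_lact b f.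
Proof. by apply: dualP => x /=; rewrite mulrDr dualD. Qed.
Lemma kstr_triv (a : A) c : a * triv_in (kstr R c) = triv_in (kstr R c) * a.
Proof. by congr pair; rewrite /= ?mul0r ?mulr0 ?addr0 ?add0r kstr_central. Qed.

Lemma adual_lactE r s a f :
  adual_lact (rmk r s) (amk a f) = amk (triv_in r * a) (dual_ract f s) :> adual R.
Proof.
rewrite adual_lact_rmk aliftE // => [g x y|x g h|x c g].
- by rewrite mulrBr amkBl.
- by rewrite -(amkBr _); congr amk; apply: dualP => y /=; rewrite mulrBl.
- by rewrite mulrA amk_bal; congr amk; apply: dualP => y /=; rewrite -!mulrA kstr_central.
Qed.

Lemma adual_ract_rmkE p q a f :
  alift (fun a f => amk (a * triv_in p) (dual_lact (triv_in q) f)) (amk a f)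
  = amk (a * triv_in p) (dual_lact (triv_in q) f) :> adual R.
Proof.
apply: aliftE => [g x y|x g h|x c g].
- by rewrite mulrBl amkBl.
- by rewrite -(amkBr _); congr amk; apply: dualP.
- by rewrite -mulrA -kstr_triv mulrA amk_bal; congr amk; apply: dualP.
Qed.

Lemma adual_ract_rmk p q (m : adual R) :
  adual_ract m (rmk p q) =
  alift (fun a f => amk (a * triv_in p) (dual_lact (triv_in q) f)) m.
Proof.
rewrite /adual_ract (rliftE (h := fun p q =>
  alift (fun a f => amk (a * triv_in p) (dual_lact (triv_in q) f)) m)) //
  => [x y z|x y z|x c y]; elim/adual_ind: m => [|u u' IH IH'|a f];
  rewrite ?(zmod_morph0 (alift_zmod _)) ?addr0 //;
  rewrite ?(zmod_morphD (alift_zmod _)) ?IH ?IH' 1?addrACA // !adual_ract_rmkE.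
- by rewrite triv_inD mulrDr; exact: tmkDl.
- by rewrite triv_inD dual_lactDl; exact: tmkDr.
- rewrite triv_inM mulrA amk_bal; congr amk; apply: dualP => w /=.
  by rewrite triv_inM mulrA kstr_triv -mulrA dualZ kstr_central.
Qed.

Lemma adual_ractE p q a f :
  adual_ract (amk a f) (rmk p q) =
  amk (a * triv_in p) (dual_lact (triv_in q) f) :> adual R.
Proof. by rewrite adual_ract_rmk adual_ract_rmkE. Qed.

Lemma adual_lact_zmodl (m : adual R) : zmod_morphism (fun u => adual_lact u m).
Proof. by move=> x y; exact: rliftD. Qed.
Lemma adual_ract_zmodr (m : adual R) : zmod_morphism (adual_ract m).
Proof. by move=> x y; exact: rliftD. Qed.
Lemma adual_lact_zmodr r s : zmod_morphism (@adual_lact k R (rmk r s)).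
Proof. by move=> x y; rewrite !adual_lact_rmk alift_zmod. Qed.
Lemma adual_ract_zmodl p q : zmod_morphism (fun m : adual R => adual_ract m (rmk p q)).
Proof. by move=> x y; rewrite !adual_ract_rmk alift_zmod. Qed.

Lemma dual_triv0 (f : dual R) : f 0 = 0.
Proof. by apply: (addrI (f 0)); rewrite -dualD !addr0. Qed.

Lemma dual_normal (f : dual R) (a : A) : f a = a.1 * f 1 + a.2 * f (ebase R true).
Proof.
rewrite -!dualZ -dualD; congr dual_fun; case: a => x y.
by congr pair; rewrite /= ?mulr1 ?mulr0 ?mul0r ?addr0 ?add0r.
Qed.

Lemma tvect_zmod : zmod_morphism (tvect (@adual_lact k R) (@adual_ract k R)).
Proof.
apply: zmod_morphismP => x y.
exact: (pring_rel (tr_vadd (@adual_lact k R) (@adual_ract k R) x y)).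
Qed.

Lemma cproj_zmod : zmod_morphism (@cproj k R).
Proof. by apply: zmod_morphismP => x y; exact: rprojD. Qed.

Lemma cpi_zmodl f : zmod_morphism ((@cpi k R)^~ f).
Proof. by move=> x y; rewrite /cpi amkBl tvect_zmod cproj_zmod. Qed.
Lemma cpi_zmodr a : zmod_morphism (@cpi k R a).
Proof. by move=> x y; rewrite /cpi amkBr tvect_zmod cproj_zmod. Qed.
Lemma cio_zmodl s : zmod_morphism ((@cio k R)^~ s).
Proof. by apply: zmod_morphismP => x y; exact: cioDl. Qed.
Lemma cio_zmodr r : zmod_morphism (@cio k R r).
Proof. by apply: zmod_morphismP => x y; exact: cioDr. Qed.

Lemma cio_cpi r s a f : cio r s * cpi a f = cpi (triv_in r * a) (dual_ract f s) :> L.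
Proof.
rewrite /cpi -adual_lactE /cio /cproj -rprojM; congr rproj.
exact: esym (pring_rel (tr_lact _ _ _ _)).
Qed.

Lemma cpi_cio a f p q :
  cpi a f * cio p q = cpi (a * triv_in p) (dual_lact (triv_in q) f) :> L.
Proof.
rewrite /cpi -adual_ractE /cio /cproj -rprojM; congr rproj.
exact: esym (pring_rel (tr_ract _ _ _ _)).
Qed.

Lemma cpi_unit f : cpi 1 f = cio 1 (f 1) :> L.
Proof. exact: esym (rproj_rel (coend_unit f)). Qed.

Lemma cpi_mul a a' f :
  cpi (a * a') f = cpi a f * cpi a' (edual R false)
    + cpi a (dual_lact (ebase R true) f) * cpi a' (edual R true) :> L.
Proof.
rewrite /cpi /cproj -(rproj_rel (coend_mul a a' f)) big_bool rprojD !rprojM addrC.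
congr (_ * _ + _); congr rproj; congr tvect; congr amk; apply: dualP => x /=.
by congr dual_fun; exact: mulr1.
Qed.

(** [cX] and [cY] are the coefficients of the universal coaction t |-> x (x) 1 + y (x) t on A; those
    of 1 are scalars by the unit relation. *)
Definition cX : L := cpi (ebase R true) (edual R false).
Definition cY : L := cpi (ebase R true) (edual R true).

Lemma edual_normal (f : dual R) :
  f = dual_ract (edual R false) (f 1) + dual_ract (edual R true) (f (ebase R true)).
Proof. by apply: dualP => x /=; rewrite dual_normal. Qed.

Lemma triv_normal (a : A) : a = triv_in a.1 * 1 + triv_in a.2 * ebase R true.
Proof.
by case: a => x y; congr pair; rewrite /= ?mulr1 ?mulr0 ?mul0r ?addr0 ?add0r.
Qed.

(** On the part of a along 1 the unit relation gives a scalar; on the part along t, expanding f in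
    the dual basis gives x and y. So R^e, x and y generate L(A). *)
Lemma cpi_normal a f :
  cpi a f = cio a.1 (f 1) + cio a.2 (f 1) * cX + cio a.2 (f (ebase R true)) * cY.
Proof.
rewrite {1}[a]triv_normal (zmod_morphD (cpi_zmodl f)) -addrA; congr (_ + _).
  rewrite -[X in cpi _ X](_ : dual_ract f 1 = f).
    by rewrite -cio_cpi cpi_unit cioM !mulr1.
  by apply: dualP => x /=; rewrite mulr1.
rewrite {1}[f]edual_normal (zmod_morphD (cpi_zmodr _)).
by rewrite -!cio_cpi.
Qed.

Lemma cX_cio r s : cX * cio r s = cio r s * cX.
Proof.
rewrite /cX cio_cpi cpi_cio; congr cpi; first by congr pair; rewrite /= ?mulr1 ?mul1r ?mul0r
  ?mulr0 ?addr0 ?add0r.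
by apply: dualP.
Qed.

Lemma cY_cio r s : cY * cio r s = cio r s * cY.
Proof.
rewrite /cY cio_cpi cpi_cio; congr cpi; first by congr pair; rewrite /= ?mulr1 ?mul1r ?mul0r
  ?mulr0 ?addr0 ?add0r.
by apply: dualP => x /=; rewrite mulr0 add0r.
Qed.

Lemma ebaseTT : ebase R true * ebase R true = 0.
Proof. by congr pair; rewrite /= ?mulr0 ?mul0r ?addr0. Qed.

(** This relation and the next one come from t t = 0. The multiplication relation for the pair (t,
    t) gives x^2 = 0 at the coordinate on 1, which t annihilates, and yx + xy = 0 at the coordinate
    on t, which t sends to the coordinate on 1. *)
Lemma cXX : cX * cX = 0.
Proof.
have := cpi_mul (ebase R true) (ebase R true) (edual R false).
rewrite ebaseTT (zmod_morph0 (cpi_zmodl _)) => ->.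
have -> : dual_lact (ebase R true) (edual R false) = 0.
  by apply: dualP => x /=; rewrite mulr0.
by rewrite (zmod_morph0 (cpi_zmodr _)) mul0r addr0.
Qed.

Lemma cXY : cX * cY = - (cY * cX).
Proof.
have := cpi_mul (ebase R true) (ebase R true) (edual R true).
rewrite ebaseTT (zmod_morph0 (cpi_zmodl _)).
have -> : dual_lact (ebase R true) (edual R true) = edual R false.
  by apply: dualP => x /=; rewrite mulr0 addr0 mulr1.
by move/eqP; rewrite eq_sym addrC addr_eq0 => /eqP.
Qed.

(* The ring L(A) is generated by R^e and two R^e-invariant elements x, y
   subject to x^2 = 0 and xy + yx = 0. *)
Lemma coend_lift (T : pzRingType) (q : R -> R -> T) (x y : T) :
    (forall s, zmod_morphism (q^~ s)) -> (forall r, zmod_morphism (q r)) ->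
    (forall r c s, q (r * kstr R c) s = q r (kstr R c * s)) ->
    q 1 1 = 1 -> (forall r s r' s', q r s * q r' s' = q (r * r') (s' * s)) ->
    (forall r s, x * q r s = q r s * x) -> (forall r s, y * q r s = q r s * y) ->
    x * x = 0 -> x * y = - (y * x) ->
  exists F : L -> T,
    [/\ is_rmorph F, forall r s, F (cio r s) = q r s, F cX = x & F cY = y].
Proof.
move=> ql qr qb q1 qM xq yq xx xy.
have q0r r : q r 0 = 0 by exact: zmod_morph0 (qr r).
have q0l s : q 0 s = 0 by exact: zmod_morph0 (ql s).
(* The value on pi(a (x) f) is forced by [cpi_normal]. *)
pose p (a : A) (f : dual R) := q a.1 (f 1) + q a.2 (f 1) * x + q a.2 (f (ebase R true)) * y.
have pl f : zmod_morphism (p^~ f).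
  by do 2?[apply: zmod_morph_add] => a b; rewrite /= ql ?mulrBl.
have pr a : zmod_morphism (p a).
  by do 2?[apply: zmod_morph_add] => f g; rewrite /= qr ?mulrBl.
have pb a c f : p (a * triv_in (kstr R c)) f = p a (dual_ract f (kstr R c)).
  by rewrite /p /= mulr0 add0r !qb !kstr_central.
have paE a f : alift p (amk a f) = p a f by exact: aliftE.
have rE r s : rlift q (rmk r s) = q r s.
  by apply: rliftE => // *; [exact: zmod_morphD (ql _) _ _|exact: zmod_morphD (qr _) _ _].
have rM : is_rmorph (rlift q : renv R -> T).
  split; first exact: rliftD.
  have rB := @rliftD k R T q; have r0 := zmod_morph0 rB; have rD := zmod_morphD rB.
  split; first exact: etrans (rE 1 1) q1.
  move=> u v; elim/renv_ind: u => [|u u' IH IH'|r s]; first by rewrite mul0r r0 mul0r.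
    by rewrite mulrDl !rD IH IH' mulrDl.
  elim/renv_ind: v => [|u u' IH IH'|r' s']; first by rewrite mulr0 r0 mulr0.
    by rewrite mulrDr !rD IH IH' mulrDr.
  by rewrite [_ * _ : renv R]renv_mulE !rE qM.
have [|u m|m u|G [GR Gs Gv]] := @tring_lift _ _ _ (@adual_lact k R) (@adual_ract k R)
  _ (alift p : adual R -> T) rM.
- exact: alift_zmod.
- elim/renv_ind: u => [|u u' IH IH'|r s].
  + by rewrite (zmod_morph0 (adual_lact_zmodl _)) !(zmod_morph0 (alift_zmod _))
    (zmod_morph0 rM.1) mul0r.
  + by rewrite (zmod_morphD (adual_lact_zmodl _)) !(zmod_morphD (alift_zmod _))
    (zmod_morphD rM.1) mulrDl IH IH'.
  elim/adual_ind: m => [|m m' IH IH'|a f].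
  + by rewrite (zmod_morph0 (adual_lact_zmodr _ _)) !(zmod_morph0 (alift_zmod _)) mulr0.
  + by rewrite (zmod_morphD (adual_lact_zmodr _ _)) !(zmod_morphD (alift_zmod _)) IH IH' mulrDr.
  rewrite adual_lactE !paE rE /p /= mul0r addr0.
  by rewrite !mulrDr !mulrA !qM.
- elim/renv_ind: u => [|u u' IH IH'|r s].
  + by rewrite (zmod_morph0 (adual_ract_zmodr _)) !(zmod_morph0 (alift_zmod _))
    (zmod_morph0 rM.1) mulr0.
  + by rewrite (zmod_morphD (adual_ract_zmodr _)) !(zmod_morphD (alift_zmod _))
    (zmod_morphD rM.1) mulrDr IH IH'.
  elim/adual_ind: m => [|m m' IH IH'|a f].
  + by rewrite (zmod_morph0 (adual_ract_zmodl _ _)) !(zmod_morph0 (alift_zmod _)) mul0r.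
  + by rewrite (zmod_morphD (adual_ract_zmodl _ _)) !(zmod_morphD (alift_zmod _)) IH IH' mulrDl.
  rewrite adual_ractE !paE rE /p /= mulr0 add0r.
  (* 1 and t commute with R, so left linearity of f also governs its values at 1 s and t s. *)
  have -> : f (1 * triv_in s) = s * f 1 by rewrite -dualZ mul1r mulr1.
  have -> : f (ebase R true * triv_in s) = s * f (ebase R true).
    by rewrite -dualZ; congr dual_fun; congr pair; rewrite /= ?mul0r ?mulr0 ?mul1r ?mulr1 ?addr0
      ?add0r.
  by rewrite !mulrDl -!mulrA xq yq !mulrA !qM.
have [GB [G1 GM]] := GR.
have [_ _ [a a' f|f]|F [FR FE]] := @rquot_lift _ _ (@coend_rel k R) G GR.
(* The multiplication relation: after expansion the term in x x vanishes and those in x y and y x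
   cancel; the remaining ones are the value at the product. *)
- rewrite (zmod_morph_sum _ _ _ GB) big_bool !GM !Gv !paE /p /=.
  have := ebaseTT; rewrite /ebase => ->; rewrite -[(1, 0)]/(1 : A) !mulr1 !mul1r dual_triv0 !q0r
    !mul0r !addr0 !add0r.
  set u := f 1; set v := f (0, 1).
  rewrite !mulrDl !mulrDr !(zmod_morphD (ql _)) -!mulrA.
  rewrite ![x * (q _ _ * _)]mulrA ![y * (q _ _ * _)]mulrA !xq !yq -!mulrA xx xy !mulrN.
  rewrite !mulrA !qM !mul1r !mulr0 addr0 !mulrDl.
  rewrite [LHS]addrC -!addrA; do 3![congr (_ + _)].
  by rewrite [X in _ + X]addrCA subrr addr0 addrC.
- rewrite Gs Gv rE paE /p /= !q0l !mul0r !addr0 //.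
exists F; split=> // [r s||].
- by rewrite [LHS]FE Gs rE.
- by rewrite [LHS]FE Gv paE /p /= q0l q1 q0r mul0r mul1r addr0 add0r.
- by rewrite [LHS]FE Gv paE /p /= q0l q1 q0r mul0r mul1r !add0r.
Qed.

End CoendStructure.

(** * The monomials x^i y^n span L(A) over R^e *)

Section CoendBasis.
Variables (k : comPzRingType) (R : kalgebra k).
Local Notation A := (triv R).
Local Notation L := (coend R).
Local Notation cX := (cX R).
Local Notation cY := (cY R).

(** Opposites are products with the scalar -1, and a generator pi(a (x) f) is expanded by
    [cpi_normal]. *)
Lemma coend_ind (P : L -> Prop) :
    (forall x y, P x -> P y -> P (x + y)) -> (forall x y, P x -> P y -> P (x * y)) ->
    (forall r s, P (cio r s)) -> P cX -> P cY -> forall x, P x.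
Proof.
move=> PD PM Pio PX PY.
have P0 : P 0 by rewrite -(zmod_morph0 (cio_zmodl 0)).
elim/rmorph_comp_ind; elim/pring_ind => [||x y Px Py|x Px|x y Px Py|[u|m]].
- by rewrite -[rproj _ _]/(cproj _) zmod_morph0 //; exact: cproj_zmod.
- by rewrite rproj1 -cio1.
- by rewrite rprojD; exact: PD.
- have -> : - x = -1 * x by rewrite mulN1r.
  rewrite rprojM; apply: PM => //.
  rewrite -[rproj _ _]/(cproj (- (1 : adual_tring R))) (zmod_morphN (@cproj_zmod _ _)).
  by rewrite [cproj _]rproj1 -cio1 -(zmod_morphN (cio_zmodl 1)).
- by rewrite rprojM; exact: PM.
- elim/renv_ind: u => [|u v Pu Pv|r s]; last exact: Pio.
  + rewrite [rgen _ _](_ : _ = 0) //; first by rewrite -[rproj _ _]/(cproj _) zmod_morph0 //;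
    exact: cproj_zmod.
    have tB : zmod_morphism (tscal (@adual_lact k R) (@adual_ract k R)).
      by apply: zmod_morphismP; exact: tscalD.
    exact: (zmod_morph0 tB).
  + by have := PD _ _ Pu Pv; rewrite -rprojD -tscalD.
- elim/adual_ind: m => [|u v Pu Pv|a f].
  + rewrite [rgen _ _](_ : _ = 0) //; first by rewrite -[rproj _ _]/(cproj _) zmod_morph0 //;
    exact: cproj_zmod.
    exact: (zmod_morph0 (@tvect_zmod k R)).
  + by have := PD _ _ Pu Pv; rewrite -rprojD -(zmod_morphD (@tvect_zmod k R)).
  + rewrite -[rproj _ _]/(cpi a f) cpi_normal; apply: (PD); first apply: (PD) => //.
    all: exact: (PM).
Qed.

(** Normal form of a word in x and y up to sign: yx = -xy moves x to the front, and by x^2 = 0 its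
    exponent is a boolean. *)
Definition cw (i : bool) (n : nat) : L := cX ^+ i * cY ^+ n.

Lemma cw_cio i n r s : cw i n * cio r s = cio r s * cw i n.
Proof.
rewrite /cw -mulrA; have -> : cY ^+ n * cio r s = cio r s * cY ^+ n.
  exact: esym (commrX n (esym (cY_cio r s) : GRing.comm (cio r s) cY)).
rewrite !mulrA; congr (_ * _).
exact: esym (commrX i (esym (cX_cio r s) : GRing.comm (cio r s) cX)).
Qed.

Lemma cX_w i n : cX * cw i n = if i then 0 else cw true n.
Proof. by case: i; rewrite /cw ?expr1 ?expr0 ?mul1r // mulrA cXX mul0r. Qed.

Lemma cY_w i n : cY * cw i n = (-1) ^+ i * cw i n.+1.
Proof.
case: i; rewrite /cw ?expr1 ?expr0 ?mul1r ?exprS // mulN1r !mulrA cXY mulNr opprK.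
by rewrite -mulrA.
Qed.

(** This span contains 1 and is stable under left multiplication by each generator of L(A). *)
Lemma coend_span (z : L) :
  aspan (fun z => exists r s i n, z = cio r s * cw i n) z.
Proof.
pose G := fun z : L => exists r s i n, z = cio r s * cw i n.
suff H : forall u, aspan G u -> aspan G (z * u).
  rewrite -[z]mulr1; apply: H; apply: aspan_gen; exists 1, 1, false, 0%N.
  by rewrite cio1 mul1r /cw !expr0 mulr1.
elim/coend_ind: z => [x y IHx IHy|x y IHx IHy|r s||] u Gu.
- by rewrite mulrDl; apply: aspanD; [exact: IHx|exact: IHy].
- by rewrite -mulrA; apply: IHx; exact: IHy.
- apply: (aspan_map (f := *%R (cio r s))) Gu => [x y|_ [r' [s' [i [n ->]]]]].
    by rewrite mulrBr.
  by apply: aspan_gen; rewrite mulrA cioM; exists (r * r'), (s' * s), i, n.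
- apply: (aspan_map (f := *%R cX)) Gu => [x y|_ [r [s [i [n ->]]]]].
    by rewrite mulrBr.
  rewrite mulrA cX_cio -mulrA cX_w; case: i; first by rewrite mulr0; exact: aspan0.
  by apply: aspan_gen; exists r, s, true, n.
- apply: (aspan_map (f := *%R cY)) Gu => [x y|_ [r [s [i [n ->]]]]].
    by rewrite mulrBr.
  apply: aspan_gen; rewrite mulrA cY_cio -mulrA cY_w; exists ((-1) ^+ i * r), s, i, n.+1.
  case: i; rewrite ?expr0 ?expr1 ?mul1r //.
  by rewrite !mulN1r mulrN -mulNr (zmod_morphN (cio_zmodl _)).
Qed.

End CoendBasis.

(** * Existence of the comultiplication, and its values on monomials *)

Section Comultiplication.
Variables (k : comPzRingType) (R : kalgebra k).
Local Notation cX := (cX R).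
Local Notation cY := (cY R).
Local Notation L := (coend_bimod R).
Local Notation LL := (btens L L).
Local Notation lmk x y := (tmk _ _ (x : L) (y : L) : LL).

(** The tensor product over R identifies the right action on its left factor, by 1 (x) t^o, with the
    left action on its right factor, by t (x) 1^o. Left multiplication by a on the left factor and
    by b on the right one therefore descends when [lcomm a] and [rcomm b] hold, as they do for all
    factors that occur in the comultiplication of the generators. *)
Definition lcomm (a : coend R) := forall t, a * cio 1 t = cio 1 t * a.
Definition rcomm (a : coend R) := forall t, a * cio t 1 = cio t 1 * a.

Lemma lcommM a b : lcomm a -> lcomm b -> lcomm (a * b).
Proof. by move=> ca cb t; rewrite -mulrA cb mulrA ca mulrA. Qed.
Lemma rcommM a b : rcomm a -> rcomm b -> rcomm (a * b).
Proof. by move=> ca cb t; rewrite -mulrA cb mulrA ca mulrA. Qed.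
Lemma lcomm_cio r : lcomm (cio r 1).
Proof. by move=> t; rewrite !cioM !mul1r !mulr1. Qed.
Lemma rcomm_cio s : rcomm (cio 1 s).
Proof. by move=> t; rewrite !cioM !mul1r !mulr1. Qed.
Lemma lcommX : lcomm cX. Proof. by move=> t; exact: cX_cio. Qed.
Lemma rcommX : rcomm cX. Proof. by move=> t; exact: cX_cio. Qed.
Lemma lcommY : lcomm cY. Proof. by move=> t; exact: cY_cio. Qed.
Lemma rcommY : rcomm cY. Proof. by move=> t; exact: cY_cio. Qed.
Lemma lcomm1 : lcomm 1. Proof. by move=> t; rewrite mul1r mulr1. Qed.
Lemma rcomm1 : rcomm 1. Proof. by move=> t; rewrite mul1r mulr1. Qed.

Definition lmop (a b : coend R) : aend LL :=
  AEnd (@tliftD _ _ _ _ _ _ LL (fun z w : L => lmk (a * (z : coend R)) (b * (w : coend R)))).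

Lemma lmopE a b z w : lcomm a -> rcomm b -> lmop a b (lmk z w) = lmk (a * z) (b * w).
Proof.
move=> ca cb; apply: (@tlift_addE _ _ L L _ _ LL
   (fun z w : L => lmk (a * (z : coend R)) (b * (w : coend R)))) => [x y u|x u v|s x t u].
- by rewrite -tmkDl -mulrDr.
- by rewrite -tmkDr -mulrDr.
- have -> : a * (s *: bract x t : L) = bract (a * (s *: x : L) : L) t.
    by rewrite /bract /= -coend_ractZ /coend_ract !mulrA ca.
  have -> : b * (t *: u : L) = t *: (b * (u : coend R) : L).
    by rewrite [LHS]mulrA cb -mulrA.
  exact: tmk_bal.
Qed.

Definition rmop (a b : coend R) (t : LL) : LL :=
  tlift (fun z w : L => lmk ((z : coend R) * a) ((w : coend R) * b)) t.

Lemma rmop_zmod a b : zmod_morphism (rmop a b).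
Proof. by move=> x y; exact: tliftD. Qed.

Lemma rmopE a b z w : rmop a b (lmk z w) = lmk (z * a) (w * b).
Proof.
apply: (@tlift_addE _ _ L L _ _ LL
   (fun z w : L => lmk ((z : coend R) * a) ((w : coend R) * b))) => [x y u|x u v|s x t u].
- by rewrite -tmkDl -mulrDl.
- by rewrite -tmkDr -mulrDl.
- have -> : (s *: bract x t : L) * a = bract ((s *: x : L) * a : L) t.
    by rewrite /bract /= -coend_ractZ /coend_ract !mulrA.
  have -> : (t *: u : L) * b = t *: ((u : coend R) * b : L) by rewrite [RHS]mulrA.
  exact: tmk_bal.
Qed.

Lemma lmop_eq (F G : aend LL) : (forall z w, F (lmk z w) = G (lmk z w)) -> F = G.
Proof. by move=> FG; apply: aendP; apply: tens_eq => //; exact: aend_morph. Qed.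

Hint Resolve lcommM rcommM lcomm_cio rcomm_cio lcommX rcommX lcommY rcommY lcomm1 rcomm1 : core.

Lemma lmop_rmop a b z w t : lcomm a -> rcomm b ->
  lmop a b (rmop z w t) = rmop z w (lmop a b t).
Proof.
move=> ca cb; have lB := aend_morph (lmop a b); have rB := @rmop_zmod z w.
apply: (tens_eq (zmod_morph_comp lB rB) (zmod_morph_comp rB lB)) => z' w'.
by rewrite rmopE !lmopE // rmopE !mulrA.
Qed.

(* L(A) acts on L(A) (x)_R L(A) through the generators, and D is the orbit map
   of 1 (x) 1.  It is multiplicative because this action commutes with the right
   multiplications, which, unlike left ones, are always defined on the tensor
   product over R. *)
Fact comult_exists : exists D : coend R -> LL, is_comult D.
Proof.
pose q r s := lmop (cio r 1) (cio 1 s).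
pose x := lmop cX 1 + lmop cY cX; pose y := lmop cY cY.
have xE z w : x (lmk z w) = lmk (cX * z) w + lmk (cY * z) (cX * w).
  by rewrite aendD !lmopE // mul1r.
have yE z w : y (lmk z w) = lmk (cY * z) (cY * w) by rewrite lmopE.
have qE r s z w : q r s (lmk z w) = lmk (cio r 1 * z) (cio 1 s * w) by rewrite lmopE.
have lB a (z w : LL) : (a : aend LL) (z + w) = a z + a w.
  by rewrite (zmod_morphD (aend_morph a)).
have [|||||||||F [[FB [F1 FM]] Fq Fx Fy]] := @coend_lift k R (aend LL) q x y.
- move=> s; apply: zmod_morphismP => r r'; apply: lmop_eq => z w.
  by rewrite aendD !qE cioDl mulrDl tmkDl.
- move=> r; apply: zmod_morphismP => s s'; apply: lmop_eq => z w.
  by rewrite aendD !qE cioDr mulrDl tmkDr.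
- move=> r c s; apply: lmop_eq => z w; rewrite !qE.
  have -> : cio (r * kstr R c) 1 * z = bract (cio r 1 * z : L) (kstr R c).
    rewrite /bract /= /coend_ract mulrA cioM !mul1r; congr (_ * _).
    by rewrite /cio rmk_bal mulr1.
  rewrite tmk_bal; congr (tmk _ _ _ _).
  rewrite [LHS]mulrA cioM !mulr1; congr (_ * _).
  by rewrite /cio -{1}[kstr R c]mul1r rmk_bal.
- by apply: lmop_eq => z w; rewrite qE cio1 !mul1r.
- move=> r s r' s'; apply: lmop_eq => z w; rewrite aendM !qE.
  by rewrite !mulrA !cioM !mulr1.
- move=> r s; apply: lmop_eq => z w; rewrite !aendM xE !qE xE lB !qE.
  by rewrite !mulrA !cX_cio !cY_cio.
- move=> r s; apply: lmop_eq => z w; rewrite !aendM yE !qE yE.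
  by rewrite !mulrA !cY_cio.
(* (x (x) 1 + y (x) x)^2 = x^2 (x) 1 + (xy + yx) (x) x + y^2 (x) x^2 = 0. *)
- apply: lmop_eq => z w; rewrite aendM xE lB !xE !mulrA !cXX !mul0r tmk0l tmk0r.
  by rewrite addr0 add0r -tmkDl -mulrDl cXY subrr mul0r tmk0l.
- apply: lmop_eq => z w; rewrite aendM yE xE.
  rewrite [RHS](_ : _ = - (y (x (lmk z w)))) // xE lB !yE !mulrA cXY.
  rewrite !mulNr opprD; congr (_ + _).
    by rewrite (zmod_morphN (tmkBl _ _ _)).
  by rewrite (zmod_morphN (tmkBr _ _ _)).
exists (fun z => F z (lmk 1 1)); split.
- by move=> a b; rewrite FB.
- move=> a f; rewrite cpi_normal !(zmod_morphD FB) !FM Fx Fy !Fq.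
  rewrite !aendD !aendM xE yE lB !qE big_bool /= !cpi_normal /=.
  rewrite !(zmod_morph0 (cio_zmodr _), zmod_morph0 (cio_zmodl _)) !mul0r !mulr1 !add0r !addr0.
  by rewrite !tmkDr !tmkDl [RHS]addrC !addrA.
- by move=> r s; rewrite Fq qE !mulr1.
- move=> a b xs ys Da Db; rewrite FM aendM.
  have comm c z w t : F c (rmop z w t) = rmop z w (F c t).
    have rD z' w' := zmod_morphD (rmop_zmod z' w').
    elim/coend_ind: c t => [c d IHc IHd|c d IHc IHd|r s||] t.
    - by rewrite (zmod_morphD FB) !aendD IHc IHd rD.
    - by rewrite FM !aendM IHd IHc.
    - by rewrite Fq lmop_rmop.
    - by rewrite Fx !aendD !lmop_rmop // rD.
    - by rewrite Fy lmop_rmop.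
  rewrite Db (zmod_morph_sum _ _ _ (aend_morph (F a))) exchange_big /=.
  apply: eq_bigr => p _; rewrite -[p.1]mul1r -[p.2]mul1r -rmopE comm Da.
  rewrite (zmod_morph_sum _ _ _ (@rmop_zmod _ _)); apply: eq_bigr => u _.
  by rewrite rmopE !mul1r.
Qed.

Lemma comultP : is_comult (@comult k R).
Proof. by rewrite /comult; have [D HD] := comult_exists; case: xgetP => [_ ->|/(_ D)]. Qed.

Lemma comultM (x y : coend R) (z w z' w' : L) :
    comult x = lmk z w -> comult y = lmk z' w' ->
  comult (x * y) = lmk ((z : coend R) * z') ((w : coend R) * w').
Proof.
move=> Dx Dy; have [_ _ _ /(_ x y [:: (z, w)] [:: (z', w')])] := comultP.
by rewrite !big_seq1 => ->.
Qed.

Lemma comult_wF n : comult (cw R false n) = lmk (cw R false n) (cw R false n).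
Proof.
have [_ Dpi Dio _] := comultP; rewrite /cw expr0 mul1r; elim: n => [|n IHn].
  by rewrite expr0 -(cio1 R) Dio.
rewrite exprS; apply: comultM IHn; rewrite Dpi big_bool /=.
have -> : cpi (ebase R false) (edual R true) = 0.
  by rewrite cpi_unit /= (zmod_morph0 (cio_zmodr _)).
by rewrite tmk0r addr0.
Qed.

Lemma comult_wT n : comult (cw R true n) =
  lmk (cw R true n) (cw R false n) + lmk (cw R false n.+1) (cw R true n).
Proof.
have [_ Dpi _ DM] := comultP; have := comult_wF n.
rewrite /cw !expr0 !mul1r expr1 => Dn.
have DX : comult cX = \sum_(p <- [:: (cX, 1); (cY, cX)]) lmk p.1 p.2.
  rewrite Dpi !big_cons big_nil addr0 big_bool /= addrC; congr (tmk _ _ _ _ + _).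
  by rewrite cpi_unit /= cio1.
rewrite (DM _ _ _ [:: (cY ^+ n, cY ^+ n)] DX) ?big_seq1 //.
by rewrite !big_cons !big_nil !addr0 /= mul1r exprS.
Qed.

End Comultiplication.

(** * The counit *)

Section Counit.
Variables (k : comPzRingType) (R : kalgebra k).

(* L(A) acts on R through r (x) s^o |-> r v s, x |-> 0, y |-> 1, and the counit
   is the orbit map of 1. *)
Fact counit_exists : exists e : coend R -> R, is_counit e.
Proof.
have qB (r s : R) : zmod_morphism (fun v => r * v * s).
  by move=> x y; rewrite mulrBr mulrBl.
pose q r s := AEnd (qB r s).
have [|||||||||F [[FB [F1 FM]] Fq Fx Fy]] := @coend_lift k R (aend R) q 0 1; rewrite ?mulr0
  ?mul0r ?oppr0 //; try by move=> r s; rewrite ?mulr0 ?mul0r ?mul1r ?mulr1.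
- by move=> s x y; apply: aendP => v /=; rewrite !mulrBl.
- by move=> r x y; apply: aendP => v /=; rewrite !mulrBr.
- by move=> r c s; apply: aendP => v /=; rewrite -!mulrA !kstr_central -!mulrA.
- by apply: aendP => v /=; rewrite mul1r mulr1.
- by move=> r s r' s'; apply: aendP => v /=; rewrite !mulrA.
exists (fun x => F x 1); split.
- by move=> x y; rewrite FB.
- move=> a f; rewrite cpi_normal !(zmod_morphD FB) !FM Fx Fy !Fq mulr0 addr0 mulr1 /=.
  by rewrite !mulr1 -dual_normal.
- by move=> r s; rewrite Fq /= mulr1.
- by move=> x y; rewrite !FM !aendM Fq /= !mulr1.
Qed.

Lemma counitP : is_counit (@counit k R).
Proof. by rewrite /counit; have [D HD] := counit_exists; case: xgetP => [_ ->|/(_ D)]. Qed.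

(** With r the counit of the second factor, this is the counit of [cX] (r (x) 1^o) = pi(r t (x) f),
    where f is the coordinate on 1; and f(r t) = 0. *)
Lemma counitX (x : coend R) : counit (cX R * x) = 0.
Proof.
have [eB epi eio eM] := counitP.
by rewrite eM cX_cio /cX cio_cpi epi /= ?mulr0 ?mul0r ?addr0 ?mul0r.
Qed.

Lemma counit_w i n : counit (cw R i n) = (~~ i)%:R.
Proof.
have [eB epi eio eM] := counitP; rewrite /cw; case: i => /=.
  by rewrite expr1 counitX.
rewrite expr0 mul1r; elim: n => [|n IHn]; first by rewrite expr0 -cio1 eio mul1r.
by rewrite exprS eM IHn cio1 mulr1 epi /=.
Qed.

Lemma counit_scale r (x : coend R) : counit (cio r 1 * x) = r * counit x.
Proof. by have [eB epi eio eM] := counitP; rewrite eM cioM mulr1 eio mulr1. Qed.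

End Counit.

(** * A basis of the quotient coring *)

Section BarBasis.
Variables (k : comPzRingType) (R : kalgebra k).
Local Notation L := (coend_bimod R).
Local Notation Lb := (cbar_bimod R).

Definition bw (i : bool) (n : nat) : Lb := bproj (cw R i n).

Lemma bproj_zmod : zmod_morphism (@bproj k R).
Proof. by apply: zmod_morphismP => x y; exact: bprojD. Qed.

(** A monomial is R^e-invariant, so 1 (x) s^o can be moved to its right, exchanged there for s (x)
    1^o modulo the left ideal, and moved back. In particular both R-actions agree on the monomials
    of the quotient. *)
Lemma bproj_cw r s i n : bproj (cio r s * cw R i n) = (r * s) *: bw i n :> Lb.
Proof.
have -> : cio r s = cio r 1 * cio 1 s :> coend R by rewrite cioM mulr1 mulr1.
rewrite -mulrA -scalerA -[cio r 1 * _]/(r *: _ : coend R) bprojZ; congr (_ *: _).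
by rewrite -cw_cio -bproj_ideal cw_cio -[cio s 1 * _]/(s *: _ : coend R) bprojZ.
Qed.

Lemma bw_ract i n s : bract (bw i n) s = s *: bw i n.
Proof. by rewrite /bract /= cbar_ractE /coend_ract bproj_cw mul1r. Qed.

Lemma cbar_span (z : Lb) : aspan (fun z => exists r i n, z = r *: bw i n) z.
Proof.
elim/cbar_ind: z => x; apply: (aspan_map (f := @bproj k R)) (coend_span x).
  exact: bproj_zmod.
move=> _ [r [s [i [n ->]]]]; apply: aspan_gen; exists (r * s), i, n.
exact: bproj_cw.
Qed.

Lemma btens_span (X : lmodType R) (z : btens Lb X) :
  aspan (fun z => exists i n (x : X), z = tmk _ _ (bw i n) x) z.
Proof.
apply: aspan_bind (tens_span z) => _ [l [x ->]].
apply: (aspan_map (f := fun l : Lb => tmk _ _ l x)) (cbar_span l).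
  exact: tmkBl.
move=> _ [r [i [n ->]]]; apply: aspan_gen; exists i, n, (r *: x).
by rewrite -bw_ract tmk_bal.
Qed.

Lemma btens_eq (X : lmodType R) (V : zmodType) (f g : btens Lb X -> V) :
    zmod_morphism f -> zmod_morphism g ->
    (forall i n x, f (tmk _ _ (bw i n) x) = g (tmk _ _ (bw i n) x)) ->
  forall z, f z = g z.
Proof.
move=> fB gB fg z.
by apply: (aspan_eq fB gB) (btens_span z) => _ [i [n [x ->]]].
Qed.

(** The hypothesis on monomials contains both R-linearity and the compatibility with the left ideal:
    by [coend_span] each of them is an equality of additive maps to be checked on monomials. *)
Lemma extend_bproj (V : lmodType R) (v : coend R -> V) :
    zmod_morphism v -> (forall r s i n, v (cio r s * cw R i n) = (r * s) *: v (cw R i n)) ->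
  linear (extend (@bproj k R) v) /\ forall x, extend (@bproj k R) v (bproj x) = v x.
Proof.
move=> vB vw; have vD := zmod_morphD vB.
have vZ r x : v (cio r 1 * x) = r *: v x.
  pose f x := v (cio r 1 * x); pose g x := r *: v x.
  have fB : zmod_morphism f by move=> y z; rewrite /f mulrBr vB.
  have gB : zmod_morphism g by move=> y z; rewrite /g vB scalerBr.
  apply: (aspan_eq fB gB) (coend_span x) => _ [a [s [i [n ->]]]].
  by rewrite /f /g mulrA cioM mulr1 !vw scalerA mulrA.
have E x : extend (@bproj k R) v (bproj x) = v x.
  apply: extend_pgen => _ _ [y z|r y|y r] /=; first exact: vD.
    exact: vZ.
  pose f x := v (x * cio r 1); pose g x := v (x * cio 1 r).
  have fB : zmod_morphism f by move=> y1 z; rewrite /f mulrBl vB.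
  have gB : zmod_morphism g by move=> y1 z; rewrite /g mulrBl vB.
  apply: (aspan_eq fB gB) (coend_span y) => _ [a [s [i [n ->]]]].
  by rewrite /f /g -!(mulrA (cio _ _)) !cw_cio !(mulrA (cio _ _) (cio _ _)) !cioM !mul1r !mulr1
    !vw mulrA.
split=> //; apply: linearI => [|a z]; first exact: extend_additive.
by elim/cbar_ind: z => z; rewrite -bprojZ !E [LHS]vZ.
Qed.

Definition bproj2 (l l' : L) : btens Lb Lb := tmk _ _ (bproj l : Lb) (bproj l' : Lb).

Lemma bproj2_linear : linear (tlift bproj2 : btens L L -> btens Lb Lb) /\
  forall l l', tlift bproj2 (tmk _ _ l l' : btens L L) = bproj2 l l'.
Proof.
apply: tlift_linear => [l x y|l r x y|x t y]; rewrite /bproj2.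
- by rewrite bproj_zmod tmkBr.
- by rewrite (linearI bproj_zmod (@bprojZ k R)) tmkDl tmkZ.
- by rewrite bprojZ -tmk_bal; congr tmk; rewrite /= cbar_ractE.
Qed.

Lemma bar_comult_linear : linear (@bar_comult k R) /\
  forall x, bar_comult (bproj x) = tlift bproj2 (comult x).
Proof.
have [hL hE] := bproj2_linear.
apply: extend_bproj => [|r s i n].
  by move=> x y; have [DB _ _ _] := @comultP k R; rewrite DB (linear_zmod hL).
have [_ _ Dio _] := @comultP k R.
have DE x : comult (cio r s * x) = lmop (cio r 1) (cio 1 s) (comult x).
  have [xs Dx] := tens_seq (comult x).
  have [_ _ _ /(_ _ x [:: (cio r 1, cio 1 s)] xs)] := @comultP k R.
  rewrite !big_seq1 => -> //.
  rewrite Dx (zmod_morph_sum _ _ _ (aend_morph _)); apply: eq_bigr => p _.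
  by rewrite lmopE //; [exact: lcomm_cio|exact: rcomm_cio].
(* The scalar s of the right factor becomes a left scalar in the quotient and crosses the tensor
   sign, since the right action on the monomial to its left is the left one. *)
have key j m j' m' : tlift bproj2 (lmop (cio r 1) (cio 1 s) (tmk _ _ (cw R j m : L)
  (cw R j' m' : L)))
    = (r * s) *: (tlift bproj2 : btens L L -> btens Lb Lb) (tmk _ _ (cw R j m : L)
      (cw R j' m' : L)).
  rewrite lmopE; [|exact: lcomm_cio|exact: rcomm_cio].
  rewrite !hE /bproj2 !bproj_cw mulr1 mul1r tmkZ -scalerA; congr (_ *: _).
  by rewrite -tmk_bal bw_ract tmkZ.
rewrite DE; case: i; last by rewrite comult_wF key.
rewrite comult_wT (zmod_morphD (aend_morph _)) !(linear_atD hL).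
by rewrite scalerDr -!key.
Qed.

Lemma bar_comult_F n : bar_comult (bw false n) = tmk _ _ (bw false n) (bw false n).
Proof.
have [_ ->] := bar_comult_linear; rewrite comult_wF.
by have [_ ->] := bproj2_linear.
Qed.

Lemma bar_comult_T n : bar_comult (bw true n) =
  tmk _ _ (bw true n) (bw false n) + tmk _ _ (bw false n.+1) (bw true n).
Proof.
have [_ ->] := bar_comult_linear; rewrite comult_wT.
by have [hL hE] := bproj2_linear; rewrite (linear_atD hL) !hE.
Qed.

Lemma bar_counit_linear : linear (@bar_counit k R : Lb -> R^o) /\
  forall x, bar_counit (bproj x) = counit x :> R.
Proof.
have [eB _ eio eM] := counitP R.
apply: (@extend_bproj R^o (@counit k R)) => // r s i n.
rewrite counit_w; have -> : cio r s = cio r 1 * cio 1 s :> coend R.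
  by rewrite cioM mulr1 mulr1.
rewrite -mulrA counit_scale -cw_cio eM eio mul1r cw_cio counit_scale counit_w.
exact: mulrA.
Qed.

Lemma bar_counit_w i n : bar_counit (bw i n) = (~~ i)%:R.
Proof. by have [_ ->] := bar_counit_linear; rewrite counit_w. Qed.

(* The coordinates are read off from the action of L(A) on the free module with
   basis the expected elements x^i y^n, applied to the basis vector 1. *)
Fact bcoord_exists : exists phi : bool * nat -> Lb -> R,
  [/\ forall p, linear (phi p : Lb -> R^o), forall p l s, phi p (bract l s) = phi p l * s &
      forall p i n, phi p (bw i n) = (p == (i, n))%:R].
Proof.
pose V := dsum (fun _ : bool * nat => R^o : lmodType R).
pose e p (r : R) : V := din (V := fun _ : bool * nat => R^o : lmodType R) (i := p) r.
have eB p : zmod_morphism (e p) by exact: (@linear_zmod R R^o V _ (@din_linear R _ (fun=> R^o) p)).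
have Veq (F G : aend V) : (forall p r, F (e p r) = G (e p r)) -> F = G.
  by move=> FG; apply: aendP; apply: dsum_eq => //; exact: aend_morph.
have lift (h : bool * nat -> R -> V) : (forall p, zmod_morphism (h p)) ->
    exists F : aend V, forall p r, F (e p r) = h p r.
  move=> hB; have [f [fB fE]] := @dsum_lift_add R _ (fun _ : bool * nat => R^o) V h hB.
  by exists (AEnd fB).
(* R^e acts on coefficients by v |-> r v s, so r (x) 1^o and 1 (x) r^o agree on the basis vector of
   1, and its orbit map kills the left ideal. *)
have q0 (r s : R) : exists F : aend V, forall p v, F (e p v) = e p (r * v * s).
  by apply: lift => p x y; rewrite mulrBr mulrBl eB.
pose q r s := projT1 (cid (q0 r s)).
have qE r s p v : q r s (e p v) = e p (r * v * s) by rewrite /q; case: cid.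
(* Left multiplication by x and y in the expected basis, with the sign of yx = -xy. *)
have [|x xE] := lift (fun p r => if p.1 then 0 else e (true, p.2) r).
  by move=> [[] n] /=; [move=> y z; rewrite subrr|exact: eB].
have [|y yE] := lift (fun p r => e (p.1, p.2.+1) (if p.1 then - r else r)).
  by move=> [[] n] y z /=; rewrite -eB // opprD.
have [|||||||||F [[FB [F1 FM]] Fq Fx Fy]] := @coend_lift k R (aend V) q x y.
- move=> s; apply: zmod_morphismP => r r'; apply: Veq => p v.
  by rewrite aendD !qE !mulrDl (zmod_morphD (eB p)).
- move=> r; apply: zmod_morphismP => s s'; apply: Veq => p v.
  by rewrite aendD !qE !mulrDr (zmod_morphD (eB p)).
- move=> r c s; apply: Veq => p v; rewrite !qE; congr e.
  by rewrite -!mulrA; congr (_ * _); rewrite !mulrA kstr_central.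
- by apply: Veq => p v; rewrite qE mul1r mulr1.
- by move=> r s r' s'; apply: Veq => p v; rewrite aendM !qE !mulrA.
- move=> r s; apply: Veq => [[[] n] v]; rewrite !aendM qE !xE /= ?qE //.
  by rewrite (zmod_morph0 (aend_morph _)).
- by move=> r s; apply: Veq => [[[] n] v]; rewrite !aendM qE !yE /= ?qE // mulrN mulNr.
- apply: Veq => [[[] n] v]; rewrite !aendM !xE /= ?xE //.
  by rewrite (zmod_morph0 (aend_morph _)).
- apply: Veq => [[[] n] v]; rewrite -[RHS]/(- ((y * x) _)) !aendM yE xE /= xE /=.
    by rewrite (zmod_morph0 (aend_morph _)) oppr0.
  by rewrite yE /= (zmod_morphN (eB _)) opprK.
pose u := e (false, 0%N) 1.
pose v p (l : coend R) : R^o := F l u p.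
have FyE n r : F (cY R ^+ n) (e (false, 0%N) r) = e (false, n) r.
  elim: n => [|n IHn]; first by rewrite expr0 F1.
  by rewrite exprS FM aendM IHn Fy yE.
have FwE i n : F (cw R i n) u = e (i, n) 1.
  rewrite /cw FM aendM FyE; case: i; last by rewrite expr0 F1.
  by rewrite expr1 Fx xE.
have eZ p a : e p a = a *: e p 1.
  rewrite /e -(linear_scale (@din_linear _ _ _ _)); congr din.
  exact: esym (mulr1 a).
have vE p r s i n : v p (cio r s * cw R i n) = (r * s) *: v p (cw R i n).
  by rewrite /v FM aendM FwE Fq qE mulr1 eZ.
have vB p : zmod_morphism (v p) by move=> a b; rewrite /v FB.
pose phi p := extend (@bproj k R) (v p : coend R -> R^o).
have phiP p := extend_bproj (vB p) (vE p).
exists phi; split=> [p|p l s|p i n]; first exact: (phiP p).1.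
- have pB := linear_zmod (phiP p).1.
  pose f (l : Lb) : R^o := phi p (bract l s); pose g (l : Lb) : R^o := (phi p l : R) * s.
  have fB : zmod_morphism f.
    exact: (zmod_morph_comp pB (@bract_zmod _ _ Lb s)).
  have gB : zmod_morphism g by move=> a b; rewrite /g /phi pB mulrBl.
  apply: (aspan_eq fB gB) (cbar_span l) => _ [r [i [n ->]]].
  rewrite /f /g bractZ bw_ract /phi !(linear_scale (phiP p).1) !(phiP p).2 /v FwE.
  rewrite /e; have [<-|np] := eqVneq (i, n) p.
    by rewrite din_same /GRing.scale /= !mulr1.
  by rewrite (din_ne _ np) !scaler0 mul0r.
rewrite /phi (phiP p).2 /v FwE /e; have [->|np] := eqVneq p (i, n); first by rewrite din_same.
by rewrite din_ne // eq_sym.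
Qed.

End BarBasis.

(** * Coordinates on tensor products with the quotient coring *)

Section ComoduleCalculus.
Variables (k : comPzRingType) (R : kalgebra k).
Local Notation Lb := (cbar_bimod R).
Local Notation bw := (bw R).
Implicit Types X Y : comodule R.

Local Notation "l \oy x" := (tmk (@bract _ _ Lb) (@GRing.scale _ _) (l : Lb) x)
  (at level 40, left associativity).

Definition bphi : bool * nat -> Lb -> R := projT1 (cid (bcoord_exists R)).

Lemma bphiP : [/\ forall p, linear (bphi p : Lb -> R^o),
  forall p l s, bphi p (bract l s) = bphi p l * s &
  forall p i n, bphi p (bw i n) = (p == (i, n))%:R].
Proof. by rewrite /bphi; case: cid. Qed.

Section Coordinates.
Variable X : lmodType R.

Definition bcoord (p : bool * nat) : btens Lb X -> X := tlift (fun l x => bphi p l *: x).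

Lemma bcoord_spec p : linear (bcoord p) /\ forall l x, bcoord p (l \oy x) = bphi p l *: x.
Proof.
have [pL pr _] := bphiP.
apply: tlift_linear => [l x y|x r l l'|l t x].
- exact: scalerBr.
- by rewrite pL scalerDl scalerA.
- by rewrite pr scalerA.
Qed.

Lemma bcoord_linear p : linear (bcoord p). Proof. exact: (bcoord_spec p).1. Qed.
Lemma bcoord_zmod p : zmod_morphism (bcoord p). Proof. exact: linear_zmod (bcoord_linear p). Qed.

Lemma bcoordE p i n x : bcoord p (bw i n \oy x) = if p == (i, n) then x else 0.
Proof.
have [_ _ pw] := bphiP; rewrite (bcoord_spec p).2 pw.
by case: eqP; rewrite ?scale1r ?scale0r.
Qed.

(** The two R-actions agree on monomials, so the direct sum of copies of X indexed by monomials maps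
    R-linearly to the tensor product. This map is onto, and the coordinates [bcoord] invert it. *)
Lemma btens_decomp (z : btens Lb X) :
  exists s : seq (bool * nat), uniq s /\ z = \sum_(p <- s) bw p.1 p.2 \oy bcoord p z.
Proof.
pose V := dsum (fun _ : bool * nat => X).
have [|f [fL fE]] := @dsum_lift R _ (fun _ : bool * nat => X) (btens Lb X : lmodType R)
    (fun p x => bw p.1 p.2 \oy x).
  by move=> p a x y; rewrite tmkDr -tmk_bal bw_ract tmkZ.
have bf p (d : V) : bcoord p (f d) = d p.
  apply: (dsum_eq (f := fun d : V => bcoord p (f d)) (g := fun d : V => d p)) => //.
    by apply: zmod_morph_comp; [exact: bcoord_zmod|exact: linear_zmod].
  move=> [i n] x; rewrite fE bcoordE /=.
  have [<-|ne] := eqVneq p (i, n); first by rewrite dfwith_in.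
  by rewrite dfwith_out // eq_sym.
have [d ->] : exists d, z = f d.
  elim: (btens_span z) => [|_ _ _ [d ->] _ [d' ->]|_ [i [n [x ->]]]].
  - by exists 0; rewrite (linear_at0 fL).
  - by exists (d + d'); rewrite (linear_atD fL).
  - by exists (din (V := fun _ => X) (i := (i, n)) x); rewrite fE.
have [s us ds] := dsum_supp d; exists s; split=> //.
rewrite {1}(dsum_decomp us ds) (zmod_morph_sum _ _ _ (linear_zmod fL)).
by apply: eq_bigr => p _; rewrite fE bf.
Qed.

End Coordinates.

Lemma tens_map_zmod (X Y : lmodType R) (f : X -> Y) : zmod_morphism (@tens_map k R X Y f).
Proof. exact: tliftD. Qed.

(** x y^(n-1), indexed by the degree n of the elements whose coaction it enters. In degree 0 there
    is no differential, whence the value 0. *)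
Definition bz (n : nat) : Lb := if n is m.+1 then bw true m else 0.

Lemma bar_comult_z n :
  bar_comult (bz n) = bz n \oy bw false n.-1 + bw false n \oy bz n.
Proof.
case: n => [|n]; last exact: bar_comult_T.
by rewrite tmk0l tmk0r addr0 (linear_at0 ((bar_comult_linear R).1)).
Qed.

Lemma bw_tmkZ (X : lmodType R) i n a (x : X) : bw i n \oy (a *: x) = a *: (bw i n \oy x).
Proof. by rewrite -tmk_bal bw_ract tmkZ. Qed.

Lemma bz_tmkZ (X : lmodType R) n a (x : X) : bz n \oy (a *: x) = a *: (bz n \oy x).
Proof. by case: n => [|n]; [rewrite !tmk0l scaler0|exact: bw_tmkZ]. Qed.

Section ComultTens.
Variable X : lmodType R.
Local Notation LX := (btens Lb X).
Local Notation LLX := (btens Lb LX).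

Definition assoc2 (x : X) : btens Lb Lb -> LLX :=
  tlift (fun l1 l2 : Lb => l1 \oy (l2 \oy x : LX)).

Lemma assoc2_spec x : linear (assoc2 x) /\
  forall l1 l2 : Lb, assoc2 x (l1 \oy l2) = l1 \oy (l2 \oy x : LX).
Proof.
apply: tlift_linear => [l y z|l r y z|l t y].
- by rewrite (tmkBl _ _ x) tmkBr.
- by rewrite tmkDl tmkZ.
- by rewrite tmkZ tmk_bal.
Qed.

Lemma assoc2_zmod x : zmod_morphism (assoc2 x).
Proof. exact: linear_zmod (assoc2_spec x).1. Qed.

Lemma assoc2_linear_r (z : btens Lb Lb) : zmod_morphism (assoc2^~ z).
Proof.
move=> x y; pose g z := assoc2 x z - assoc2 y z.
have gB : zmod_morphism g.
  by move=> u v; rewrite /g !assoc2_zmod !opprD !opprK addrACA.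
apply: (tens_eq (assoc2_zmod (x - y)) gB) z => l1 l2.
by rewrite /g !(assoc2_spec _).2 tmkBr tmkBr.
Qed.

Lemma comult_tens_spec : linear (@comult_tens k R X) /\
  forall l x, comult_tens (l \oy x) = assoc2 x (bar_comult l).
Proof.
have cL := (bar_comult_linear R).1; have cB := linear_zmod cL.
apply: (@tlift_linear _ _ _ _ _ _ (LLX : lmodType R) (fun l x => assoc2 x (bar_comult l)))
  => [l x y|x r l l'|l t x].
- exact: assoc2_linear_r.
- by rewrite cL (assoc2_spec x).1.
(* Balancedness is reduced to monomials, on which the right action is the left one. *)
pose f (l : Lb) := assoc2 x (bar_comult (bract l t : Lb)).
pose g (l : Lb) := assoc2 (t *: x) (bar_comult l).
have fB : zmod_morphism f.
  exact: (zmod_morph_comp (assoc2_zmod x) (zmod_morph_comp cB (@bract_zmod _ _ Lb t))).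
have gB : zmod_morphism g by exact: (zmod_morph_comp (assoc2_zmod _) cB).
apply: (aspan_eq fB gB) (cbar_span l) => _ [r [i [n ->]]].
rewrite /f /g bractZ bw_ract !(linear_scale cL) !(linear_scale (assoc2_spec _).1).
congr (_ *: _); case: i.
  rewrite bar_comult_T !(zmod_morphD (assoc2_zmod _)) !(assoc2_spec _).2.
  by rewrite !bw_tmkZ scalerDr.
by rewrite bar_comult_F !(assoc2_spec _).2 !bw_tmkZ.
Qed.

Lemma comult_tens_F n x :
  comult_tens (bw false n \oy x) = bw false n \oy (bw false n \oy x : LX) :> LLX.
Proof. by rewrite comult_tens_spec.2 bar_comult_F (assoc2_spec _).2. Qed.

Lemma comult_tens_z n x : comult_tens (bz n \oy x) =
  bz n \oy (bw false n.-1 \oy x : LX) + bw false n \oy (bz n \oy x : LX) :> LLX.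
Proof.
by rewrite comult_tens_spec.2 bar_comult_z (zmod_morphD (assoc2_zmod x)) !(assoc2_spec _).2.
Qed.

End ComultTens.

Lemma bar_act_spec (X : lmodType R) :
  linear (tlift (fun (l : Lb) (y : X) => bar_counit l *: y) : btens Lb X -> X) /\
  forall l y, tlift (fun (l : Lb) (y : X) => bar_counit l *: y) (l \oy y : btens Lb X)
    = bar_counit l *: y.
Proof.
have [eL eE] := bar_counit_linear R.
have [cB _ cio_ cM] := counitP R.
apply: tlift_linear => [l x y|x r l l'|l t x].
- exact: scalerBr.
- by rewrite eL scalerDl scalerA.
rewrite scalerA; congr (_ *: _).
pose f (l : Lb) := bar_counit (bract l t : Lb) : R^o.
pose g (l : Lb) := bar_counit l * t : R^o.
have fB : zmod_morphism f.
  exact: (zmod_morph_comp (linear_zmod eL) (@bract_zmod _ _ Lb t)).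
have gB : zmod_morphism g.
  by move=> a b; rewrite /g [bar_counit _](linear_zmod eL) mulrBl.
apply: (aspan_eq fB gB) (cbar_span l) => _ [r [i [n ->]]].
rewrite /f /g bractZ bw_ract !(linear_scale eL) !bar_counit_w /GRing.scale /=.
by case: i; rewrite /= ?mulr0 ?mul0r ?mulr1.
Qed.

End ComoduleCalculus.

(** * Comodules as graded modules with a differential *)

Section Homogeneous.
Variables (k : comPzRingType) (R : kalgebra k).
Local Notation Lb := (cbar_bimod R).
Local Notation bw := (bw R).
Local Notation bz := (bz R).
Implicit Types X Y : comodule R.

Local Notation "l \oy x" := (tmk (@bract _ _ Lb) (@GRing.scale _ _) (l : Lb) x)
  (at level 40, left associativity).

(* x is homogeneous of degree n for the grading by the group-likes y^n of the
   quotient coring, and dx is its image under the differential. *)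
Definition homog X (n : nat) (x dx : X) : Prop :=
  [/\ coact x = bw false n \oy x + bz n \oy dx, coact dx = bw false n.-1 \oy dx &
      n = 0%N -> dx = 0].

Definition is_homog X (x : X) : Prop := exists n dx, homog n x dx.

Lemma homogZ X n (a : R) (x dx : X) :
  linear (@coact _ _ X) -> homog n x dx -> homog n (a *: x) (a *: dx).
Proof.
move=> cL [cx cdx d0]; split=> [||/d0 ->]; last by rewrite scaler0.
  by rewrite (linear_scale cL) cx bw_tmkZ bz_tmkZ scalerDr.
by rewrite (linear_scale cL) cdx bw_tmkZ.
Qed.

Lemma homog0 X n : linear (@coact _ _ X) -> homog n (0 : X) 0.
Proof.
by move=> cL; split; rewrite // (linear_at0 cL) !tmk0r ?addr0.
Qed.

(** For v homogeneous of degree n, both sides of coassociativity are the sum of y^n (x) y^n (x) v,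
    [bz n] (x) y^(n-1) (x) dv and y^n (x) [bz n] (x) dv; the counit keeps v and kills the term in
    [bz n]. *)
Lemma comodule_gen X :
  linear (@coact _ _ X) -> (forall x : X, aspan (@is_homog X) x) -> is_comodule X.
Proof.
move=> cL Xs; have cB := linear_zmod cL.
have [mL mE] := comult_tens_spec X; have mB := linear_zmod mL.
split=> // x.
  apply: (aspan_eq (zmod_morph_comp mB cB) (zmod_morph_comp (tens_map_zmod _) cB)) (Xs x).
  move=> y [n [dy [cy cdy _]]]; rewrite cy (zmod_morphD mB) (zmod_morphD (tens_map_zmod _)).
  rewrite !tens_mapE // comult_tens_F comult_tens_z cy cdy tmkDr -!addrA.
  by congr (_ + _); rewrite addrC.
have [eL eE] := bar_act_spec X; have eB := linear_zmod eL.
apply: (aspan_eq (f := fun x => tlift _ (coact x)) (zmod_morph_comp eB cB)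
  (zmod_morph_comp (f := id) (fun _ _ => erefl) (fun _ _ => erefl))) (Xs x).
move=> y [n [dy [cy _ _]]]; rewrite cy (zmod_morphD eB) !eE bar_counit_w scale1r.
suff -> : bar_counit (bz n) *: dy = 0 by rewrite addr0.
case: n {cy} => [|n]; last by rewrite bar_counit_w scale0r.
by rewrite [bar_counit _](linear_at0 ((bar_counit_linear R).1)) scale0r.
Qed.

Definition hproj X (n : nat) (x : X) : X := bcoord (false, n) (coact x).
Definition hdiff X (n : nat) (x : X) : X :=
  if n is m.+1 then bcoord (true, m) (coact x) else 0.

Lemma bcoord_bz (X : lmodType R) p n (x : X) :
  bcoord p (bz n \oy x) = if n is m.+1 then (if p == (true, m) then x else 0) else 0.
Proof.
case: n => [|n]; last exact: bcoordE.
by rewrite tmk0l (zmod_morph0 (bcoord_zmod p)).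
Qed.

Lemma homog_proj X m n (x dx : X) : homog n x dx -> hproj m x = if m == n then x else 0.
Proof.
move=> [cx _ _]; rewrite /hproj cx (zmod_morphD (bcoord_zmod _)) bcoordE bcoord_bz.
by case: n {cx} => [|n]; rewrite /= addr0.
Qed.

Lemma homog_diff X m n (x dx : X) : homog n x dx -> hdiff m x = if m == n then dx else 0.
Proof.
move=> [cx _ dx0]; case: m => [|m] /=; first by case: eqP => // /esym/dx0.
rewrite cx (zmod_morphD (bcoord_zmod _)) bcoordE bcoord_bz /= add0r.
by case: n {cx dx0} => [|n] //=; rewrite eqSS; case: (eqVneq m n) => [->|ne];
  rewrite ?eqxx // xpair_eqE (negbTE ne).
Qed.

Lemma homog_uniq X n (x dx dx' : X) : homog n x dx -> homog n x dx' -> dx = dx'.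
Proof. by move=> /(homog_diff n) + /(homog_diff n); rewrite eqxx => <- <-. Qed.

Section ComoduleComponents.
Variable X : comodule R.
Hypothesis HX : is_comodule X.

Lemma coact_linear : linear (@coact _ _ X). Proof. by case: HX. Qed.
Lemma coact_zmod : zmod_morphism (@coact _ _ X). Proof. exact: linear_zmod coact_linear. Qed.

Lemma hproj_linear n : linear (@hproj X n).
Proof. exact: (linear_comp (bcoord_linear _) coact_linear). Qed.

Lemma hdiff_linear n : linear (@hdiff X n).
Proof.
case: n => [|n]; first by move=> a x y; rewrite scaler0 addr0.
exact: (linear_comp (bcoord_linear _) coact_linear).
Qed.

Lemma bcoord_tens_map p (z : btens Lb X) :
  bcoord p (tens_map (@coact _ _ X) z) = coact (bcoord p z).
Proof.
apply: (btens_eq (zmod_morph_comp (bcoord_zmod p) (tens_map_zmod _))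
  (zmod_morph_comp coact_zmod (bcoord_zmod p))) z => i n x.
rewrite tens_mapE; last exact: coact_linear.
by rewrite !bcoordE; case: eqP => // _; rewrite (zmod_morph0 coact_zmod).
Qed.

(** Among the comultiplications of monomials, y^n is a left tensor factor in those of y^n and of x
    y^(n-1) only. *)
Lemma bcoord_comult_F n (z : btens Lb X) : bcoord (false, n) (comult_tens z) =
  bw false n \oy bcoord (false, n) z
    + bz n \oy (if n is m.+1 then bcoord (true, m) z else 0).
Proof.
have mB := linear_zmod (comult_tens_spec X).1.
pose g z := bw false n \oy bcoord (false, n) z
    + bz n \oy (if n is m.+1 then bcoord (true, m) z else 0) : btens Lb X.
have gB : zmod_morphism g.
  apply: zmod_morph_add; first exact: (zmod_morph_comp (tmkBr _ _ _) (bcoord_zmod _)).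
  apply: (zmod_morph_comp (tmkBr _ _ _)); case: n {g} => [|n]; last exact: bcoord_zmod.
  by move=> x y; rewrite subrr.
apply: (btens_eq (zmod_morph_comp (bcoord_zmod _) mB) gB) z => i m x.
rewrite /g; clear gB g; case: i.
  rewrite -[bw true m]/(bz m.+1) comult_tens_z (zmod_morphD (bcoord_zmod _)).
  case: n => [|n]; rewrite !bcoord_bz bcoordE /=; first by rewrite !tmk0r.
  by rewrite tmk0r !add0r !xpair_eqE /= eqSS; case: eqP => [->|_]; rewrite ?tmk0r.
rewrite comult_tens_F !bcoordE; case: n => [|n].
  by rewrite tmk0r addr0; case: ifP; rewrite ?tmk0r // => /eqP[->].
rewrite bcoordE /= tmk0r addr0; case: ifP; rewrite ?tmk0r // => /eqP[->] //.
Qed.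

(** x y^n is a left tensor factor in the comultiplication of x y^n only, where it is paired with
    y^n. *)
Lemma bcoord_comult_T n (z : btens Lb X) : bcoord (true, n) (comult_tens z) =
  bw false n \oy bcoord (true, n) z.
Proof.
have mB := linear_zmod (comult_tens_spec X).1.
apply: (btens_eq (zmod_morph_comp (bcoord_zmod _) mB)
  (zmod_morph_comp (tmkBr _ _ _) (bcoord_zmod _))) z => -[] m x.
  rewrite -[bw true m]/(bz m.+1) comult_tens_z (zmod_morphD (bcoord_zmod _)).
  rewrite !bcoord_bz bcoordE /= addr0.
  by case: eqP => [[->]|_]; rewrite ?tmk0r.
by rewrite comult_tens_F !bcoordE /= tmk0r.
Qed.

(** Take the coordinate of coassociativity on a monomial in the first factor: one side is the
    coaction of a component, the other is given by [bcoord_comult_F] or [bcoord_comult_T]. *)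
Lemma homog_component n (x : X) : homog n (hproj n x) (hdiff n x).
Proof.
have [_ coass _] := HX.
split=> [||->] //.
  by rewrite -bcoord_tens_map -coass bcoord_comult_F; case: n.
case: n => [|n]; first by rewrite (zmod_morph0 coact_zmod) tmk0r.
by rewrite -bcoord_tens_map -coass bcoord_comult_T.
Qed.

(** The counit sends y^n to 1 and x y^n to 0, so the counit axiom writes x as the sum of its
    homogeneous components. *)
Lemma comodule_span (x : X) : aspan (@is_homog X) x.
Proof.
have [_ _ cu] := HX; rewrite -[x]cu.
have [eL eE] := bar_act_spec X; have eB := linear_zmod eL.
have [s [_ ->]] := btens_decomp (coact x).
rewrite (zmod_morph_sum _ _ _ eB); apply: aspan_sum => -[i n].
rewrite eE bar_counit_w; case: i => /=; first by rewrite scale0r; exact: aspan0.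
rewrite scale1r; apply: aspan_gen; exists n, (hdiff n x).
exact: homog_component.
Qed.

Lemma homogP n (x : X) : hproj n x = x <-> homog n x (hdiff n x).
Proof.
split=> [xE|/(homog_proj n)]; last by rewrite eqxx.
by have := homog_component n x; rewrite {1}xE.
Qed.

End ComoduleComponents.

Lemma comodule_map_homog X Y (f : X -> Y) n x dx :
  is_comodule_map f -> homog n x dx -> homog n (f x) (f dx).
Proof.
move=> [fL fc] [cx cdx d0]; split=> [||/d0 ->]; last exact: linear_at0 fL.
  rewrite fc cx (zmod_morphD (tens_map_zmod f)) tens_mapE //.
  by case: n {cx cdx d0} => [|n]; rewrite ?tmk0l ?(zmod_morph0 (tens_map_zmod f)) // tens_mapE.
by rewrite fc cdx tens_mapE.
Qed.

Lemma comodule_map_gen X Y (f : X -> Y) :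
    linear (@coact _ _ X) -> linear (@coact _ _ Y) -> linear f ->
    (forall x, aspan (fun x => exists n dx, homog n x dx /\ homog n (f x) (f dx)) x) ->
  is_comodule_map f.
Proof.
move=> XL YL fL Xs; split=> // x.
apply: (aspan_eq (zmod_morph_comp (linear_zmod YL) (linear_zmod fL))
  (zmod_morph_comp (tens_map_zmod f) (linear_zmod XL))) (Xs x).
move=> y [n [dy [[cy _ _] [cfy _ _]]]]; rewrite cfy cy (zmod_morphD (tens_map_zmod f)).
rewrite tens_mapE //; congr (_ + _).
by case: n {cy cfy} => [|n]; rewrite ?tmk0l ?(zmod_morph0 (tens_map_zmod f)) // tens_mapE.
Qed.

Lemma comodule_mapP X Y (f : X -> Y) :
    is_comodule X -> is_comodule Y -> linear f ->
    (forall n x dx, homog n x dx -> homog n (f x) (f dx)) ->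
  is_comodule_map f.
Proof.
move=> HX HY fL fh; apply: comodule_map_gen => //; try exact: coact_linear.
move=> x; apply: aspan_bind (comodule_span HX x) => y [n [dy hy]].
by apply: aspan_gen; exists n, dy; split=> //; exact: fh.
Qed.

End Homogeneous.

(** * The bimodule K and the comodules Q_n *)

Section KernelBimodule.
Variable R : pzRingType.
Local Notation A := (triv R).
Local Notation K := (K R).
Local Notation AtA := (AtA R).

Definition tgen : A := ebase R true.

Lemma tgenE (a : A) : a = triv_in a.1 + triv_in a.2 * tgen.
Proof. by case: a => x y; congr pair; rewrite /= ?mulr0 ?mulr1 ?mul0r ?addr0 ?add0r. Qed.

(* The automorphism a + bt |-> a - bt; it is the twist of the right action on
   K = A dt, since (dt) t = - t (dt). *)
Definition sgn (a : A) : A := (a.1, - a.2).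

Lemma sgn_zmod : zmod_morphism sgn.
Proof. by move=> [a b] [c d]; congr pair; rewrite /= opprB opprK addrC. Qed.
Lemma sgnM a b : sgn (a * b) = sgn a * sgn b.
Proof. by case: a b => [a b] [c d]; congr pair; rewrite /= mulrN mulNr opprD. Qed.
Lemma sgn_in r : sgn (triv_in r) = triv_in r.
Proof. by congr pair; rewrite /= oppr0. Qed.

(** The coordinate on dt = 1 (x) t - t (x) 1 in the left A-basis 1 (x) 1, dt of A (x)_R A. The
    coordinate on 1 (x) 1 is the product, so the kernel K of the product is free on dt. *)
Definition kap0 (z : AtA) : A^o :=
  tlift (fun (a : restrr (ring_bimod A)) (b : restrl (ring_bimod A)) =>
    (a : A) * triv_in (b : A).2 : A^o) z.

Lemma kap0_spec : linear kap0 /\ forall a b, kap0 (ata a b) = a * triv_in b.2.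
Proof.
apply: (@tlift_linear A R (restrr (ring_bimod A)) (restrl (ring_bimod A)) _ _ A^o
  (fun (a : restrr (ring_bimod A)) (b : restrl (ring_bimod A)) =>
    (a : A) * triv_in (b : A).2 : A^o)) => [a x y|b a x y|a t b].
- by rewrite -mulrBr; congr (_ * _); congr pair; rewrite /= subr0.
- by rewrite mulrDl -[X in X + _]mulrA.
- rewrite -[LHS]mulrA; congr (_ * _).
  by congr pair; rewrite /= ?mulr0 ?mul0r ?addr0.
Qed.

Lemma ata_zmodl b : zmod_morphism ((@ata R)^~ b).
Proof. by apply: zmod_morphismP => x y; exact: tmkDl. Qed.
Lemma ata_zmodr a : zmod_morphism (@ata R a).
Proof. by apply: zmod_morphismP => x y; exact: tmkDr. Qed.
Lemma ata_bal (a : A) r b : ata (a * triv_in r) b = ata a (triv_in r * b).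
Proof. exact: tmk_bal. Qed.
Lemma ata_scale (c a b : A) : c *: ata a b = ata (c * a) b.
Proof. by rewrite /ata -tmkZ. Qed.

Lemma ata_eq (V : zmodType) (f g : AtA -> V) : zmod_morphism f -> zmod_morphism g ->
  (forall a b, f (ata a b) = g (ata a b)) -> forall z, f z = g z.
Proof. exact: tens_eq. Qed.

Lemma AtA_decomp (z : AtA) :
  z = (amul z : A) *: ata 1 1 + (kap0 z : A) *: (ata 1 tgen - ata tgen 1).
Proof.
have [kL kE] := kap0_spec.
pose g (z : AtA) : AtA := (amul z : A) *: ata 1 1 + (kap0 z : A) *: (ata 1 tgen - ata tgen 1).
have gB : zmod_morphism g.
  apply: zmod_morph_add => x y; rewrite -scalerBl.
    by rewrite (zmod_morphismP (@amulD R)).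
  by rewrite (linear_zmod kL).
apply: (ata_eq (f := id) _ gB) => // a b.
rewrite /g amulE kE scalerBr !ata_scale !mulr1 -{1}[b]/(b : A).
rewrite {1 2}[b]tgenE addrCA -(ata_zmodl 1) addrC mulrDr mulrA addrK.
by rewrite !ata_bal mulr1 -(zmod_morphD (ata_zmodr a)).
Qed.

Definition kap1 (z : K) : A := kap0 (kerA_val z).

Lemma kap1_linear : linear (kap1 : K -> A^o).
Proof. by have [kL _] := kap0_spec; move=> a x y; exact: kL. Qed.

Lemma kap1_bd a : kap1 (bd a) = triv_in a.2.
Proof.
have [kL kE] := kap0_spec.
have k1 : kap0 (ata a 1) = 0 by rewrite kE; exact: mulr0.
by rewrite /kap1 /= (linear_zmod kL) k1 kE mul1r subr0.
Qed.

Lemma K_decomp (z : K) : z = kap1 z *: bd tgen.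
Proof.
apply: val_inj; rewrite linearZ /= {1}[kerA_val z]AtA_decomp.
by rewrite (eqP (kerA_valP z)) scale0r add0r.
Qed.

Lemma kap1_ract (z : K) (c : A) : kap1 (bract z c) = kap1 z * sgn c.
Proof.
have [kL kE] := kap0_spec.
(* On A (x)_R A the twisted linearity holds up to a multiple of the product, which vanishes on K. *)
have key (y : AtA) : kap0 (bract y c) = (kap0 y : A) * sgn c + (amul y : A) * triv_in c.2.
  pose g (y : AtA) : A := (kap0 y : A) * sgn c + (amul y : A) * triv_in c.2.
  have gB : zmod_morphism g.
    apply: zmod_morph_add => x x'; rewrite -mulrBl.
      by rewrite (linear_zmod kL).
    by rewrite (zmod_morphismP (@amulD R)).
  apply: (ata_eq (zmod_morph_comp (linear_zmod kL) (@bract_zmod _ _ AtA c)) gB) y => a b.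
  rewrite /g kE amulE [bract _ _]tens_ractE [LHS]kE -!mulrA -mulrDr; congr (_ * _).
  case: b c {g gB} => [b1 b2] [c1 c2]; congr pair; rewrite /=; first by rewrite addrC.
  by rewrite mulr0 mul0r addr0 add0r mulrN addNr.
by rewrite /kap1 /= key (eqP (kerA_valP z)) mul0r addr0.
Qed.

Lemma bd_ract a : bract (bd tgen) a = sgn a *: bd tgen.
Proof. by rewrite [LHS]K_decomp kap1_ract kap1_bd triv_in1 mul1r. Qed.

End KernelBimodule.

Section QBimodule.
Variable R : pzRingType.
Local Notation A := (triv R).
Local Notation QA := (QA R).

Definition tb (n : nat) : QA n := bdt [tuple of nseq n (tgen R)].

(** Since the differential of a is [a.2] dt, and dt commutes with R, this is the coordinate of the
    product of the differentials of the entries on (dt)^n. *)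
Definition tprod n (t : n.-tuple A) : R := \prod_(j < n) (tnth t j).2.

Lemma tprod_cons n (t : n.+1.-tuple A) :
  tprod t = (thead t).2 * tprod (behead_tuple t).
Proof.
rewrite /tprod big_ord_recl; congr (_ * _); apply: eq_bigr => j _.
by rewrite tnth_behead; congr (tnth t _).2; apply: val_inj; rewrite /= inordK ?ltnS.
Qed.

Lemma tprod_nseq n : tprod [tuple of nseq n (tgen R)] = 1.
Proof. by rewrite /tprod big1 // => j _; rewrite tnth_nseq. Qed.

(** The coordinate on (dt)^n, over which Q_(n+1) is free of rank one as a left A-module. Right
    multiplication by A is twisted by [sgn] once for each factor dt; on R the twist is trivial,
    whence the second clause. *)
Definition is_kap n (kap : QA n -> A) : Prop :=
  [/\ linear (kap : QA n -> A^o),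
      forall q r, kap (bract q (triv_in r)) = kap q * triv_in r,
      forall t, kap (bdt t) = triv_in (tprod t) &
      forall q, q = kap q *: tb n].

Lemma nseq_tupleS n (a : A) : behead_tuple [tuple of nseq n.+1 a] = [tuple of nseq n a].
Proof. exact: val_inj. Qed.

(* Since K is free over A on dt, with right action twisted by sgn, z (x) q in
   K (x)_A Q' has coordinate kap z * sgn (kap q). *)
Fact kap_exists n : exists kap, @is_kap n kap.
Proof.
case: n => [|n].
  exists (id : A -> A); split=> // [t|q].
    by rewrite /tprod big_ord0.
  exact: esym (mulr1 (q : A)).
elim: n => [|n [kap [kL kr kb kd]]].
  exists (@kap1 R); split; first exact: kap1_linear.
  - by move=> q r; rewrite [LHS]kap1_ract sgn_in.
  - by move=> t; rewrite [LHS]kap1_bd tprod_cons [tprod (behead_tuple _)]big_ord0 mulr1.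
  - by move=> q; rewrite [LHS]K_decomp.
pose h (z : K R) (q : QA n.+1) : A^o := kap1 z * sgn (kap q).
pose kap' (w : QA n.+2) : A := tlift h w.
have [|||kL' kE'] := @tlift_linear A A (K R) (QA n.+1) (@bract _ _ (K R)) (@GRing.scale _ _) A^o h.
- by move=> z x y; rewrite /h (linear_zmod kL) (@sgn_zmod R) mulrBr.
- by move=> q a x y; rewrite /h (@kap1_linear R) mulrDl -[X in X + _]mulrA.
- by move=> z t q; rewrite /h kap1_ract (linear_scale kL) -mulrA -sgnM.
have kz := linear_zmod kL'.
exists kap'; split.
- exact: kL'.
- move=> q r; pose f (q : QA n.+2) := kap' (bract q (triv_in r)).
  pose g (q : QA n.+2) := kap' q * triv_in r.
  have fB : zmod_morphism f by exact: (zmod_morph_comp kz (@bract_zmod _ _ (QA n.+2) _)).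
  have gB : zmod_morphism g by move=> x y; rewrite /g /kap' kz mulrBl.
  apply: (tens_eq fB gB) q => z q.
  by rewrite /f /g [bract _ _]tens_ractE /kap' !kE' /h kr sgnM sgn_in mulrA.
- move=> t; rewrite tprod_cons triv_inM.
  by rewrite -[LHS]/(kap' (tmk _ _ (bd (thead t)) (bdt (behead_tuple t)))) /kap' kE' /h kap1_bd
    kb sgn_in.
- move=> q; pose g (q : QA n.+2) : QA n.+2 := kap' q *: tb n.+2.
  have gB : zmod_morphism g by move=> x y; rewrite /g /kap' kz scalerBl.
  apply: (tens_eq (f := id) _ gB) q => // z q.
  rewrite /g /kap' kE' /h /tb.
  rewrite -[bdt _]/(tmk _ _ (bd (tgen R)) (bdt (behead_tuple [tuple of nseq n.+2 (tgen R)]))).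
  (* As [sgn a] dt = dt a, the coordinate of q crosses the tensor sign and is absorbed into q. *)
  rewrite nseq_tupleS -scalerA -tmkZ -bd_ract tmk_bal -tmkZ -kd.
  by rewrite -K_decomp.
Qed.

Definition kap n : QA n -> A := projT1 (cid (kap_exists n)).
Lemma kapP n : is_kap (@kap n).
Proof. by rewrite /kap; case: cid. Qed.

Lemma kap_tb n : kap (tb n) = 1.
Proof. by have [_ _ -> _] := kapP n; rewrite tprod_nseq. Qed.

Lemma kap_qgen n (p : A * n.-tuple A) : kap (qgen p : QA n) = p.1 * triv_in (tprod p.2).
Proof. by have [kL _ kb _] := kapP n; rewrite [LHS](linear_scale kL) kb. Qed.

Lemma qgen_kap n (q : QA n) : q = qgen (kap q, [tuple of nseq n (tgen R)]) :> Q R n.+1.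
Proof. by have [_ _ _ kd] := kapP n; rewrite {1}[q]kd. Qed.

Lemma QA_eq n (p q : QA n) : kap p = kap q -> p = q.
Proof. by have [_ _ _ kd] := kapP n; move=> pq; rewrite [p]kd [q]kd pq. Qed.

End QBimodule.

(** * An R-basis of Q_n and the differential in it *)

Section QBasis.
Variable R : pzRingType.
Local Notation A := (triv R).

(* Q_n is free over R on alpha n = t (dt)^(n-1) and beta n = (dt)^(n-1), with
   alpha 0 = 1 and no beta 0. *)
Definition alpha n : Q R n :=
  match n with 0 => (1 : R) | m.+1 => qgen (tgen R, [tuple of nseq m (tgen R)]) end.
Definition beta n : Q R n :=
  match n with 0 => (0 : R) | m.+1 => tb R m end.
Definition qa n : Q R n -> R :=
  match n return Q R n -> R with 0 => fun q => q | m.+1 => fun q => (kap (q : QA R m)).2 end.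
Definition qb n : Q R n -> R :=
  match n return Q R n -> R with 0 => fun=> 0 | m.+1 => fun q => (kap (q : QA R m)).1 end.

Lemma qa_linear n : linear (@qa n : Q R n -> R^o).
Proof.
case: n => [|n] // a x y; have [kL _ _ _] := @kapP R n.
by rewrite /qa [kap _](kL (triv_in a)) /= mul0r addr0.
Qed.

Lemma qb_linear n : linear (@qb n : Q R n -> R^o).
Proof.
case: n => [|n] a x y; first by rewrite scaler0 addr0.
by have [kL _ _ _] := @kapP R n; rewrite /qb [kap _](kL (triv_in a)) /=.
Qed.

Lemma qa_ract n (q : Q R n) r : qa (bract q r) = qa q * r.
Proof.
case: n q => [|n] // q; have [_ kr _ _] := @kapP R n.
by rewrite /qa [kap _]kr /= mulr0 add0r.
Qed.

Lemma qb_ract n (q : Q R n) r : qb (bract q r) = qb q * r.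
Proof.
case: n q => [|n] q; first by rewrite mul0r.
by have [_ kr _ _] := @kapP R n; rewrite /qb [kap _]kr.
Qed.

Lemma qa_alpha n : qa (alpha n) = 1.
Proof. by case: n => [|n] //; rewrite /qa kap_qgen tprod_nseq mulr1. Qed.
Lemma qb_alpha n : qb (alpha n) = 0.
Proof. by case: n => [|n] //; rewrite /qb kap_qgen tprod_nseq mulr1. Qed.
Lemma qa_beta n : qa (beta n) = 0.
Proof. by case: n => [|n] //; rewrite /qa kap_tb. Qed.
Lemma qb_beta n : qb (beta n.+1) = 1.
Proof. by rewrite /qb kap_tb. Qed.

Lemma Q_decomp n (q : Q R n) : q = qa q *: alpha n + qb q *: beta n.
Proof.
case: n q => [|n] q; first by rewrite scaler0 addr0; exact: esym (mulr1 (q : R)).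
have [kL _ _ _] := @kapP R n; apply: QA_eq.
rewrite -[RHS]/(kap (triv_in (qa q) *: (tgen R *: tb R n) + triv_in (qb q) *: tb R n)).
rewrite (linear_atD kL).
rewrite !(linear_scale kL) kap_tb.
rewrite -[RHS]/(triv_in (qa q) * (tgen R * 1) + triv_in (qb q) * 1) !mulr1 addrC.
exact: tgenE.
Qed.

Lemma Q_eq n (p q : Q R n) : qa p = qa q -> qb p = qb q -> p = q.
Proof. by move=> pa pb; rewrite [p]Q_decomp [q]Q_decomp pa pb. Qed.

Lemma alpha_ract n r : bract (alpha n) r = r *: alpha n.
Proof.
apply: Q_eq; rewrite ?(linear_scale (@qa_linear n)) ?(linear_scale (@qb_linear n)).
  by rewrite qa_ract qa_alpha mul1r /GRing.scale /= mulr1.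
by rewrite qb_ract qb_alpha mul0r scaler0.
Qed.

Lemma beta_ract n r : bract (beta n) r = r *: beta n.
Proof.
case: n => [|n]; first by rewrite scaler0; exact: mul0r.
apply: Q_eq; rewrite ?(linear_scale (@qa_linear n.+1)) ?(linear_scale (@qb_linear n.+1)).
  by rewrite qa_ract qa_beta mul0r scaler0.
by rewrite qb_ract qb_beta mul1r /GRing.scale /= mulr1.
Qed.

(** The differential of a depends only on the t-coefficient of a, and the coordinate of a product of
    differentials is the product of these coefficients; hence the candidate f has the values that
    [Qd] prescribes on generators. *)
Lemma QdE n (q : Q R n) : Qd q = qa q *: beta n.+1.
Proof.
case: n q => [|n] q; first exact: esym (mulr1 (triv_in (q : R) : A)).
pose f (q : Q R n.+1) : Q R n.+2 := qa q *: beta n.+2.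
have fB : zmod_morphism f by move=> x y; rewrite /f (linear_zmod (@qa_linear n.+1)) scalerBl.
rewrite -/(f q) {1}[q]qgen_kap /Qd.
suff fE p : f (qgen p) = qgen (1, [tuple of p.1 :: p.2]).
  by rewrite (extendE (f := f) fB) // -fE -qgen_kap.
apply: QA_eq; have [kL _ _ _] := @kapP R n.+1.
rewrite /f /qa !kap_qgen -[_ *: beta _]/(triv_in _ *: tb R n.+1 : QA R n.+1).
rewrite (linear_scale kL) kap_tb tprod_cons mul1r.
rewrite -[LHS]/(triv_in _ * 1) mulr1 theadE; congr triv_in.
have -> : behead_tuple [tuple of p.1 :: p.2] = p.2 by exact: val_inj.
by rewrite /= mulr0 add0r.
Qed.

Lemma Qd_linear n : linear (@Qd R n).
Proof.
by move=> a x y; rewrite !QdE (@qa_linear n) scalerDl scalerA.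
Qed.

Lemma Qd_alpha n : Qd (alpha n) = beta n.+1.
Proof. by rewrite QdE qa_alpha scale1r. Qed.
Lemma Qd_beta n : Qd (beta n) = 0.
Proof. by rewrite QdE qa_beta scale0r. Qed.

End QBasis.

(** * The coaction of Q_n in this basis *)

Section QCoaction.
Variables (k : comPzRingType) (R : kalgebra k).
Local Notation A := (triv R).
Local Notation L := (coend_bimod R).
Local Notation Lb := (cbar_bimod R).
Local Notation cX := (cX R).
Local Notation cY := (cY R).
Local Notation alpha := (alpha R).
Local Notation beta := (beta R).

Lemma cpi_edual1 (a : A) : cpi a (edual R true) = cio a.2 1 * cY.
Proof. by rewrite cpi_normal /= !(zmod_morph0 (cio_zmodr _)) mul0r !add0r. Qed.

Lemma cpi_edual0 (a : A) : cpi a (edual R false) = cio a.1 1 + cio a.2 1 * cX.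
Proof. by rewrite cpi_normal /= (zmod_morph0 (cio_zmodr _)) mul0r addr0. Qed.

Lemma prod_cioY n (c : 'I_n -> R) :
  \prod_(j < n) (cio (c j) 1 * cY) = cio (\prod_(j < n) c j) 1 * cY ^+ n :> coend R.
Proof.
elim: n c => [|n IHn] c; first by rewrite !big_ord0 expr0 cio1 mul1r.
rewrite !big_ord_recl IHn exprS mulrA -[_ * cY * _]mulrA cY_cio.
by rewrite !mulrA cioM mulr1.
Qed.

Lemma tprod_ebase n (i : n.-tuple bool) :
  tprod (map_tuple (ebase R) i) = (all id i)%:R.
Proof.
elim: n i => [|n IHn] i; first by rewrite /tprod big_ord0 [i]tuple0.
case/tupleP: i => b i; rewrite tprod_cons -[thead _]/(ebase R b).
have -> : behead_tuple (map_tuple (ebase R) [tuple of b :: i]) = map_tuple (ebase R) i.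
  exact: val_inj.
by rewrite IHn; case: b; rewrite /= ?mul1r ?mul0r.
Qed.

Lemma Q_coactS n (q : Q R n.+1) : Q_coact q =
  tmk _ _ (cio (qb q) 1 * cY ^+ n + cio (qa q) 1 * (cX * cY ^+ n) : L) (beta n.+1)
  + tmk _ _ (cio (qa q) 1 * cY ^+ n.+1 : L) (alpha n.+1).
Proof.
pose f (q : Q R n.+1) : btens L (Q R n.+1) :=
  tmk _ _ (cio (qb q) 1 * cY ^+ n + cio (qa q) 1 * (cX * cY ^+ n) : L) (beta n.+1)
  + tmk _ _ (cio (qa q) 1 * cY ^+ n.+1 : L) (alpha n.+1).
have aB := linear_zmod (@qa_linear R n.+1); have bB := linear_zmod (@qb_linear R n.+1).
have fB : zmod_morphism f.
  apply: zmod_morph_add => x y; rewrite -(tmkBl _ _ _).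
    by rewrite aB bB !cio_zmodl !mulrBl opprD addrACA.
  by rewrite aB cio_zmodl mulrBl.
suff fE p : f (qgen p) = \sum_(i0 : bool) \sum_(i : n.-tuple bool)
        tmk _ _ (cpi p.1 (edual R i0) *
             \prod_(j < n) cpi (tnth p.2 j) (edual R (tnth i j)) : L)
          (qgen (ebase R i0, map_tuple (ebase R) i)).
  rewrite -/(f q) /Q_coact {1}[q]qgen_kap (extendE (f := f) fB) //.
  by rewrite -fE -qgen_kap.
(* The differential of 1 is 0, so among the inner multi-indices only the one with all entries t
   contributes. *)
pose i1 : n.-tuple bool := [tuple of nseq n true].
have inner i0 : \sum_(i : n.-tuple bool)
        tmk _ _ (cpi p.1 (edual R i0) *
             \prod_(j < n) cpi (tnth p.2 j) (edual R (tnth i j)) : L)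
          (qgen (ebase R i0, map_tuple (ebase R) i)) =
      tmk _ _ (cpi p.1 (edual R i0) * (cio (tprod p.2) 1 * cY ^+ n) : L)
        (if i0 then alpha n.+1 else beta n.+1).
  rewrite (bigD1 i1) //= [X in _ + X]big1 ?addr0 => [|i ne].
    rewrite (eq_bigr (fun j => cio (tnth p.2 j).2 1 * cY)) => [|j _]; last first.
      by rewrite tnth_nseq cpi_edual1.
    rewrite prod_cioY; congr (tmk _ _ _ _).
    have -> : map_tuple (ebase R) i1 = [tuple of nseq n (tgen R)].
      by apply: val_inj; rewrite /= map_nseq.
    by case: i0 => //=; exact: scale1r.
  suff -> : qgen (ebase R i0, map_tuple (ebase R) i) = 0 by rewrite tmk0r.
  apply: QA_eq; have [kL _ _ _] := @kapP R n.
  rewrite kap_qgen (linear_at0 kL) tprod_ebase.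
  case: (boolP (all id i)) => [i_all|_]; last exact: mulr0.
  case/eqP: ne; apply: val_inj => /=.
  have /all_pred1P -> : all (pred1 true) i by rewrite (eq_all (a2 := id)) // => -[].
  by rewrite size_tuple.
rewrite big_bool /= !inner cpi_edual1 cpi_edual0 addrC /f.
have -> : qb (qgen p) = p.1.1 * tprod p.2 by rewrite /qb kap_qgen.
have -> : qa (qgen p) = p.1.2 * tprod p.2 by rewrite /qa kap_qgen /= mulr0 add0r.
congr (tmk _ _ _ _ + tmk _ _ _ _).
  rewrite mulrDl !mulrA !cioM mulr1; congr (_ * _ + _ * _).
  by rewrite -mulrA cX_cio mulrA cioM mulr1.
rewrite exprS !mulrA; congr (_ * _).
by rewrite -mulrA cY_cio mulrA cioM mulr1.
Qed.

Lemma bproj_tens_spec (X : lmodType R) :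
  linear (tlift (fun (l : L) (q : X) => tmk _ _ (bproj l : Lb) q) : btens L X -> btens Lb X)
  /\ forall l q, tlift (fun (l : L) (q : X) => tmk _ _ (bproj l : Lb) q)
       (tmk _ _ l q : btens L X) = tmk _ _ (bproj l : Lb) q :> btens Lb X.
Proof.
apply: tlift_linear => [l x y|q a x y|l t q].
- exact: tmkBr.
- by rewrite (linearI (@bproj_zmod k R) (@bprojZ k R)) tmkDl tmkZ.
- by rewrite -tmk_bal /= cbar_ractE.
Qed.

Lemma cY_cw n : cY ^+ n = cw R false n.
Proof. by rewrite /cw expr0 mul1r. Qed.

Lemma Q_bar_coactE n (q : Q R n) : Q_bar_coact q =
  qa q *: (tmk _ _ (bw R false n) (alpha n) + tmk _ _ (bz R n) (beta n))
  + qb q *: tmk _ _ (bw R false n.-1) (beta n).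
Proof.
have [pL pE] := bproj_tens_spec (Q R n); rewrite /Q_bar_coact.
case: n q pL pE => [|n] q pL pE.
  rewrite /Q_coact pE [bz R 0]/(0 : Lb) tmk0l addr0 scale0r addr0 -tmkZ.
  congr tmk; have := bproj_cw (q : R) 1 false 0.
  by rewrite /cw !expr0 !mulr1 /= => ->.
rewrite Q_coactS (linear_atD pL) !pE !cY_cw.
have -> : cX * cw R false n = cw R true n by rewrite cX_w.
rewrite bprojD !bproj_cw !mulr1 -[bz R n.+1]/(bw R true n) /=.
rewrite scalerDr tmkDl -!tmkZ addrC [tmk _ _ (qb q *: _) _ + _]addrC.
by rewrite addrA.
Qed.

Lemma Q_bar_coact_linear n : linear (@Q_bar_coact k R n).
Proof.
move=> a x y; rewrite !Q_bar_coactE (@qa_linear R n) (@qb_linear R n) !scalerDl.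
by rewrite addrACA [a *: (_ + _)]scalerDr ![a *: (_ *: _)]scalerA.
Qed.

Lemma Q_bar_coact_alpha n :
  Q_bar_coact (alpha n) = tmk _ _ (bw R false n) (alpha n) + tmk _ _ (bz R n) (beta n).
Proof. by rewrite Q_bar_coactE qa_alpha qb_alpha scale1r scale0r addr0. Qed.

Lemma Q_bar_coact_beta n :
  Q_bar_coact (beta n) = tmk _ _ (bw R false n.-1) (beta n).
Proof.
case: n => [|n]; last by rewrite Q_bar_coactE qa_beta qb_beta scale1r scale0r add0r.
by rewrite tmk0r (linear_at0 (@Q_bar_coact_linear 0)).
Qed.

End QCoaction.

(** * The functor Q (x)_C - *)

Section ExtendFacts.

(** [extendE] gives values on the family only; when the family spans, [extend] is thereby a known
    map and inherits its linearity. *)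
Lemma extend_eq (I : Type) (U V : zmodType) (g : I -> U) (v : I -> V) (f : U -> V) :
    zmod_morphism f -> (forall i, f (g i) = v i) ->
    (forall x, aspan (fun x => exists i, x = g i) x) ->
  forall x, extend g v x = f x.
Proof.
move=> fB fg gs x; apply: (aspan_eq _ fB) (gs x); first exact: extend_additive.
by move=> _ [i ->]; rewrite (extendE fB).
Qed.

Variable R : pzRingType.

Lemma Cring_span (c : Cring R) : aspan (fun c => exists s, c = Cgen s) c.
Proof.
case: c => c d; rewrite (_ : (c, d) = ((c, 0) : Cring R) + (0, d)); last first.
  by congr pair; rewrite /= ?addr0 ?add0r.
apply: aspanD.
  apply: (aspan_map (f := fun c => (c, 0) : Cring R)) (dsum_span c).
    by move=> x y; congr pair; rewrite /= ?subr0.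
  by move=> _ [n [r ->]]; apply: aspan_gen; exists (Csym_h (r : R) n).
apply: (aspan_map (f := fun d => (0, d) : Cring R)) (dsum_span d).
  by move=> x y; congr pair; rewrite /= ?subr0.
by move=> _ [n [r ->]]; apply: aspan_gen; exists (Csym_u (r : R) n).
Qed.

Lemma Cring_eq (V : zmodType) (f g : Cring R -> V) : zmod_morphism f -> zmod_morphism g ->
  (forall s, f (Cgen s) = g (Cgen s)) -> forall c, f c = g c.
Proof. by move=> fB gB fg c; apply: (aspan_eq fB gB) (Cring_span c) => _ [s ->]. Qed.

Lemma Cring_extend (V : zmodType) (v : Csym R -> V) :
    (forall n, zmod_morphism (fun r => v (Csym_h r n))) ->
    (forall n, zmod_morphism (fun r => v (Csym_u r n))) ->
  forall s, extend (@Cgen R) v (Cgen s) = v s.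
Proof.
move=> hB uB.
have [f [fB fE]] := @dsum_lift_add R _ (fun _ : nat => R^o) V (fun n (r : R) => v (Csym_h r n)) hB.
have [g [gB gE]] := @dsum_lift_add R _ (fun _ : nat => R^o) V (fun n (r : R) => v (Csym_u r n)) uB.
apply: (extendE (f := fun c : Cring R => f c.1 + g c.2)) => [|[r n|r n]].
- by apply: zmod_morph_add => x y /=; rewrite ?fB ?gB.
- by rewrite /= fE (zmod_morph0 gB) addr0.
- by rewrite /= gE (zmod_morph0 fB) add0r.
Qed.

End ExtendFacts.

Section TensMap.
Variables (k : comPzRingType) (R : kalgebra k).
Local Notation Lb := (cbar_bimod R).

Lemma tens_map_linear (X Y : lmodType R) (f : X -> Y) : linear f -> linear (@tens_map k R X Y f).
Proof.
move=> fL; apply: (proj1 (@tlift_linear _ _ _ _ _ _ (btens Lb Y : lmodType R) _ _ _ _)).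
- by move=> l x y; rewrite (linear_zmod fL) tmkBr.
- by move=> x r l l'; rewrite tmkDl tmkZ.
- by move=> l t x; rewrite tmk_bal (linear_scale fL).
Qed.

Lemma tens_map0 (X Y : lmodType R) z : @tens_map k R X Y (fun=> 0) z = 0.
Proof.
have l0 : linear (fun _ : X => 0 : Y) by move=> a x y; rewrite scaler0 addr0.
apply: (tens_eq (tens_map_zmod _) (g := fun=> 0)) => [x y|l x]; first by rewrite subrr.
by rewrite tens_mapE // tmk0r.
Qed.

End TensMap.

(** * Q as a comodule on which C acts by comodule maps *)

Section QTotal.
Variables (k : comPzRingType) (R : kalgebra k).
Local Notation Lb := (cbar_bimod R).
Local Notation alpha := (alpha R).
Local Notation beta := (beta R).
Local Notation qin := (din (V := fun n => Q R n : lmodType R)).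

Lemma Qtot_coact_spec : linear (@Qtot_coact k R) /\
  forall n (q : Q R n), Qtot_coact (qin q) = tens_map (fun q => qin q : Qtot R) (Q_bar_coact q).
Proof.
have dL n : linear (fun q : Q R n => qin q : Qtot R) by exact: din_linear.
have [n|f [fL fE]] := @dsum_lift R _ (fun n => Q R n : lmodType R) (btens Lb (Qtot R) : lmodType R)
  (fun n q => tens_map (fun q => qin q : Qtot R) (Q_bar_coact q)).
  exact: linear_comp (tens_map_linear (dL n)) (@Q_bar_coact_linear k R n).
have Ef x : Qtot_coact x = f x.
  apply: extend_eq => [|[n q]|y].
  - exact: linear_zmod.
  - exact: fE.
  - apply: aspan_bind (dsum_span y) => _ [n [q ->]].
    by apply: aspan_gen; exists (existT _ n q).
by split=> [a x y|n q]; rewrite !Ef ?fL ?fE.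
Qed.

Lemma Qtot_Cact_gen (q : Qtot R) s : Qtot_Cact q (Cgen s) =
  match s with
  | Csym_h r n => qin (bract ((q : dsum _) n) r)
  | Csym_u r n => qin (bract (Qd ((q : dsum _) n)) r)
  end.
Proof.
have dB n := linear_zmod (@din_linear R _ (fun n => Q R n : lmodType R) n).
apply: (Cring_extend (v := fun s => match s with
  | Csym_h r n => qin (bract ((q : dsum _) n) r)
  | Csym_u r n => qin (bract (Qd ((q : dsum _) n)) r)
  end : Qtot R)) => n; apply: zmod_morphismP => r r'; rewrite bractDr;
  exact: (zmod_morphD (dB _)).
Qed.

Lemma Qtot_Cact_zmodr q : zmod_morphism (@Qtot_Cact k R q).
Proof. exact: extend_additive. Qed.

Lemma Qtot_Cact_linear c : linear (fun q => @Qtot_Cact k R q c).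
Proof.
have dL n := @din_linear R _ (fun n => Q R n : lmodType R) n.
move=> a x y.
pose f c := Qtot_Cact (a *: x + y) c; pose g c := a *: Qtot_Cact x c + Qtot_Cact y c.
have gB : zmod_morphism g.
  apply: zmod_morph_add => c1 c2; last exact: Qtot_Cact_zmodr.
  by rewrite Qtot_Cact_zmodr scalerBr.
apply: (Cring_eq (Qtot_Cact_zmodr _) gB) c => s.
rewrite /g !Qtot_Cact_gen; case: s => r n; rewrite -(dL _) dsum_addE dsum_scaleE.
  by rewrite bractDl bractZ.
by rewrite (@Qd_linear R n) bractDl bractZ.
Qed.

Lemma Q_linear_eq n (V : lmodType R) (f g : Q R n -> V) : linear f -> linear g ->
  f (alpha n) = g (alpha n) -> f (beta n) = g (beta n) -> forall q, f q = g q.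
Proof.
move=> fL gL fa fb q; rewrite [q]Q_decomp.
rewrite (linear_atD fL) (linear_atD gL).
by rewrite !(linear_scale fL) !(linear_scale gL) fa fb.
Qed.

Lemma Q_bar_coact_ract n (q : Q R n) r :
  Q_bar_coact (bract q r) = tens_map (fun q => bract q r) (Q_bar_coact q).
Proof.
have bL : linear (fun q : Q R n => bract q r) by move=> a x y; rewrite bractDl bractZ.
have tL := tens_map_linear (k := k) bL; have tD := linear_atD tL.
have cL := @Q_bar_coact_linear k R n.
apply: (Q_linear_eq (linear_comp cL bL) (linear_comp tL cL)).
  rewrite alpha_ract (linear_scale cL) Q_bar_coact_alpha tD !tens_mapE //.
  by rewrite alpha_ract beta_ract bw_tmkZ bz_tmkZ scalerDr.
rewrite beta_ract (linear_scale cL) Q_bar_coact_beta !tens_mapE //.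
by rewrite beta_ract bw_tmkZ.
Qed.

Lemma Q_bar_coact_diff n (q : Q R n) :
  Q_bar_coact (Qd q) = tens_map (@Qd R n) (Q_bar_coact q).
Proof.
have dL := @Qd_linear R n; have cL m := @Q_bar_coact_linear k R m.
have tL := tens_map_linear (k := k) dL; have tD := linear_atD tL.
apply: (Q_linear_eq (linear_comp (cL _) dL) (linear_comp tL (cL _))).
  rewrite Qd_alpha Q_bar_coact_alpha Q_bar_coact_beta tD !tens_mapE //.
  by rewrite Qd_alpha Qd_beta tmk0r addr0.
by rewrite Qd_beta Q_bar_coact_beta !tens_mapE // Qd_beta tmk0r (linear_at0 (cL _)).
Qed.

(** This is what makes the coaction on Q (x)_C M well defined. *)
Lemma Qtot_colinear (q : Qtot R) (c : Cring R) :
  Qtot_coact (Qtot_Cact q c) = tens_map (fun q => Qtot_Cact q c) (Qtot_coact q).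
Proof.
have dL n := @din_linear R _ (fun n => Q R n : lmodType R) n.
have [cL cE] := Qtot_coact_spec; have cB := linear_zmod cL.
(* on a summand, the action of a generator is a colinear map h of Q_n followed
   by an inclusion *)
have key n m (h : Q R n -> Q R m) : linear h ->
    (forall q, Q_bar_coact (h q) = tens_map h (Q_bar_coact q)) -> forall q : Qtot R,
    Qtot_coact (qin (h ((q : dsum _) n)) : Qtot R) =
    tens_map (fun q : Qtot R => qin (h ((q : dsum _) n)) : Qtot R) (Qtot_coact q).
  move=> hL hc.
  have dhL : linear (fun q : Qtot R => qin (h ((q : dsum _) n)) : Qtot R).
    by move=> a x y; rewrite dsum_addE dsum_scaleE hL; exact: (dL m).
  have tL := tens_map_linear (k := k) dhL.
  apply: (dsum_eq (zmod_morph_comp cB (linear_zmod dhL)) (zmod_morph_comp (linear_zmod tL) cB)).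
  move=> i v; rewrite !cE -tens_map_comp //.
  have [ni|ni] := eqVneq i n; last first.
    have -> : (fun x : Q R i => qin (h ((qin x : Qtot R) n)) : Qtot R) = fun=> 0.
      apply/funext => y; rewrite din_ne // (linear_at0 hL).
      exact: (linear_at0 (dL m)).
    rewrite tens_map0 din_ne // (linear_at0 hL).
    rewrite (linear_at0 (@Q_bar_coact_linear k R m)).
    exact: (zmod_morph0 (tens_map_zmod _)).
  subst i; rewrite din_same hc -tens_map_comp //.
  by congr (tens_map _ _); apply/funext => y; rewrite din_same.
pose f c := Qtot_coact (Qtot_Cact q c).
pose g c := tens_map (fun q => Qtot_Cact q c) (Qtot_coact q) : btens Lb (Qtot R).
have fB : zmod_morphism f by exact: (zmod_morph_comp cB (Qtot_Cact_zmodr q)).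
have gB : zmod_morphism g.
  move=> c1 c2; rewrite /g; move: (Qtot_coact q).
  apply: (tens_eq (tens_map_zmod _)).
    apply: zmod_morph_add; first exact: tens_map_zmod.
    by move=> x y; rewrite (@tens_map_zmod k R) opprB addrC opprK.
  move=> l x; rewrite !tens_mapE; try exact: Qtot_Cact_linear.
  by rewrite Qtot_Cact_zmodr tmkBr.
apply: (Cring_eq fB gB) c => s; rewrite /f /g Qtot_Cact_gen.
case: s => r n.
  rewrite (key n n (fun q => bract q r)) => [|a x y|x]; first last.
  - exact: Q_bar_coact_ract.
  - by rewrite bractDl bractZ.
  by congr (tens_map _ _); apply/funext => x; rewrite Qtot_Cact_gen.
rewrite (key n n.+1 (fun q => bract (Qd q) r)) => [|a x y|x]; first last.
- rewrite Q_bar_coact_ract Q_bar_coact_diff.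
  have bL : linear (fun q : Q R n.+1 => bract q r) by move=> a u v; rewrite bractDl bractZ.
  exact: esym (tens_map_comp (R := R) _ bL (@Qd_linear R n)).
- by rewrite (@Qd_linear R n) bractDl bractZ.
by congr (tens_map _ _); apply/funext => x; rewrite Qtot_Cact_gen.
Qed.

End QTotal.

(** * The comodule Q (x)_C M as a direct sum of copies of the M_n *)

Section FunctorObjects.
Variables (k : comPzRingType) (R : kalgebra k).
Local Notation Lb := (cbar_bimod R).
Local Notation alpha := (alpha R).
Local Notation beta := (beta R).
Local Notation qin := (din (V := fun n => Q R n : lmodType R)).
Variable M : complex R.
Local Notation min := (din (V := M)).
Local Notation FM := (tens (@Qtot_Cact k R) (@ctot_Cact R M)).
Local Notation "q \om m" := (tmk (@Qtot_Cact k R) (@ctot_Cact R M) q m)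
  (at level 40, left associativity).
Hypothesis HM : is_complex M.

Lemma cdiff_linear n : linear (@cdiff _ M n). Proof. by case: HM. Qed.
Lemma cdiff_zmod n : zmod_morphism (@cdiff _ M n). Proof. exact: linear_zmod (@cdiff_linear n). Qed.
Lemma cdiffK n (x : M n.+2) : cdiff (cdiff x) = 0. Proof. by case: HM. Qed.

Lemma ctot_Cact_gen (m : ctot M) s : ctot_Cact (Cgen s) m =
  match s with
  | Csym_h r n => min (r *: (m : dsum M) n)
  | Csym_u r n => min (r *: cdiff ((m : dsum M) n.+1))
  end.
Proof.
have dB n := linear_zmod (@din_linear R _ M n).
apply: (Cring_extend (v := fun s => match s with
  | Csym_h r n => min (r *: (m : dsum M) n)
  | Csym_u r n => min (r *: cdiff ((m : dsum M) n.+1))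
  end : ctot M)) => n r r'; by rewrite scalerBl dB.
Qed.

Lemma ctot_Cact_zmodl m : zmod_morphism (fun c => @ctot_Cact R M c m).
Proof. exact: extend_additive. Qed.

Definition Qj n (x : M n) : QC_ob M := qin (alpha n) \om min x.
Definition Qjd n : M n -> QC_ob M :=
  if n is m.+1 return M n -> QC_ob M then fun x => Qj (cdiff x) else fun=> 0.

(** r alpha_n is the image of alpha_n under r h_n, and r h_n crosses the tensor sign over C, where
    it multiplies by r and projects to degree n. *)
Lemma Qj_scale n r (m : ctot M) :
  r *: (qin (alpha n) \om m) = Qj (r *: (m : dsum M) n).
Proof.
rewrite -tmkZ -(linear_scale (@din_linear _ _ _ _)) -alpha_ract.
have -> : qin (bract (alpha n) r) = Qtot_Cact (qin (alpha n)) (Cgen (Csym_h r n)).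
  by rewrite Qtot_Cact_gen din_same.
by rewrite tmk_bal ctot_Cact_gen.
Qed.

Lemma qin_alpha_om n (m : ctot M) : qin (alpha n) \om m = Qj ((m : dsum M) n).
Proof. by rewrite -[LHS]scale1r Qj_scale scale1r. Qed.

(** beta_(n+1) is the image of alpha_n under u_n, and u_n crosses the tensor sign over C as the
    differential of M. *)
Lemma qin_beta_om n (m : ctot M) : qin (beta n) \om m = Qjd ((m : dsum M) n).
Proof.
case: n => [|n] /=.
  by rewrite (linear_at0 (@din_linear _ _ (fun n => Q R n : lmodType R) 0%N)) tmk0l.
have -> : qin (beta n.+1) = Qtot_Cact (qin (alpha n)) (Cgen (Csym_u 1 n)).
  by rewrite Qtot_Cact_gen din_same Qd_alpha bract1.
by rewrite tmk_bal ctot_Cact_gen scale1r.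
Qed.

Lemma Qj_linear n : linear (@Qj n).
Proof.
move=> a x y; rewrite /Qj (@din_linear _ _ M n) tmkDr; congr (_ + _).
by rewrite qin_alpha_om Qj_scale dsum_scaleE.
Qed.

Lemma Qj_zmod n : zmod_morphism (@Qj n). Proof. exact: linear_zmod (@Qj_linear n). Qed.

Lemma Qj_span (x : QC_ob M) : aspan (fun x => exists n y, x = @Qj n y) x.
Proof.
apply: aspan_bind (tens_span x) => _ [q [m ->]].
apply: (aspan_map (f := fun q => q \om m)) (dsum_span q); first exact: tmkBl.
move=> _ [n [v ->]]; rewrite [v]Q_decomp.
have dL := @din_linear R _ (fun n => Q R n : lmodType R) n.
rewrite dL (linear_scale dL) tmkDl !tmkZ; apply: aspanD.
  by rewrite qin_alpha_om -(linear_scale (@Qj_linear n)); apply: aspan_gen; exists n,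
    (qa v *: (m : dsum M) n).
rewrite qin_beta_om; case: n v dL => [|n] v dL; first by rewrite scaler0; exact: aspan0.
rewrite /Qjd -(linear_scale (@Qj_linear n)); apply: aspan_gen.
by exists n, (qb v *: cdiff ((m : dsum M) n.+1)).
Qed.

(** The coordinate on the summand alpha_n (x) M_n. The second term is the contribution of beta_(n+1)
    (x) m = alpha_n (x) dm. *)
Definition Qth n (x : QC_ob M) : M n :=
  tlift (fun (q : Qtot R) (m : ctot M) =>
    qa ((q : dsum _) n) *: (m : dsum M) n
    + qb ((q : dsum _) n.+1) *: cdiff ((m : dsum M) n.+1)) x.

Lemma Qth_spec n : linear (@Qth n) /\ forall (q : Qtot R) (m : ctot M), Qth n (q \om m) =
    qa ((q : dsum _) n) *: (m : dsum M) n
    + qb ((q : dsum _) n.+1) *: cdiff ((m : dsum M) n.+1).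
Proof.
apply: tlift_linear => [q x y|m a x y|q c m].
- rewrite ![(x - y) _](linear_zmod (@dsum_proj_linear _ _ M _)).
  by rewrite (@cdiff_zmod n) !scalerBr opprD addrACA.
- rewrite !dsum_addE !dsum_scaleE (@qa_linear R n) (@qb_linear R n.+1) !scalerDl addrACA.
  by rewrite scalerDr !scalerA.
pose g c := qa ((q : dsum _) n) *: (ctot_Cact c m : dsum M) n
    + qb ((q : dsum _) n.+1) *: cdiff ((ctot_Cact c m : dsum M) n.+1).
pose f c := qa ((Qtot_Cact q c : dsum _) n) *: (m : dsum M) n
    + qb ((Qtot_Cact q c : dsum _) n.+1) *: cdiff ((m : dsum M) n.+1).
have dB n' (x y : ctot M) : (x - y : dsum M) n' = x n' - y n'.
  exact: (linear_zmod (@dsum_proj_linear _ _ M _)).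
have qB n' (x y : Qtot R) : (x - y : dsum _) n' = x n' - y n'.
  exact: (linear_zmod (@dsum_proj_linear _ _ (fun n => Q R n : lmodType R) _)).
have fB : zmod_morphism f.
  apply: zmod_morph_add => c1 c2; rewrite Qtot_Cact_zmodr qB -scalerBl.
    by rewrite (linear_zmod (@qa_linear R n)).
  by rewrite (linear_zmod (@qb_linear R n.+1)).
have gB : zmod_morphism g.
  apply: zmod_morph_add => c1 c2; rewrite ctot_Cact_zmodl dB -scalerBr //.
  by rewrite (@cdiff_zmod n).
apply: (Cring_eq fB gB) c => s; rewrite /f /g; clear f g fB gB.
rewrite Qtot_Cact_gen ctot_Cact_gen.
have a0 p : qa (0 : Q R p) = 0 by exact: linear_at0 (@qa_linear R p).
have b0 p : qb (0 : Q R p) = 0 by exact: linear_at0 (@qb_linear R p).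
have d0 p : cdiff (0 : M p.+1) = 0 by exact: zmod_morph0 (@cdiff_zmod p).
have nn p : (p != p.+1) && (p.+1 != p) by rewrite !neq_ltn ltnSn orbT.
case: s => r p.
  have [E|pn] := eqVneq p n.
    subst p; have /andP[n1 n2] := nn n; rewrite !din_same !(din_ne _ n1).
    by rewrite qa_ract scalerA b0 d0 scale0r scaler0.
  (* For p different from n, h_p contributes through beta_(n+1) only, when p = n + 1. *)
  rewrite !(din_ne _ pn) a0 scale0r scaler0 !add0r.
  have [E|pn1] := eqVneq p n.+1; last by rewrite !(din_ne _ pn1) b0 d0 scale0r scaler0.
  by subst p; rewrite !din_same qb_ract (linear_scale (@cdiff_linear n)) scalerA.
(* For p = n, u_n turns alpha_n into beta_(n+1) on one side and the component of m in degree n + 1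
   into its differential on the other. *)
have [E|pn] := eqVneq p n.
  subst p; have /andP[n1 n2] := nn n; rewrite !din_same (din_ne _ n1) (din_ne _ n2).
  rewrite a0 d0 scale0r scaler0 add0r addr0 scalerA qb_ract QdE.
  by rewrite (linear_scale (@qb_linear R n.+1)) qb_beta /GRing.scale /= mulr1.
rewrite (din_ne (V := M) _ pn) scaler0 add0r (din_ne (i := p.+1) (j := n.+1)) // b0 scale0r addr0.
have [E|pn1] := eqVneq p n.+1; last first.
  rewrite (din_ne (V := M) _ pn1) d0 scaler0.
  have [E'|pn2] := eqVneq p.+1 n; last by rewrite (din_ne _ pn2) a0 scale0r.
  subst n; rewrite din_same qa_ract QdE (linear_scale (@qa_linear R p.+1)) qa_beta.
  by rewrite scaler0 mul0r scale0r.
(* Here u_(n+1) produces d d of the component of m in degree n + 2, while the other side has no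
   component in degrees n and n + 1: balancedness rests on d d = 0. *)
subst p; rewrite din_same (linear_scale (@cdiff_linear n)) cdiffK !scaler0.
by rewrite din_ne ?a0 ?scale0r // gtn_eqF // (ltnW (ltnSn _)).
Qed.

Lemma Qth_linear n : linear (@Qth n). Proof. exact: (Qth_spec n).1. Qed.

Lemma QthK n (x : M n) : Qth n (Qj x) = x.
Proof.
by rewrite /Qj (Qth_spec n).2 !din_same qa_alpha scale1r !din_ne ?(zmod_morph0 (@cdiff_zmod n))
  ?scaler0 ?addr0 // neq_ltn ltnSn.
Qed.

Lemma Qth_ne n p (x : M p) : n != p -> Qth n (Qj x) = 0.
Proof.
move=> np; rewrite /Qj (Qth_spec n).2 (din_ne (V := M) x) ?scaler0 ?add0r 1?eq_sym //.
have [E|ne] := eqVneq n.+1 p; last by rewrite (din_ne x) 1?eq_sym //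
  (zmod_morph0 (@cdiff_zmod n)) scaler0.
by subst p; rewrite !din_same qb_alpha scale0r.
Qed.

Lemma QC_coact_spec : linear (@coact _ _ (QC_ob M)) /\
  forall (q : Qtot R) (m : ctot M), coact (q \om m : QC_ob M) =
    tens_map (fun q => q \om m : QC_ob M) (Qtot_coact q).
Proof.
have mL (m : ctot M) : linear (fun q : Qtot R => q \om m : QC_ob M).
  by move=> a x y; rewrite tmkDl tmkZ.
have [cL _] := Qtot_coact_spec R.
apply: tlift_linear => [q x y|m|q c m].
- pose g z := tens_map (fun q => q \om x : QC_ob M) z - tens_map (fun q => q \om y : QC_ob M) z.
  have gB : zmod_morphism g.
    by move=> u v; rewrite /g !tens_map_zmod !opprD !opprK addrACA.
  apply: (tens_eq (tens_map_zmod (fun q => q \om (x - y) : QC_ob M)) gB) (Qtot_coact q) => l q'.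
  by rewrite /g !tens_mapE // !tmkBr.
- exact: linear_comp (tens_map_linear (mL m)) cL.
rewrite -/(tens_map _ _) -/(tens_map _ _) Qtot_colinear -tens_map_comp //; last exact:
  Qtot_Cact_linear.
by congr (tens_map _ _); apply/funext => q'; rewrite tmk_bal.
Qed.

Lemma QC_coact_linear : linear (@coact _ _ (QC_ob M)).
Proof. exact: QC_coact_spec.1. Qed.

Lemma Qj_homog n (x : M n) : homog n (Qj x) (Qjd x).
Proof.
have [cL cE] := QC_coact_spec.
have mL (m : ctot M) : linear (fun q : Qtot R => q \om m : QC_ob M).
  by move=> a u v; rewrite tmkDl tmkZ.
have dL p := @din_linear R _ (fun n => Q R n : lmodType R) p.
have cj p (y : M p) : coact (Qj y : QC_ob M) =
    tmk _ _ (bw R false p : Lb) (Qj y) + tmk _ _ (bz R p : Lb) (Qjd y).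
  rewrite cE (Qtot_coact_spec R).2 Q_bar_coact_alpha !(zmod_morphD (tens_map_zmod _)).
  by rewrite !tens_mapE // qin_beta_om din_same.
split; first exact: cj; last by case: n x.
case: n x => [|n] x.
  by rewrite [Qjd x]/(0 : QC_ob M) (linear_at0 cL) tmk0r.
rewrite [Qjd x]/(Qj (cdiff x)) cj; case: n x => [|n] x; first by rewrite [Qjd _]/(0 : QC_ob M)
  tmk0r addr0.
by rewrite /Qjd cdiffK (zmod_morph0 (@Qj_zmod n)) tmk0r addr0.
Qed.

Lemma QC_comodule : is_comodule (QC_ob M).
Proof.
apply: comodule_gen; first exact: QC_coact_linear.
move=> x; apply: aspan_bind (Qj_span x) => _ [n [y ->]].
by apply: aspan_gen; exists n, (Qjd y); exact: Qj_homog.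
Qed.

Lemma QC_eq (V : zmodType) (f g : QC_ob M -> V) : zmod_morphism f -> zmod_morphism g ->
  (forall n (x : M n), f (Qj x) = g (Qj x)) -> forall x, f x = g x.
Proof.
by move=> fB gB fg x; apply: (aspan_eq fB gB) (Qj_span x) => _ [n [y ->]].
Qed.

(** [hproj n] and the composite of [Qth n] and [Qj] are both the identity on alpha_n (x) M_n and 0
    on the other summands, so they coincide; [hproj n] fixes homogeneous elements of degree n. *)
Lemma QC_homog n (x dx : QC_ob M) : homog n x dx -> x = Qj (Qth n x).
Proof.
move=> xh; have := homog_proj n xh; rewrite eqxx => {1}<-.
have HF := QC_comodule.
have cL := hproj_linear HF n; have tL := Qth_linear n; have jL := @Qj_linear n.
apply: (QC_eq (linear_zmod cL) (zmod_morph_comp (linear_zmod jL) (linear_zmod tL))) => p y.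
rewrite (homog_proj n (Qj_homog y)).
have [E|np] := eqVneq n p; first by subst p; rewrite QthK.
by rewrite Qth_ne // (linear_at0 jL).
Qed.

(** The components of x - y are the images under [Qj] of its coordinates, hence vanish, and the
    counit axiom recovers an element from its components. *)
Lemma QC_ext (x y : QC_ob M) : (forall n, Qth n x = Qth n y) -> x = y.
Proof.
have HF := QC_comodule.
have cE n z : hproj n z = Qj (Qth n z).
  have zh := homog_component HF n z; rewrite [LHS](QC_homog zh); congr Qj.
  have cB := linear_zmod (hproj_linear HF n); have tB := linear_zmod (Qth_linear n).
  clear zh; move: z; apply: (QC_eq (zmod_morph_comp tB cB) tB) => p y'.
  rewrite (homog_proj n (Qj_homog y')).
  by have [//|np] := eqVneq n p; rewrite Qth_ne // (zmod_morph0 tB).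
move=> xy; apply/eqP; rewrite -subr_eq0; apply/eqP; set z := x - y.
have z0 n : hproj n z = 0.
  by rewrite cE (linear_zmod (Qth_linear n)) xy subrr (zmod_morph0 (@Qj_zmod n)).
have [_ _ cu] := HF; rewrite -[z]cu.
have [eL eE] := bar_act_spec (QC_ob M).
have [s [_ ->]] := btens_decomp (coact z).
rewrite (zmod_morph_sum _ _ _ (linear_zmod eL)) big1 // => -[i n] _.
rewrite eE bar_counit_w; case: i => /=; first by rewrite scale0r.
by rewrite -/(hproj n z) z0 scaler0.
Qed.

Lemma Qth_fin (x : QC_ob M) : exists s : seq nat, forall n, n \notin s -> Qth n x = 0.
Proof.
elim: (Qj_span x) => [|y z _ [s ys] _ [t zt]|_ [n [y ->]]].
- by exists [::] => n _; exact: linear_at0 (Qth_linear n).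
- exists (s ++ t) => n; rewrite mem_cat negb_or => /andP[/ys yn /zt zn].
  by rewrite (linear_atD (Qth_linear n)) yn zn addr0.
- by exists [:: n] => p; rewrite inE; exact: Qth_ne.
Qed.

(** Only finitely many coordinates [Qth n x] are nonzero, so they form an element of the direct sum
    of the M_n, on which the family h is extended. *)
Lemma QC_lift (V : lmodType R) (h : forall n, M n -> V) : (forall n, linear (h n)) ->
  exists f : QC_ob M -> V, linear f /\ forall n (x : M n), f (Qj x) = h n x.
Proof.
move=> hL; have [f [fL fE]] := dsum_lift hL.
exists (fun x => f (DSum (Qth_fin x))); split=> [a x y|n x].
  rewrite -fL; congr f; apply: dsumP => n; rewrite dsum_addE dsum_scaleE.
  exact: Qth_linear.
rewrite -fE; congr f; apply: dsumP => p.
have [E|np] := eqVneq n p; first by subst p; rewrite din_same; exact: QthK.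
by rewrite (din_ne _ np); apply: Qth_ne; rewrite eq_sym.
Qed.

End FunctorObjects.

(** * The equivalence *)

Section EquivalenceCriterion.
Variables (C D : category) (F : functor C D).
Hypothesis F_fun : is_functor F.
Variables (C0 : ob C) (dC : forall X Y : ob C, mor X Y) (dD : forall X Y : ob D, mor X Y).
Hypothesis F_full : forall (X Y : ob C) (g : mor (F X) (F Y)),
  isob X -> isob Y -> ismor g -> exists f, ismor f /\ fmor F f = g.
Hypothesis F_faithful : forall (X Y : ob C) (f f' : mor X Y),
  isob X -> isob Y -> ismor f -> ismor f' -> fmor F f = fmor F f' -> f = f'.
Hypothesis F_surj : forall Y : ob D, isob Y ->
  exists X, isob X /\ exists b : mor (F X) Y, is_iso b.

(** The quasi-inverse has to be defined on all underlying data, also where no object or morphism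
    with the wanted property exists; it takes a default value there. *)
Let pick_from (T : Type) (x0 : T) (P : T -> Prop) : T :=
  if pselect (exists x, P x) is left e then projT1 (cid e) else x0.

Let pickP (T : Type) (x0 : T) (P : T -> Prop) : (exists x, P x) -> P (pick_from x0 P).
Proof. by rewrite /pick_from; case: pselect => // e _; case: cid. Qed.

Let gob (Y : ob D) : ob C := pick_from C0 (fun X => isob X /\ exists b : mor (F X) Y, is_iso b).
Let gb Y : mor (F (gob Y)) Y := pick_from (dD _ _) (@is_iso D _ _).
Let gbi Y : mor Y (F (gob Y)) :=
  pick_from (dD _ _) (fun g => [/\ ismor g, g \oc gb Y = idm _ & gb Y \oc g = idm _]).
Let gmor Y Y' (f : mor Y Y') : mor (gob Y) (gob Y') :=
  pick_from (dC _ _) (fun g => ismor g /\ fmor F g = gbi Y' \oc (f \oc gb Y)).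
Let G : functor D C := @Functor D C gob gmor.
Let ga X : mor X (gob (F X)) :=
  pick_from (dC _ _) (fun g => ismor g /\ fmor F g = gbi (F X)).

Let F_ob X : isob X -> isob (F X). Proof. by case: F_fun => H _ _ _; exact: H. Qed.
Let F_mor X Y (f : mor X Y) : isob X -> isob Y -> ismor f -> ismor (fmor F f).
Proof. by case: F_fun => _ H _ _; exact: H. Qed.
Let F_id X : isob X -> fmor F (idm X) = idm (F X).
Proof. by case: F_fun => _ _ H _; exact: H. Qed.
Let F_comp X Y Z (g : mor Y Z) (f : mor X Y) : isob X -> isob Y -> isob Z ->
  ismor g -> ismor f -> fmor F (g \oc f) = fmor F g \oc fmor F f.
Proof. by case: F_fun => _ _ _ H; exact: H. Qed.

Let gobP Y : isob Y -> isob (gob Y) /\ is_iso (gb Y).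
Proof. by move=> /F_surj /(pickP C0)[gY /(pickP (dD _ _))]. Qed.
Let gob_ob Y : isob Y -> isob (gob Y). Proof. by case/gobP. Qed.
Let gb_mor Y : isob Y -> ismor (gb Y). Proof. by case/gobP => _ []. Qed.
Let gbiP Y : isob Y -> [/\ ismor (gbi Y), gbi Y \oc gb Y = idm _ & gb Y \oc gbi Y = idm _].
Proof. by case/gobP => _ [_ /(pickP (dD _ _))]. Qed.

Let gmorP Y Y' (f : mor Y Y') : isob Y -> isob Y' -> ismor f ->
  ismor (gmor f) /\ fmor F (gmor f) = gbi Y' \oc (f \oc gb Y).
Proof.
move=> oY oY' mf; have [mi _ _] := gbiP oY'; have mb := gb_mor oY.
have oG := gob_ob oY; have oG' := gob_ob oY'.
have ex : exists g, ismor g /\ fmor F g = gbi Y' \oc (f \oc gb Y).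
  apply: F_full => //; apply: ismor_comp => //; try exact: F_ob.
  by apply: ismor_comp => //; exact: F_ob.
exact: (pickP (dC _ _) ex).
Qed.

Let gaP X : isob X -> ismor (ga X) /\ fmor F (ga X) = gbi (F X).
Proof.
move=> oX; have [mi _ _] := gbiP (F_ob oX).
have ex : exists g, ismor g /\ fmor F g = gbi (F X).
  by apply: F_full => //; exact: gob_ob (F_ob oX).
exact: (pickP (dC _ _) ex).
Qed.

Let F_mono X Y (f : mor X Y) (g : mor Y X) : isob X -> isob Y -> ismor f -> ismor g ->
  fmor F g \oc fmor F f = idm _ -> g \oc f = idm _.
Proof.
move=> oX oY mf mg gf; apply: F_faithful => //.
- exact: ismor_comp.
- exact: ismor_id.
- by rewrite F_comp // F_id.
Qed.

Lemma equivalence_criterion : is_equivalence F.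
Proof.
split=> //; exists G; split.
- split.
  + exact: gob_ob.
  + by move=> X Y f oX oY mf; have [] := gmorP oX oY mf.
  + move=> X oX; have [mg gE] := gmorP oX oX (ismor_id oX).
    have [_ bi _] := gbiP oX; have oG := gob_ob oX.
    apply: F_faithful => //; first exact: ismor_id.
    by rewrite gE comp_idl bi F_id.
  + move=> X Y Z g f oX oY oZ mg mf.
    have [m1 E1] := gmorP oX oY mf; have [m2 E2] := gmorP oY oZ mg.
    have mgf := ismor_comp oX oY oZ mg mf; have [m3 E3] := gmorP oX oZ mgf.
    have [oGX [oGY oGZ]] := (gob_ob oX, (gob_ob oY, gob_ob oZ)).
    apply: F_faithful => //; first exact: (ismor_comp oGX oGY oGZ).
    have [_ _ bi] := gbiP oY.
    rewrite F_comp // E1 E2 E3 -!Defs.compA; congr (_ \oc (_ \oc _)).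
    by rewrite !Defs.compA bi comp_idl.
- exists ga; split=> [X oX|X Y f oX oY mf].
    have [ma aE] := gaP oX; have oF := F_ob oX; have oG := gob_ob oF.
    have [mi bi ib] := gbiP oF.
    have [h [mh hE]] := F_full oG oX (gb_mor oF).
    by split=> //; exists h; split=> //; apply: F_mono; rewrite // aE hE.
  have [oFX oFY] := (F_ob oX, F_ob oY); have mF := F_mor oX oY mf.
  have [mX aX] := gaP oX; have [mY aY] := gaP oY; have [mG gE] := gmorP oFX oFY mF.
  have [oGX oGY] := (gob_ob oFX, gob_ob oFY); have [_ _ ib] := gbiP oFX.
  apply: F_faithful => //.
  + exact: (ismor_comp oX oY oGY).
  + exact: (ismor_comp oX oGX oGY).
  + by rewrite !F_comp // aX aY gE -!Defs.compA ib comp_idr.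
- exists gb; split=> [X oX|X Y f oX oY mf]; first by have [] := gobP oX.
  have [_ gE] := gmorP oX oY mf; have [_ _ bi] := gbiP oY.
  by rewrite /= gE Defs.compA bi comp_idl.
Qed.

End EquivalenceCriterion.

(** * Bijective comodule maps *)

Section ComoduleIso.
Variables (k : comPzRingType) (R : kalgebra k).
Implicit Types X Y : comodule R.

Lemma comodule_map_comp_n X Y (f : X -> Y) n x :
  is_comodule X -> is_comodule Y -> is_comodule_map f -> hproj n (f x) = f (hproj n x).
Proof.
move=> HX HY Hf; have fB := linear_zmod Hf.1.
have cX := linear_zmod (hproj_linear HX n); have cY := linear_zmod (hproj_linear HY n).
apply: (aspan_eq (zmod_morph_comp cY fB) (zmod_morph_comp fB cX)) (comodule_span HX x).
move=> y [m [dy hy]]; rewrite (homog_proj n hy) (homog_proj n (comodule_map_homog Hf hy)).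
by case: eqP => // _; rewrite (zmod_morph0 fB).
Qed.

(** The inverse preserves degrees because f is injective and commutes with the projections, and it
    preserves differentials because these are determined by the element. *)
Lemma comodule_bij_iso X Y (f : X -> Y) :
    is_comodule X -> is_comodule Y -> is_comodule_map f ->
    injective f -> (forall y, exists x, f x = y) ->
  @is_iso (comodule_category R) X Y f.
Proof.
move=> HX HY Hf fI fS; split=> //.
pose g y := projT1 (cid (fS y)).
have fg y : f (g y) = y by rewrite /g; case: cid.
have gf x : g (f x) = x by apply: fI; rewrite fg.
exists g; split; [|by apply/funext => x; exact: gf|by apply/funext => y; exact: fg].
have [fL _] := Hf.
apply: comodule_mapP => // [a x y|n y dy hy]; first by apply: fI; rewrite fg fL !fg.
have hx : homog n (g y) (hdiff n (g y)).
  apply/(homogP HX)/fI.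
  by rewrite -comodule_map_comp_n // fg (homog_proj n hy) eqxx.
have := comodule_map_homog Hf hx; rewrite fg => hy'.
by have := congr1 g (homog_uniq hy' hy); rewrite gf => <-.
Qed.

End ComoduleIso.

(** * Functoriality, faithfulness and fullness *)

Section FunctorQC.
Variables (k : comPzRingType) (R : kalgebra k).

Section Map.
Variables (M N : complex R) (f : forall n, M n -> N n).
Hypotheses (HM : is_complex M) (HN : is_complex N) (Hf : is_chain_map f).

Lemma QC_map_spec : linear (QC_map f : QC_ob M -> QC_ob N) /\
  forall n (x : M n), QC_map f (Qj x) = Qj (f x) :> QC_ob N.
Proof.
have [fL fd] := Hf.
pose tot (m : ctot M) : ctot N := extend (fun p : {n & M n} => din (tagged p) : ctot M)
  (fun p => din (f (tagged p)) : ctot N) m.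
have dL n := @din_linear R _ N n.
have [n|g [gL gE]] := @dsum_lift R _ M (ctot N) (fun n x => din (f x)).
  exact: linear_comp (dL n) (fL n).
have tE m : tot m = g m.
  apply: extend_eq => [|[n q]|y]; first exact: linear_zmod.
    exact: gE.
  apply: aspan_bind (dsum_span y) => _ [n [q ->]].
  by apply: aspan_gen; exists (existT _ n q).
have gn m n : (g m : dsum N) n = f ((m : dsum M) n).
  pose pN (m : ctot N) := (m : dsum N) n; pose pM (m : ctot M) := f ((m : dsum M) n).
  apply: (dsum_eq (f := fun m => pN (g m)) (g := pM)) m => [||i v].
  - exact: (zmod_morph_comp (linear_zmod (@dsum_proj_linear _ _ N n)) (linear_zmod gL)).
  - exact: (zmod_morph_comp (linear_zmod (fL n)) (linear_zmod (@dsum_proj_linear _ _ M n))).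
  rewrite /pN /pM gE; have [E|ne] := eqVneq i n; first by subst i; rewrite !din_same.
  by rewrite !(din_ne _ ne) (linear_at0 (fL n)).
(* Makes q (x) m |-> q (x) f m balanced over C; on u_n this is the chain map condition. *)
have Cg c m : ctot_Cact c (g m) = g (ctot_Cact c m).
  apply: (Cring_eq (@ctot_Cact_zmodl k R N (g m)) (zmod_morph_comp (linear_zmod gL)
    (@ctot_Cact_zmodl k R M m))) c => s.
  rewrite !ctot_Cact_gen //; case: s => r n; rewrite gn gE.
    by rewrite (linear_scale (fL n)).
  by rewrite -fd (linear_scale (fL n)).
have [||| qL qE] := @tlift_linear R (Cring R) (Qtot R) (ctot M) (@Qtot_Cact k R) (@ctot_Cact R M)
  (QC_ob N) (fun q m => tmk (@Qtot_Cact k R) (@ctot_Cact R N) q (tot m)).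
- by move=> q x y; rewrite !tE (linear_zmod gL) tmkBr.
- by move=> m a x y; rewrite tmkDl tmkZ.
- by move=> q c m; rewrite !tE tmk_bal Cg.
split=> [|n x]; first exact: qL.
by rewrite /Qj [LHS]qE tE gE.
Qed.

Lemma QC_map_linear : linear (QC_map f : QC_ob M -> QC_ob N).
Proof. exact: QC_map_spec.1. Qed.
Lemma QC_mapE n (x : M n) : QC_map f (Qj x) = Qj (f x) :> QC_ob N.
Proof. exact: QC_map_spec.2. Qed.

Lemma QC_map_comodule : is_comodule_map (QC_map f : QC_ob M -> QC_ob N).
Proof.
apply: comodule_map_gen; try exact: QC_coact_linear; first exact: QC_map_linear.
move=> x; apply: aspan_bind (Qj_span x) => _ [n [y ->]].
apply: aspan_gen; exists n, (Qjd y); split; first exact: Qj_homog.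
rewrite QC_mapE (_ : QC_map f (Qjd y) = Qjd (f y)); first exact: Qj_homog.
case: n y => [|n] y; first exact: (linear_at0 QC_map_linear).
by rewrite /Qjd QC_mapE Hf.2.
Qed.

End Map.

Lemma QC_functorP : is_functor (QC_functor R).
Proof.
split=> /=.
- by move=> M; exact: QC_comodule.
- by move=> M N f HM HN Hf; exact: QC_map_comodule.
- move=> M HM; have Hid := chain_map_id HM.
  have E : forall x : QC_ob M, QC_map (@chain_idm _ M) x = x :> QC_ob M.
    have gB : zmod_morphism (fun x : QC_ob M => x) by [].
    pose lB := linear_zmod (QC_map_linear Hid).
    by refine (QC_eq (V := coob (QC_ob M)) lB gB _) => n y; rewrite QC_mapE.
  exact: (funext E).
- move=> M N P g f HM HN HP Hg Hf; have Hgf := chain_map_comp HM HN HP Hg Hf.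
  have E : forall x : QC_ob M, QC_map (chain_comp g f) x = QC_map g (QC_map f x : QC_ob N) :>
    QC_ob P.
    apply: (QC_eq (linear_zmod (QC_map_linear Hgf)) (zmod_morph_comp
      (linear_zmod (QC_map_linear Hg)) (linear_zmod (QC_map_linear Hf)))) => n y.
    by rewrite !QC_mapE.
  exact: (funext E).
Qed.

Lemma QC_faithful (M N : complex R) (f f' : forall n, M n -> N n) :
  is_complex M -> is_complex N -> is_chain_map f -> is_chain_map f' ->
  QC_map f = QC_map f' :> (QC_ob M -> QC_ob N) -> f = f'.
Proof.
move=> HM HN Hf Hf' ff'; apply: functional_extensionality_dep => n; apply/funext => x.
by rewrite -[LHS](QthK HN) -QC_mapE // ff' QC_mapE // QthK.
Qed.

(** A comodule map preserves degrees, so it maps alpha_n (x) M_n to alpha_n (x) N_n; the maps M_n ->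
    N_n so obtained commute with d because a homogeneous element determines its differential. *)
Lemma QC_full (M N : complex R) (g : QC_ob M -> QC_ob N) :
  is_complex M -> is_complex N -> is_comodule_map g ->
  exists f : forall n, M n -> N n, is_chain_map f /\ QC_map f = g.
Proof.
move=> HM HN Hg; pose f n (x : M n) := Qth n (g (Qj x)).
have [gL _] := Hg.
have fE n (x : M n) : g (Qj x) = Qj (f n x).
  exact: (QC_homog HN (comodule_map_homog Hg (Qj_homog HM x))).
have Hf : is_chain_map f.
  split=> [n|n x]; first exact: (linear_comp (Qth_linear HN n)
    (linear_comp gL (@Qj_linear _ _ _ n))).
  have h1 := comodule_map_homog Hg (Qj_homog HM x); rewrite fE in h1.
  have := homog_uniq h1 (Qj_homog HN (f n.+1 x)).
  by rewrite /Qjd fE => /(congr1 (@Qth k R N n)); rewrite !QthK.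
exists f; split=> //; apply/funext => x.
apply: (QC_eq (linear_zmod (QC_map_linear Hf)) (linear_zmod gL)) => n y.
by rewrite QC_mapE // fE.
Qed.

End FunctorQC.

(** * The complex of homogeneous components of a comodule *)

Section ComplexOfComodule.
Variables (k : comPzRingType) (R : kalgebra k).
Variable X : comodule R.
Hypothesis HX : is_comodule X.

(** The coaction of dx has the single term y^n (x) dx, so its own differential is 0. This is the
    source of d d = 0 in [hcomplex]. *)
Lemma homog_d n (x dx : X) : homog n.+1 x dx -> homog n dx 0.
Proof.
by move=> [_ cdx _]; have h0 := homog0 0 (coact_linear HX); split=> //;
   rewrite ?cdx ?(zmod_morph0 (coact_zmod HX)) ?tmk0r ?addr0.
Qed.

Definition hpred n : {pred X} := fun x => hproj n x == x.
(** The proof [H] is a parameter so that the module structure can be attached to the type: the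
    homogeneous elements form a submodule because the projection is linear, which comes from the
    comodule axioms. *)
Record hpart (H : is_comodule X) (n : nat) := HPart { hval :> X; hvalP : hval \in hpred n }.

HB.instance Definition _ n := [isSub for @hval HX n].
HB.instance Definition _ n := [Choice of hpart HX n by <:].

Fact hpart_closed n : GRing.subsemimod_closed (hpred n).
Proof.
have pL := hproj_linear HX n.
split=> [|a z]; last by move=> /eqP zE; apply/eqP; rewrite (linear_scale pL) zE.
split=> [|x y /eqP xE /eqP yE]; apply/eqP; first exact: linear_at0 pL.
by rewrite (linear_atD pL) xE yE.
Qed.

HB.instance Definition _ n :=
  GRing.SubChoice_isSubLmodule.Build R X (hpred n) (hpart HX n) (hpart_closed n).

Lemma hval_homog n (x : hpart HX n) : homog n (hval x) (hdiff n (hval x)).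
Proof. by apply/(homogP HX)/eqP; exact: hvalP. Qed.

Lemma hval_linear n : linear (fun x : hpart HX n => hval x).
Proof. by move=> a x y; rewrite -![hval _]/(val _) Algebra.valD linearZ. Qed.

Fact hpart_diff_subproof n (x : hpart HX n.+1) : hdiff n.+1 (hval x) \in hpred n.
Proof.
by apply/eqP; rewrite (homog_proj n (homog_d (hval_homog x))) eqxx.
Qed.
Definition hpart_diff n (x : hpart HX n.+1) : hpart HX n := HPart HX (hpart_diff_subproof x).

Definition hcomplex : complex R := @Complex R (fun n => hpart HX n : lmodType R) hpart_diff.

Lemma hcomplexP : is_complex hcomplex.
Proof.
split=> [n a x y|n x]; apply: val_inj.
  by rewrite -[LHS]/(hdiff n.+1 (hval (a *: x + y))) hval_linear hdiff_linear // -[RHS]/(hval _)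
    hval_linear.
rewrite -[LHS]/(hdiff n.+1 (hdiff n.+2 (hval x))) (homog_diff n.+1 (homog_d (hval_homog x))).
by rewrite eqxx; exact: esym (linear_at0 (@hval_linear n)).
Qed.

(** The map is alpha_n (x) v |-> v. It is injective since it carries the coordinates [Qth n] to the
    projections [hproj n], and onto since the homogeneous elements span X. *)
Lemma hcomplex_iso : exists b : QC_ob hcomplex -> X, @is_iso (comodule_category R) _ _ b.
Proof.
have HM := hcomplexP.
have [b [bL bE]] := QC_lift HM (h := fun n (x : hcomplex n) => hval x) hval_linear.
have HF := QC_comodule HM.
have Hb : is_comodule_map (b : QC_ob hcomplex -> X).
  apply: comodule_map_gen => //; [exact: QC_coact_linear|exact: coact_linear HX|].
  move=> x; apply: aspan_bind (Qj_span x) => _ [n [y ->]].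
  apply: aspan_gen; exists n, (Qjd y); split; first exact: Qj_homog.
  rewrite bE; have := hval_homog y; congr homog.
  by case: n y => [|n] y; [rewrite (linear_at0 bL)|rewrite /Qjd bE].
have bB := linear_zmod bL.
exists b; apply: comodule_bij_iso => //.
  move=> x y xy; apply: QC_ext => // n; apply: val_inj.
  have key (z : QC_ob hcomplex) : hval (Qth n z : hpart HX n) = hproj n (b z).
    have tB := linear_zmod (Qth_linear HM n); have pB := linear_zmod (hproj_linear HX n).
    apply: (QC_eq (zmod_morph_comp (linear_zmod (@hval_linear n)) tB)
      (zmod_morph_comp pB bB)) z => m v.
    rewrite bE (homog_proj n (hval_homog v)).
    by have [E|nm] := eqVneq n m; [subst m; rewrite QthK|rewrite Qth_ne].
  by rewrite /= !key xy.
move=> y; elim: (comodule_span HX y) => [|_ _ _ [u <-] _ [v <-]|z [n [dz hz]]].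
- by exists 0; exact: zmod_morph0.
- by exists (u + v); exact: zmod_morphD.
have zP : z \in hpred n by apply/eqP; rewrite (homog_proj n hz) eqxx.
by exists (Qj (HPart HX zP : hcomplex n)); rewrite bE.
Qed.

End ComplexOfComodule.

Theorem QC_equivalence (k : comPzRingType) (R : kalgebra k) : is_equivalence (QC_functor R).
Proof.
apply: equivalence_criterion.
- exact: QC_functorP.
- exact: complex_unit R.
- by move=> M N n _; exact: 0.
- by move=> X Y _; exact: 0.
- by move=> M N g HM HN; exact: QC_full.
- by move=> M N f f' HM HN Hf Hf'; exact: QC_faithful.
- by move=> X HX; exists (hcomplex HX); split; [exact: hcomplexP|exact: hcomplex_iso].
Qed.

(** * Tensor products of comodules and of complexes *)

Section BarProduct.
Variables (k : comPzRingType) (R : kalgebra k).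
Hypothesis Rc : forall x y : R, x * y = y * x.
Local Notation Lb := (cbar_bimod R).
Local Notation bw := (bw R).
Local Notation bz := (bz R).

Local Notation "l \oy x" := (tmk (@bract _ _ Lb) (@GRing.scale _ _) (l : Lb) x)
  (at level 40, left associativity).

Lemma cio_central r s (x : coend R) : cio r s * x = x * cio r s.
Proof.
elim/coend_ind: x => [x y IHx IHy|x y IHx IHy|a b||].
- by rewrite mulrDr mulrDl IHx IHy.
- by rewrite mulrA IHx -mulrA IHy mulrA.
- by rewrite !cioM [r * a]Rc [s * b]Rc.
- by rewrite cX_cio.
- by rewrite cY_cio.
Qed.

Lemma bract_comm (l : Lb) s : bract l s = s *: l.
Proof.
elim/cbar_ind: l => x; rewrite /= cbar_ractE -bprojZ.
by rewrite /coend_ract [s *: x]cio_central cio_central bproj_ideal.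
Qed.

Lemma bproj_cio r s (x : coend R) : bproj (cio r s * x) = (r * s) *: bproj x.
Proof.
have -> : cio r s = cio r 1 * cio 1 s :> coend R by rewrite cioM mulr1 mulr1.
rewrite -mulrA -[cio r 1 * _]/(r *: _ : coend R) bprojZ -scalerA; congr (_ *: _).
by rewrite -[cio 1 s * x]/(coend_ract x s) -cbar_ractE; exact: bract_comm.
Qed.

(** For R commutative the image of R^e is central, so multiplication on either side is compatible
    with the left ideal and both nested extensions exist. *)
Lemma bar_mulE (x y : coend R) : bar_mul (bproj x) (bproj y) = bproj (x * y).
Proof.
have inner (x' y' : coend R) : extend (@bproj k R) (fun y => bproj (x' * y)) (bproj y') = bproj
  (x' * y').
  apply: (proj2 (@extend_bproj k R _ (fun y => bproj (x' * y)) _ _)) => [a b|r s i n].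
    by rewrite mulrBr bproj_zmod.
  by rewrite mulrA -cio_central -mulrA bproj_cio.
rewrite -inner; apply: (proj2 (@extend_bproj k R _ (fun x =>
  extend (@bproj k R) (fun y => bproj (x * y)) (bproj y)) _ _)) => [a b|r s i n].
  by rewrite !inner mulrBl bproj_zmod.
by rewrite !inner -mulrA bproj_cio.
Qed.

Lemma bar_mul_linearl (v : Lb) : linear (fun u : Lb => bar_mul u v : Lb).
Proof.
move=> a x y; elim/cbar_ind: v => v; elim/cbar_ind: x => x; elim/cbar_ind: y => y.
rewrite -bprojZ -bprojD !bar_mulE -bprojZ -bprojD mulrDl; congr (bproj (_ + _)).
exact: esym (mulrA _ _ _).
Qed.

Lemma bar_mul_linearr (u : Lb) : linear (bar_mul u : Lb -> Lb).
Proof.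
move=> a x y; elim/cbar_ind: u => u; elim/cbar_ind: x => x; elim/cbar_ind: y => y.
rewrite -bprojZ -bprojD !bar_mulE -bprojZ -bprojD mulrDr; congr (bproj (_ + _)).
by rewrite mulrA -cio_central -mulrA.
Qed.

Lemma cYn_cX n : cY R ^+ n * cX R = (-1) ^+ n * (cX R * cY R ^+ n).
Proof.
elim: n => [|n IHn]; first by rewrite !expr0 mulr1 !mul1r.
rewrite exprS -mulrA IHn [(-1) ^+ n.+1]exprS -[RHS]mulrA mulN1r.
have -> : cY R * ((-1) ^+ n * (cX R * cY R ^+ n)) = (-1) ^+ n * (cY R * (cX R * cY R ^+ n)).
  by rewrite !mulrA; congr (_ * _ * _); exact: commr_sign.
by rewrite -mulrN; congr (_ * _); rewrite !mulrA cXY mulNr opprK.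
Qed.

Lemma bar_mul_FF n m : bar_mul (bw false n) (bw false m) = bw false (n + m).
Proof.
by rewrite -[RHS]/(bproj (cw R false (n + m))) bar_mulE /cw !expr0 !mul1r -exprD.
Qed.

(** For n = 0 the product is 0 while [bz m] is not in general. In coactions [bz 0] only occurs next
    to the differential of an element of degree 0, which is 0. *)
Lemma bar_mul_zF n m : (0 < n)%N -> bar_mul (bz n) (bw false m) = bz (n + m).
Proof.
case: n => // n _; rewrite -[RHS]/(bproj (cw R true (n + m))) bar_mulE /cw.
by rewrite expr0 expr1 mul1r -mulrA -exprD.
Qed.

Lemma bproj_sign n (x : coend R) : bproj ((-1) ^+ n * x) = (-1) ^+ n *: bproj x :> Lb.
Proof.
have -> : (-1) ^+ n = cio ((-1) ^+ n) 1 :> coend R.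
  elim: n => [|n IHn]; first by rewrite !expr0 cio1.
  rewrite !exprS IHn !mulN1r.
  by rewrite (zmod_morphN (cio_zmodl 1)).
by rewrite bproj_cio mulr1.
Qed.

Lemma bar_mul_Fz n m : (0 < m)%N ->
  bar_mul (bw false n) (bz m) = (-1) ^+ n *: bz (n + m).
Proof.
case: m => // m _; rewrite addnS -[bz (n + m).+1]/(bproj (cw R true (n + m))).
rewrite bar_mulE -bproj_sign /cw expr0 expr1 mul1r.
by rewrite mulrA cYn_cX -!mulrA -exprD.
Qed.

Lemma bar_mul_zz n m : bar_mul (bz n) (bz m) = 0.
Proof.
case: n => [|n]; first exact: (linear_at0 (bar_mul_linearl _)).
case: m => [|m]; first exact: (linear_at0 (bar_mul_linearr _)).
rewrite bar_mulE /cw expr1 -mulrA [cY R ^+ n * _]mulrA cYn_cX -mulrA.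
rewrite !mulrA.
have -> : cX R * (-1) ^+ n = (-1) ^+ n * cX R by exact: commr_sign.
rewrite -[_ * cX R * cX R]mulrA cXX mulr0 !mul0r.
exact: zmod_morph0 (@bproj_zmod k R).
Qed.

Lemma oyZ (X : lmodType R) (l : Lb) a (x : X) : l \oy (a *: x) = a *: (l \oy x).
Proof. by rewrite -tmk_bal bract_comm tmkZ. Qed.

(** As r (x) 1^o is central, the counit of l (r (x) 1^o) is r times that of l, and the counit axiom
    concludes. So the product of comodules is the usual tensor product over R. *)
Lemma comodule_ractE (X : comodule R) (x : X) r : is_comodule X -> comodule_ract x r = r *: x.
Proof.
move=> HX; have [_ _ cu] := HX; rewrite -{2}[x]cu.
have [eL eE] := bar_act_spec X.
have [bL bE] := bar_counit_linear R.
pose h (l : Lb) (y : X) := bar_counit (bar_mul l (bproj (cio r 1))) *: y.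
have hE l y : h l y = r *: (bar_counit l *: y).
  elim/cbar_ind: l => l; rewrite /h bar_mulE -cio_central bproj_cio mulr1 (linear_scale bL).
  by rewrite scalerA.
have bZ t (l : Lb) : bar_counit (t *: l) = t * bar_counit l by exact: (linear_scale bL t l).
have bD := linear_atD bL.
have [l u v|u a l l'|l t u|hL hE'] := @tlift_linear _ _ Lb X (@bract _ _ Lb) (@GRing.scale _ X) X h.
- by rewrite !hE !scalerBr.
- by rewrite !hE [bar_counit _]bD bZ scalerDl scalerDr !scalerA !mulrA [r * a]Rc.
- rewrite !hE bract_comm bZ.
  by rewrite [t * _]Rc -scalerA.
apply: (tens_eq (linear_zmod hL) (linear_zmod (linear_comp (scale_linear Rc r) eL))) => l y.
by rewrite hE' eE hE.
Qed.

End BarProduct.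

(** * The product of comodules on homogeneous elements *)

Section ComoduleTensor.
Variables (k : comPzRingType) (R : kalgebra k).
Hypothesis Rc : forall x y : R, x * y = y * x.
Local Notation Lb := (cbar_bimod R).
Local Notation bw := (bw R).
Local Notation bz := (bz R).
Implicit Types X Y Z : comodule R.

Local Notation "l \oy x" := (tmk (@bract _ _ Lb) (@GRing.scale _ _) (l : Lb) x)
  (at level 40, left associativity).

Definition cox X Y (x : X) (y : Y) : comodule_tens X Y :=
  tmk (@comodule_ract k R X) (@GRing.scale R Y) x y.
Local Notation "x \ox y" := (cox x y) (at level 40, left associativity).

Section Bilinear.
Variables X Y : comodule R.
Hypothesis HX : is_comodule X.

Lemma cox_linearl (y : Y) : linear (fun x : X => x \ox y).
Proof. by move=> a u v; rewrite /cox tmkDl tmkZ. Qed.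

Lemma cox_zmodr (x : X) : zmod_morphism (fun y : Y => x \ox y).
Proof. exact: tmkBr. Qed.

Lemma cox_linearr (x : X) : linear (fun y : Y => x \ox y).
Proof.
apply: linearI => [|a y]; first exact: cox_zmodr.
by rewrite /cox -tmk_bal comodule_ractE // tmkZ.
Qed.

Lemma cox_span (z : comodule_tens X Y) : aspan (fun z => exists x y, z = x \ox y) z.
Proof. exact: tens_span. Qed.

Lemma cox_eq (V : zmodType) (f g : comodule_tens X Y -> V) :
    zmod_morphism f -> zmod_morphism g -> (forall x y, f (x \ox y) = g (x \ox y)) ->
  forall z, f z = g z.
Proof. exact: tens_eq. Qed.

Lemma cox_lift (V : lmodType R) (h : X -> Y -> V) :
    (forall x, linear (h x)) -> (forall y, linear (h^~ y)) ->
  linear (tlift h : comodule_tens X Y -> V) /\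
  forall x y, (tlift h : comodule_tens X Y -> V) (x \ox y) = h x y.
Proof.
move=> hr hl; apply: tlift_linear => // [x|x t y]; first exact: linear_zmod.
by rewrite comodule_ractE // (linear_scale (hl y)) (linear_scale (hr x)).
Qed.

(** Together with [cmul], the product of two coactions taken one argument at a time, so that each
    step is a lift with its own linearity. *)
Definition cmul1 (l : Lb) (x : X) : btens Lb Y -> btens Lb (comodule_tens X Y) :=
  tlift (fun (l' : Lb) (y : Y) => (bar_mul l l' : Lb) \oy (x \ox y)).

Lemma cmul1_spec l x : linear (cmul1 l x) /\
  forall l' y, cmul1 l x (l' \oy y) = (bar_mul l l' : Lb) \oy (x \ox y).
Proof.
apply: tlift_linear => [l' u v|y a l' l''|l' t y].
- by rewrite cox_zmodr tmkBr.
- by rewrite (bar_mul_linearr Rc l) tmkDl tmkZ.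
- rewrite bract_comm // (linear_scale (bar_mul_linearr Rc l)) tmkZ.
  by rewrite (linear_scale (@cox_linearr x)) oyZ.
Qed.

Definition cmul (z : btens Lb X) (z' : btens Lb Y) : btens Lb (comodule_tens X Y) :=
  tlift (fun (l : Lb) (x : X) => cmul1 l x z') z.

Lemma cmul_spec z' : linear (cmul^~ z') /\
  forall l x, cmul (l \oy x) z' = cmul1 l x z'.
Proof.
have mB l x := linear_zmod (cmul1_spec l x).1.
apply: (@tlift_linear _ _ _ _ _ _ _ (fun (l : Lb) (x : X) => cmul1 l x z')) =>
  [l u v|x a l l'|l t x].
- pose g z := cmul1 l u z - cmul1 l v z.
  have gB : zmod_morphism g by move=> a b; rewrite /g !mB !opprD !opprK addrACA.
  apply: (tens_eq (mB _ _) gB) z' => l' y.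
  by rewrite /g !(cmul1_spec _ _).2 (linear_zmod (@cox_linearl y)) tmkBr.
- pose g z := a *: cmul1 l x z + cmul1 l' x z.
  have gB : zmod_morphism g.
    by apply: zmod_morph_add (mB _ _) => b c; rewrite mB scalerBr.
  apply: (tens_eq (mB _ _) gB) z' => l'' y.
  by rewrite /g !(cmul1_spec _ _).2 (bar_mul_linearl Rc l'') tmkDl tmkZ.
apply: (tens_eq (mB _ _) (mB _ _)) z' => l' y.
rewrite !(cmul1_spec _ _).2 bract_comm // (linear_scale (bar_mul_linearl Rc l')) tmkZ.
by rewrite (linear_scale (@cox_linearl y)) oyZ.
Qed.

Lemma cmulE l x l' y : cmul (l \oy x) (l' \oy y) = (bar_mul l l' : Lb) \oy (x \ox y).
Proof. by rewrite (cmul_spec _).2 (cmul1_spec _ _).2. Qed.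

Lemma cmul_zmodl z' : zmod_morphism (cmul^~ z').
Proof. exact: linear_zmod (cmul_spec z').1. Qed.

Lemma cmul_linearr z : linear (cmul z).
Proof.
move=> a u v; pose g z := a *: cmul z u + cmul z v.
have gB : zmod_morphism g.
  by apply: zmod_morph_add (@cmul_zmodl _) => b c; rewrite cmul_zmodl scalerBr.
apply: (tens_eq (@cmul_zmodl _) gB) z => l x.
by rewrite /g !(cmul_spec _).2 (cmul1_spec _ _).1.
Qed.

Hypothesis HY : is_comodule Y.

Lemma comodule_tens_coact : linear (@coact _ _ (comodule_tens X Y)) /\
  forall x y, coact (x \ox y) = cmul (coact x) (coact y).
Proof.
apply: (@cox_lift _ (fun x y => cmul (coact x) (coact y))) => [x|y].
  exact: linear_comp (@cmul_linearr _) (coact_linear HY).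
exact: linear_comp (cmul_spec _).1 (coact_linear HX).
Qed.

(** In the product of the two coactions the term with both [bz n] and [bz m] vanishes, as x^2 = 0 in
    L(A); moving y^n past the generator x in [bz m] yields the sign. *)
Lemma homog_tens n m (x dx : X) (y dy : Y) : homog n x dx -> homog m y dy ->
  homog (n + m) (x \ox y) (dx \ox y + (-1) ^+ n *: (x \ox dy)).
Proof.
have cl z := cmul_zmodl z; have cr z := linear_zmod (@cmul_linearr z).
have [cL cE] := comodule_tens_coact; have cB := linear_zmod cL.
move=> [cx cdx dx0] [cy cdy dy0].
have xl0 v : (0 : X) \ox (v : Y) = 0 by exact: linear_at0 (@cox_linearl v).
have xr0 u : (u : X) \ox (0 : Y) = 0 by exact: zmod_morph0 (cox_zmodr u).
have E1 : (bar_mul (bz n) (bw false m) : Lb) \oy (dx \ox y) = bz (n + m) \oy (dx \ox y).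
  by case: n dx0 {cx cdx} => [->//|n _]; rewrite ?xl0 ?tmk0r // bar_mul_zF.
have E2 : (bar_mul (bw false n) (bz m) : Lb) \oy (x \ox dy)
    = (-1) ^+ n *: (bz (n + m) \oy (x \ox dy)).
  case: m dy0 {cy cdy E1} => [->//|m _]; rewrite ?xr0 ?tmk0r ?scaler0 // bar_mul_Fz //.
  by rewrite tmkZ.
split=> [||/eqP].
- rewrite cE cx cy (zmod_morphD (cl _)) !(zmod_morphD (cr _)) !cmulE bar_mul_FF // bar_mul_zz //.
  by rewrite tmk0l addr0 E1 E2 tmkDr oyZ // -addrA [X in _ + X]addrC.
(* Each of dx (x) y and x (x) dy has a further term, a multiple of [bz (n + m).-1] (x) (dx (x) dy).
   Their signs are (-1)^(n-1) and (-1)^n, so they cancel in the sum. *)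
- have Edx : coact (dx \ox y) = bw false (n + m).-1 \oy (dx \ox y)
      + (bar_mul (bw false n.-1) (bz m) : Lb) \oy (dx \ox dy).
    rewrite cE cdx cy (zmod_morphD (cr _)) !cmulE bar_mul_FF //; congr (_ + _).
    by case: n dx0 {cx cdx E1 E2} => [->//|n _]; rewrite ?xl0 ?tmk0r.
  have Edy : coact (x \ox dy) = bw false (n + m).-1 \oy (x \ox dy)
      + (bar_mul (bz n) (bw false m.-1) : Lb) \oy (dx \ox dy).
    rewrite cE cx cdy (zmod_morphD (cl _)) !cmulE bar_mul_FF //; congr (_ + _).
    by case: m dy0 {cy cdy E1 E2 Edx} => [->//|m _]; rewrite ?xr0 ?tmk0r ?addnS.
  rewrite (zmod_morphD cB) (linear_scale cL) Edx Edy scalerDr tmkDr oyZ // addrACA.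
  rewrite [X in _ + X](_ : _ = 0) ?addr0 //.
  case: n dx0 {cx cdx E1 E2 Edx Edy} => [->//|n _]; first by rewrite xl0 !tmk0r scaler0 addr0.
  case: m dy0 {cy cdy} => [->//|m _]; first by rewrite xr0 !tmk0r scaler0 addr0.
  rewrite bar_mul_Fz // bar_mul_zF // addnS addSn tmkZ -scalerDl exprS mulN1r subrr.
  by rewrite scale0r.
by rewrite addn_eq0 => /andP[/eqP/dx0 -> /eqP/dy0 ->]; rewrite xl0 xr0 scaler0 addr0.
Qed.

End Bilinear.

End ComoduleTensor.

(** * The monoidal category of comodules *)

Section ComoduleMonoidal.
Variables (k : comPzRingType) (R : kalgebra k).
Hypothesis Rc : forall x y : R, x * y = y * x.
Local Notation Lb := (cbar_bimod R).
Local Notation bw := (bw R).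
Local Notation bz := (bz R).
Implicit Types X Y Z W : comodule R.
Local Notation "l \oy x" := (tmk (@bract _ _ Lb) (@GRing.scale _ _) (l : Lb) x)
  (at level 40, left associativity).
Local Notation "x \ox y" := (cox x y) (at level 40, left associativity).

Lemma homog_span2 X Y (z : comodule_tens X Y) : is_comodule X -> is_comodule Y ->
  aspan (fun z => exists n m x dx y dy, [/\ homog n x dx, homog m y dy & z = x \ox y]) z.
Proof.
move=> HX HY; apply: aspan_bind (cox_span z) => _ [x [y ->]].
apply: (aspan_map (f := fun x => x \ox y)) (comodule_span HX x).
  exact: linear_zmod (cox_linearl y).
move=> x' [n [dx hx]]; apply: (aspan_map (f := fun y => x' \ox y)) (comodule_span HY y).
  exact: cox_zmodr.
move=> y' [m [dy hy]]; apply: aspan_gen.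
by exists n, m, x', dx, y', dy.
Qed.

Lemma comodule_tensP X Y : is_comodule X -> is_comodule Y -> is_comodule (comodule_tens X Y).
Proof.
move=> HX HY; apply: comodule_gen; first by case: (comodule_tens_coact Rc HX HY).
move=> z; apply: aspan_bind (homog_span2 z HX HY).
move=> _ [n [m [x [dx [y [dy [hx hy ->]]]]]]]; apply: aspan_gen.
by exists (n + m)%N, (dx \ox y + (-1) ^+ n *: (x \ox dy)); exact: homog_tens.
Qed.

(** Products of homogeneous elements span the product of comodules, and their differentials are
    given by the Leibniz rule of [homog_tens]. *)
Lemma tens_comodule_map X Y Z (f : comodule_tens X Y -> Z) :
    is_comodule X -> is_comodule Y -> is_comodule Z -> linear f ->
    (forall n m x dx y dy, homog n x dx -> homog m y dy ->
      homog (n + m) (f (x \ox y)) (f (dx \ox y) + (-1) ^+ n *: f (x \ox dy))) ->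
  is_comodule_map f.
Proof.
move=> HX HY HZ fL fh; have fB := linear_zmod fL.
apply: comodule_map_gen => //; try exact: coact_linear; first exact: coact_linear
  (comodule_tensP HX HY).
move=> z; apply: aspan_bind (homog_span2 z HX HY).
move=> _ [n [m [x [dx [y [dy [hx hy ->]]]]]]]; apply: aspan_gen.
exists (n + m)%N, (dx \ox y + (-1) ^+ n *: (x \ox dy)).
split; first exact: homog_tens.
by rewrite (zmod_morphD fB) (linear_scale fL); exact: fh.
Qed.

Section Map.
Variables (X X' Y Y' : comodule R) (f : X -> X') (g : Y -> Y').
Hypotheses (HX : is_comodule X) (HX' : is_comodule X') (HY : is_comodule Y) (HY' : is_comodule Y').
Hypotheses (Hf : is_comodule_map f) (Hg : is_comodule_map g).

Lemma comodule_tens_map_spec :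
  linear (comodule_tens_map f g : comodule_tens X Y -> comodule_tens X' Y') /\
  forall x y, comodule_tens_map f g (x \ox y) = f x \ox g y.
Proof.
apply: (@cox_lift _ _ Rc X Y HX _ (fun x y => f x \ox g y)) => [x|y].
  exact: linear_comp (@cox_linearr _ _ Rc X' Y' HX' (f x)) Hg.1.
exact: linear_comp (cox_linearl (g y)) Hf.1.
Qed.

Lemma comodule_tens_map_morph :
  is_comodule_map (comodule_tens_map f g : comodule_tens X Y -> comodule_tens X' Y').
Proof.
have [L E] := comodule_tens_map_spec.
apply: tens_comodule_map => //; first exact: comodule_tensP.
move=> n m x dx y dy hx hy; rewrite !E; apply: homog_tens => //; exact: comodule_map_homog.
Qed.

End Map.

Lemma comodule_unit_coact (r : R) :
  coact (r : comodule_unit R) = bw false 0 \oy (r : R^o).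
Proof.
rewrite -[coact _]/((bproj (cio r 1) : Lb) \oy (1 : R^o)).
have := bproj_cw r 1 false 0; rewrite /cw !expr0 !mulr1 => ->.
by rewrite tmkZ -bw_tmkZ; congr tmk; exact: mulr1.
Qed.

Lemma unit_homog (r : R) : homog 0 (r : comodule_unit R) 0.
Proof.
have c0 : coact (0 : comodule_unit R) = 0 by rewrite [LHS]comodule_unit_coact tmk0r.
by split; rewrite ?c0 ?tmk0r ?addr0 // comodule_unit_coact.
Qed.

Lemma comodule_unitP : is_comodule (comodule_unit R).
Proof.
apply: comodule_gen => [a x y|x].
  rewrite ![coact _]comodule_unit_coact -bw_tmkZ -tmkDr //.
by apply: aspan_gen; exists 0%N, 0; exact: unit_homog.
Qed.

Lemma inverse_iso X Y (f : X -> Y) (g : Y -> X) : is_comodule X -> is_comodule Y ->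
  is_comodule_map f -> cancel f g -> cancel g f -> @is_iso (comodule_category R) X Y f.
Proof.
move=> HX HY Hf fg gf; apply: comodule_bij_iso => //; first exact: can_inj fg.
by move=> y; exists (g y).
Qed.

Section Assoc.
Variables X Y Z : comodule R.
Hypotheses (HX : is_comodule X) (HY : is_comodule Y) (HZ : is_comodule Z).
Let XY := comodule_tens X Y.
Let YZ := comodule_tens Y Z.
Let HXY : is_comodule XY. Proof. exact: comodule_tensP. Qed.
Let HYZ : is_comodule YZ. Proof. exact: comodule_tensP. Qed.

Lemma cox3_span (w : comodule_tens XY Z) :
  aspan (fun w => exists x y z, w = (x \ox y : XY) \ox z) w.
Proof.
apply: aspan_bind (cox_span w) => _ [u [z ->]].
apply: (aspan_map (f := fun u => u \ox z)) (cox_span u).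
  exact: linear_zmod (cox_linearl z).
by move=> _ [x [y ->]]; apply: aspan_gen; exists x, y, z.
Qed.

Lemma cox3_eq (V : zmodType) (f g : comodule_tens XY Z -> V) :
    zmod_morphism f -> zmod_morphism g ->
    (forall x y z, f ((x \ox y : XY) \ox z) = g ((x \ox y : XY) \ox z)) ->
  forall w, f w = g w.
Proof.
by move=> fB gB fg w; apply: (aspan_eq fB gB) (cox3_span w) => _ [x [y [z ->]]].
Qed.

Lemma cox3_lift (V : lmodType R) (h : X -> Y -> Z -> V) :
    (forall x y, linear (h x y)) -> (forall x z, linear (fun y => h x y z)) ->
    (forall y z, linear (fun x => h x y z)) ->
  exists f : comodule_tens XY Z -> V, linear f /\
    forall x y z, f ((x \ox y : XY) \ox z) = h x y z.
Proof.
move=> h3 h2 h1.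
pose g (u : XY) (z : Z) : V := tlift (fun x y => h x y z) u.
have gP z := cox_lift Rc HX (fun x => h2 x z) (fun y => h1 y z).
have gE x y z : g (x \ox y) z = h x y z := (gP z).2 x y.
have [u a z z'|z|fL fE] := @cox_lift _ _ Rc XY Z HXY V g.
- pose g2 u := a *: g u z + g u z'.
  have g2B : zmod_morphism g2.
    apply: zmod_morph_add; last exact: linear_zmod (gP z').1.
    exact: linear_zmod (linear_comp (scale_linear Rc a) (gP z).1).
  apply: (cox_eq (linear_zmod (gP _).1) g2B) u => x y.
  by rewrite /g2 [LHS]gE !gE h3.
- exact: (gP z).1.
by exists (tlift g); split=> // x y z; rewrite fE gE.
Qed.

Lemma comodule_assoc_spec :
  linear (@comodule_assoc k R X Y Z) /\
  forall x y z, comodule_assoc ((x \ox y : XY) \ox z) = x \ox (y \ox z : YZ).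
Proof.
have [x y|x z|y z|f [fL fE]] := @cox3_lift (comodule_tens X YZ)
  (fun x y z => x \ox (y \ox z : YZ)).
- exact: linear_comp (cox_linearr Rc HX x) (cox_linearr Rc HY y).
- exact: linear_comp (cox_linearr Rc HX x) (cox_linearl z).
- exact: cox_linearl.
have E w : comodule_assoc w = f w.
  apply: (extend_eq (linear_zmod fL)) => [[[x y] z]|w']; first exact: fE.
  apply: aspan_bind (cox3_span w') => _ [x [y [z ->]]].
  by apply: aspan_gen; exists (x, y, z).
by split=> [a u v|x y z]; rewrite !E ?fL ?fE.
Qed.

Lemma comodule_assoc_morph : is_comodule_map (@comodule_assoc k R X Y Z).
Proof.
have [aL aE] := comodule_assoc_spec; have aB := linear_zmod aL.
have HX_YZ := comodule_tensP HX HYZ.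
apply: comodule_map_gen => //; try exact: coact_linear; first exact: coact_linear
  (comodule_tensP HXY HZ).
move=> w; apply: aspan_bind (cox_span w) => _ [u [z ->]].
apply: (aspan_map (f := fun u : XY => u \ox z)) (homog_span2 u HX HY).
  exact: linear_zmod (cox_linearl z).
move=> _ [n [m [x [dx [y [dy [hx hy ->]]]]]]].
apply: (aspan_map (f := fun z : Z => (x \ox y : XY) \ox z)) (comodule_span HZ z).
  exact: (cox_zmodr (x \ox y : XY)).
move=> z' [p [dz hz]]; apply: aspan_gen.
have hxy := homog_tens Rc HX HY hx hy; have hyz := homog_tens Rc HY HZ hy hz.
exists (n + m + p)%N; eexists; split; first exact: (homog_tens Rc HXY HZ hxy hz).
(* The differentials on both sides correspond because the sign of dz is (-1)^(n+m) = (-1)^n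
   (-1)^m. *)
rewrite aE; have := homog_tens Rc HX HYZ hx hyz; rewrite addnA; congr homog.
rewrite (zmod_morphD aB) (linear_atD (cox_linearl z')) (zmod_morphD aB).
rewrite !(linear_scale (cox_linearl z')) !(linear_scale aL) !aE.
rewrite (zmod_morphD (cox_zmodr x)) (linear_scale (cox_linearr Rc HX x)).
by rewrite scalerDr scalerA -exprD addrA.
Qed.

Lemma comodule_assoc_iso : @is_iso (comodule_category R) _ _ (@comodule_assoc k R X Y Z).
Proof.
have [aL aE] := comodule_assoc_spec.
have HX_YZ := comodule_tensP HX HYZ; have HXY_Z := comodule_tensP HXY HZ.
pose g x (v : YZ) : comodule_tens XY Z := tlift (fun y z => (x \ox y : XY) \ox z) v.
have gP x : linear (g x) /\ forall y z, g x (y \ox z) = (x \ox y : XY) \ox z.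
  apply: (@cox_lift _ _ Rc Y Z HY _ (fun y z => (x \ox y : XY) \ox z)) => [y|z].
    exact: (@cox_linearr _ _ Rc XY Z HXY (x \ox y)).
  exact: linear_comp (@cox_linearl _ _ XY Z z) (cox_linearr Rc HX x).
have [x|v a x x'|fL fE] := @cox_lift _ _ Rc X YZ HX _ g; first exact: (gP x).1.
  pose g2 v := a *: g x v + g x' v.
  have g2B : zmod_morphism g2.
    apply: zmod_morph_add; last exact: linear_zmod (gP x').1.
    exact: linear_zmod (linear_comp (scale_linear Rc a) (gP x).1).
  apply: (cox_eq (linear_zmod (gP _).1) g2B) v => y z.
  rewrite /g2 !(gP _).2 cox_linearl.
  exact: (@cox_linearl _ _ XY Z z).
apply: (@inverse_iso (comodule_tens XY Z) (comodule_tens X YZ) _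
  (tlift g : comodule_tens X YZ -> comodule_tens XY Z)) => //; first exact: comodule_assoc_morph.
  apply: (cox3_eq (linear_zmod (linear_comp fL aL)) (g := fun x => x)) => // x y z.
  by rewrite aE fE (gP _).2.
move=> w; pose f (w : comodule_tens X YZ) : comodule_tens X YZ :=
  comodule_assoc (tlift g w : comodule_tens XY Z).
have fB : zmod_morphism f by exact: linear_zmod (linear_comp aL fL).
apply: (cox_eq fB (g := fun x => x)) w => // x v.
apply: (cox_eq (zmod_morph_comp fB (cox_zmodr x)) (cox_zmodr x)) v => y z.
by rewrite /f fE (gP _).2 aE.
Qed.

End Assoc.

Section Units.
Variable X : comodule R.
Hypothesis HX : is_comodule X.

Lemma comodule_lunit_spec : linear (@comodule_lunit k R X) /\
  forall (r : R) (x : X), comodule_lunit ((r : comodule_unit R) \ox x) = r *: x.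
Proof.
apply: (@cox_lift _ _ Rc _ X comodule_unitP _ (fun (r : comodule_unit R) x => (r : R) *: x))
  => [r|x]; first exact: scale_linear.
by move=> a r r'; rewrite scalerDl scalerA.
Qed.

Lemma comodule_runit_spec : linear (@comodule_runit k R X) /\
  forall (r : R) (x : X), comodule_runit (x \ox (r : comodule_unit R)) = r *: x.
Proof.
have [x|r|L E] := @cox_lift _ _ Rc X (comodule_unit R) HX X
  (fun x (r : comodule_unit R) => comodule_ract x (r : R)).
- by move=> a r r'; rewrite !comodule_ractE // scalerDl scalerA.
- by move=> a x y; rewrite !comodule_ractE // scale_linear.
by split=> // r x; rewrite [LHS]E comodule_ractE.
Qed.

Lemma comodule_lunit_morph : is_comodule_map (@comodule_lunit k R X).
Proof.
have [L E] := comodule_lunit_spec; have HU := comodule_unitP.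
apply: comodule_map_gen => //; [exact: coact_linear (comodule_tensP HU HX)|exact: coact_linear|].
move=> w; apply: aspan_bind (cox_span w) => _ [r [x ->]].
apply: (aspan_map (f := fun x : X => r \ox x)) (comodule_span HX x); first exact: cox_zmodr.
move=> y [n [dy hy]]; apply: aspan_gen; exists n.
eexists; split; first exact: (homog_tens Rc HU HX (unit_homog r) hy).
rewrite E (linear_atD L) (linear_scale L) !E scale0r add0r scale1r.
exact: homogZ (coact_linear HX) hy.
Qed.

Lemma comodule_runit_morph : is_comodule_map (@comodule_runit k R X).
Proof.
have [L E] := comodule_runit_spec; have HU := comodule_unitP.
apply: comodule_map_gen => //; [exact: coact_linear (comodule_tensP HX HU)|exact: coact_linear|].
move=> w; apply: aspan_bind (cox_span w) => _ [x [r ->]].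
apply: (aspan_map (f := fun x : X => x \ox r)) (comodule_span HX x).
  exact: linear_zmod (cox_linearl r).
move=> y [n [dy hy]]; apply: aspan_gen; exists n.
have := homog_tens Rc HX HU hy (unit_homog r); rewrite addn0 => hyr.
eexists; split; first exact: hyr.
rewrite E (linear_atD L) (linear_scale L) !E scale0r scaler0 addr0.
exact: homogZ (coact_linear HX) hy.
Qed.

Lemma comodule_lunit_iso : @is_iso (comodule_category R) _ _ (@comodule_lunit k R X).
Proof.
have [L E] := comodule_lunit_spec; have HU := comodule_unitP.
apply: (@inverse_iso (comodule_tens (comodule_unit R) X) X _
  (fun x : X => (1 : comodule_unit R) \ox x)) => //.
- exact: comodule_tensP.
- exact: comodule_lunit_morph.
- move=> z; pose f (z : comodule_tens (comodule_unit R) X) : comodule_tens (comodule_unit R) X :=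
    (1 : comodule_unit R) \ox comodule_lunit z.
  have fB : zmod_morphism f by exact: (zmod_morph_comp (cox_zmodr _) (linear_zmod L)).
  apply: (cox_eq fB (g := fun z => z)) z => // r x.
  rewrite /f E (linear_scale (cox_linearr Rc HU _)) -(linear_scale (cox_linearl x)).
  by congr cox; exact: mulr1.
- by move=> x; rewrite E scale1r.
Qed.

Lemma comodule_runit_iso : @is_iso (comodule_category R) _ _ (@comodule_runit k R X).
Proof.
have [L E] := comodule_runit_spec; have HU := comodule_unitP.
apply: (@inverse_iso (comodule_tens X (comodule_unit R)) X _
  (fun x : X => x \ox (1 : comodule_unit R))) => //.
- exact: comodule_tensP.
- exact: comodule_runit_morph.
- move=> z; pose f (z : comodule_tens X (comodule_unit R)) : comodule_tens X (comodule_unit R) :=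
    comodule_runit z \ox (1 : comodule_unit R).
  have fB : zmod_morphism f.
    exact: (zmod_morph_comp (linear_zmod (cox_linearl _)) (linear_zmod L)).
  apply: (cox_eq fB (g := fun z => z)) z => // x r.
  rewrite /f E (linear_scale (cox_linearl _)) -(linear_scale (cox_linearr Rc HX x)).
  by congr cox; exact: mulr1.
- by move=> x; rewrite E scale1r.
Qed.

End Units.

Lemma comodule_monoidal : is_monoidal (comodule_mon_data R).
Proof.
have HU := comodule_unitP; split; [split|split|split| |]; rewrite /=.
- exact: comodule_tensP.
- by move=> X X' Y Y' f g HX HX' HY HY' Hf Hg; exact: comodule_tens_map_morph.
- move=> X Y HX HY; have HiX := comodule_map_id HX; have HiY := comodule_map_id HY.
  have [L E] := comodule_tens_map_spec HX HX HiX HiY.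
  by apply/funext; apply: (cox_eq (linear_zmod L) (g := fun z => z)).
- move=> X X' X'' Y Y' Y'' f' f g' g HX HX' HX'' HY HY' HY'' Hf' Hf Hg' Hg.
  have [L1 E1] := comodule_tens_map_spec HX HX' Hf Hg.
  have [L2 E2] := comodule_tens_map_spec HX' HX'' Hf' Hg'.
  have [L3 E3] := comodule_tens_map_spec HX HX'' (comodule_map_comp HX HX' HX'' Hf' Hf)
    (comodule_map_comp HY HY' HY'' Hg' Hg).
  apply/funext; apply: (cox_eq (linear_zmod L3) (linear_zmod (linear_comp L2 L1))) => x y.
  by rewrite E1 E2 E3.
- exact: comodule_unitP.
- by move=> X Y Z HX HY HZ; exact: comodule_assoc_iso.
- by move=> X HX; exact: comodule_lunit_iso.
- by move=> X HX; exact: comodule_runit_iso.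
- move=> X X' Y Y' Z Z' f g h HX HX' HY HY' HZ HZ' Hf Hg Hh.
  have [Ls Es] := comodule_assoc_spec Z HX HY; have [Lt Et] := comodule_assoc_spec Z' HX' HY'.
  have [HXY HXY'] := (comodule_tensP HX HY, comodule_tensP HX' HY').
  have [HYZ HYZ'] := (comodule_tensP HY HZ, comodule_tensP HY' HZ').
  have Hfg := comodule_tens_map_morph HX HX' HY HY' Hf Hg.
  have Hgh := comodule_tens_map_morph HY HY' HZ HZ' Hg Hh.
  have [L1 E1] := comodule_tens_map_spec HX HX' Hf Hg.
  have [L2 E2] := comodule_tens_map_spec HY HY' Hg Hh.
  have [L3 E3] := comodule_tens_map_spec HXY HXY' Hfg Hh.
  have [L4 E4] := comodule_tens_map_spec HX HX' Hf Hgh.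
  apply/funext; apply: (cox3_eq (linear_zmod (linear_comp Lt L3))
    (linear_zmod (linear_comp L4 Ls))) => x y z.
  by rewrite E3 E1 Et Es E4 E2.
- move=> X Y f HX HY Hf.
  have [L1 E1] := comodule_lunit_spec X; have [L2 E2] := comodule_lunit_spec Y.
  have [L3 E3] := comodule_tens_map_spec HU HU (comodule_map_id HU) Hf.
  apply/funext; apply: (cox_eq (linear_zmod (linear_comp L2 L3))
    (linear_zmod (linear_comp Hf.1 L1))) => r x.
  by rewrite E3 E2 E1 (linear_scale Hf.1).
- move=> X Y f HX HY Hf.
  have [L1 E1] := comodule_runit_spec HX; have [L2 E2] := comodule_runit_spec HY.
  have [L3 E3] := comodule_tens_map_spec HX HY Hf (comodule_map_id HU).
  apply/funext; apply: (cox_eq (linear_zmod (linear_comp L2 L3))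
    (linear_zmod (linear_comp Hf.1 L1))) => x r.
  by rewrite E3 E2 E1 (linear_scale Hf.1).
- move=> X Y Z W HX HY HZ HW.
  have [HXY [HYZ HZW]] := (comodule_tensP HX HY, (comodule_tensP HY HZ, comodule_tensP HZ HW)).
  have [HXY_Z HX_YZ] := (comodule_tensP HXY HZ, comodule_tensP HX HYZ).
  have [HYZ_W HY_ZW] := (comodule_tensP HYZ HW, comodule_tensP HY HZW).
  have [L1 E1] := comodule_assoc_spec (comodule_tens Z W) HX HY.
  have [L2 E2] := comodule_assoc_spec W HXY HZ.
  have [L3 E3] := comodule_assoc_spec W HY HZ.
  have [L4 E4] := comodule_assoc_spec W HX HYZ.
  have [L5 E5] := comodule_assoc_spec Z HX HY.
  have A3 := comodule_assoc_morph HY HZ HW; have A5 := comodule_assoc_morph HX HY HZ.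
  have [L6 E6] := comodule_tens_map_spec HX HX (comodule_map_id HX) A3.
  have [L7 E7] := comodule_tens_map_spec HXY_Z HX_YZ A5 (comodule_map_id HW).
  apply/funext => w.
  pose f w := comodule_assoc (comodule_assoc w : comodule_tens (comodule_tens X Y)
    (comodule_tens Z W)).
  pose g w := comodule_tens_map (@comodule_idm _ _ X) (@comodule_assoc _ _ Y Z W)
    (comodule_assoc (comodule_tens_map (@comodule_assoc _ _ X Y Z) (@comodule_idm _ _ W) w)).
  have fB : zmod_morphism f by exact: linear_zmod (linear_comp L1 L2).
  have gB : zmod_morphism g by exact: linear_zmod (linear_comp L6 (linear_comp L4 L7)).
  apply: (cox_eq fB gB) w => u w.
  have wL := @cox_linearl _ _ (comodule_tens (comodule_tens X Y) Z) W w.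
  apply: (cox3_eq (zmod_morph_comp fB (linear_zmod wL)) (zmod_morph_comp gB (linear_zmod wL))) u
    => x y z.
  by rewrite /f /g E2 E1 E7 E5 E4 E6 E3.
- move=> X Y HX HY.
  have [L1 E1] := comodule_assoc_spec Y HX HU.
  have [L2 E2] := comodule_lunit_spec Y; have [L3 E3] := comodule_runit_spec HX.
  have HXU := comodule_tensP HX HU; have HUY := comodule_tensP HU HY.
  have [L4 E4] := comodule_tens_map_spec HX HX (comodule_map_id HX) (comodule_lunit_morph HY).
  have [L5 E5] := comodule_tens_map_spec HXU HX (comodule_runit_morph HX) (comodule_map_id HY).
  apply/funext; apply: (cox3_eq (linear_zmod (linear_comp L4 L1)) (linear_zmod L5)) => x r y.
  rewrite E1 E4 E5 E2 E3 (linear_scale (cox_linearr Rc HX x)).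
  by rewrite (linear_scale (cox_linearl y)).
Qed.

End ComoduleMonoidal.

(** * Tensor products of complexes *)

Section ChainTensor.
Variable R : pzRingType.
Hypothesis Rc : forall x y : R, x * y = y * x.
Implicit Types M N P : complex R.

Lemma ctmk_linearl M N p q (y : N q) :
  linear (fun x : M p => tmk _ _ x y : ctens M N p q).
Proof. by move=> a u v; rewrite tmkDl tmkZ. Qed.

Lemma ctmk_linearr M N p q (x : M p) :
  linear (fun y : N q => tmk _ _ x y : ctens M N p q).
Proof. by apply: linearI => [|a y]; [exact: tmkBr|rewrite -tmk_bal tmkZ]. Qed.

Lemma cmk_linearl M N n p q (e : (p + q == n)%N) (y : N q) :
  linear (fun x : M p => cmk e x y).
Proof. by move=> a u v; rewrite /cmk ctmk_linearl; exact: din_linear. Qed.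

Lemma cmk_linearr M N n p q (e : (p + q == n)%N) (x : M p) :
  linear (fun y : N q => cmk e x y).
Proof. by move=> a u v; rewrite /cmk ctmk_linearr; exact: din_linear. Qed.

Lemma cmk_irr M N n p q (e e' : (p + q == n)%N) (x : M p) (y : N q) : cmk e x y = cmk e' x y.
Proof. by rewrite (bool_irrelevance e e'). Qed.

Definition is_cmk M N n (z : ctens_ob M N n) : Prop :=
  exists p q (e : (p + q == n)%N) (x : M p) (y : N q), z = cmk e x y.

Lemma cmk_span M N n (z : ctens_ob M N n) : aspan (@is_cmk M N n) z.
Proof.
apply: aspan_bind (dsum_span z) => _ [[[p q] e] [v ->]].
have dB := linear_zmod (@din_linear R _ (fun i : bideg n => ctens M N (val i).1 (val i).2)
  (exist _ (p, q) e)).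
apply: (aspan_map dB) (tens_span v) => _ [x [y ->]].
by apply: aspan_gen; exists p, q, e, x, y.
Qed.

Lemma cmk_eq M N n (V : zmodType) (f g : ctens_ob M N n -> V) :
    zmod_morphism f -> zmod_morphism g ->
    (forall p q (e : (p + q == n)%N) x y, f (cmk e x y) = g (cmk e x y)) ->
  forall z, f z = g z.
Proof.
move=> fB gB fg z.
by apply: (aspan_eq fB gB) (cmk_span z) => _ [p [q [e [x [y ->]]]]].
Qed.

Lemma cmk_lift M N n (V : lmodType R) (h : forall p q, (p + q == n)%N -> M p -> N q -> V) :
    (forall p q e x, linear (@h p q e x)) ->
    (forall p q e y, linear (fun x => @h p q e x y)) ->
  exists f : ctens_ob M N n -> V, linear f /\ forall p q e x y, f (cmk e x y) = @h p q e x y.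
Proof.
move=> hr hl.
pose h' (i : bideg n) : ctens M N (val i).1 (val i).2 -> V := tlift (h _ _ (valP i)).
have hP' (i : bideg n) : linear (@h' i) /\ forall x y, h' i (tmk _ _ x y) = h _ _ (valP i) x y.
  apply: tlift_linear => [x|y|x t y]; first exact: linear_zmod (hr _ _ _ _).
    exact: hl.
  by rewrite (linear_scale (hl _ _ (valP i) y)) (linear_scale (hr _ _ (valP i) x)).
have [|f [fL fE]] := @dsum_lift R _ (fun i : bideg n => ctens M N (val i).1 (val i).2) V h'.
  by move=> i; exact: (hP' i).1.
exists f; split=> // p q e x y; rewrite /cmk fE (hP' _).2.
exact: (congr1 (fun e => @h p q e x y) (bool_irrelevance _ _)).
Qed.

Lemma cext_spec M N n (V : lmodType R) (v : cgen M N n -> V) :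
    (forall p q (e : (p + q == n)%N) x, linear (fun y => v (CGen e x y))) ->
    (forall p q (e : (p + q == n)%N) y, linear (fun x => v (CGen e x y))) ->
  linear (extend (@cgen_elt R M N n) v) /\
  forall p q (e : (p + q == n)%N) x y, extend (@cgen_elt R M N n) v (cmk e x y) = v (CGen e x y).
Proof.
move=> vr vl; have [f [fL fE]] := cmk_lift vr vl.
have E z : extend (@cgen_elt R M N n) v z = f z.
  apply: (extend_eq (linear_zmod fL)) => [[p q e x y]|w]; first exact: fE.
  apply: aspan_bind (cmk_span w) => _ [p [q [e [x [y ->]]]]].
  by apply: aspan_gen; exists (CGen e x y).
by split=> [a u w|p q e x y]; rewrite !E ?fL ?fE.
Qed.

Section Differential.
Variables M N : complex R.
Hypotheses (HM : is_complex M) (HN : is_complex N).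

Lemma ctens_diffl_linearl n p q (e : (p + q == n.+1)%N) (y : N q) :
  linear (fun x : M p => ctens_diffl e x y).
Proof.
case: p e => [|p] e; first by move=> a u v; rewrite scaler0 addr0.
exact: (linear_comp (@cmk_linearl M N n p q e y) (HM.1 p)).
Qed.

Lemma ctens_diffl_linearr n p q (e : (p + q == n.+1)%N) (x : M p) :
  linear (fun y : N q => ctens_diffl e x y).
Proof.
case: p e x => [|p] e x; first by move=> a u v; rewrite scaler0 addr0.
exact: (@cmk_linearr M N n p q e (cdiff x)).
Qed.

Lemma ctens_diffr_linearl n p q (e : (p + q == n.+1)%N) (y : N q) :
  linear (fun x : M p => ctens_diffr e x y).
Proof.
case: q e y => [|q] e y; first by move=> a u v; rewrite scaler0 addr0.
exact: (cmk_linearl (bideg_predr e) (cdiff y)).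
Qed.

Lemma ctens_diffr_linearr n p q (e : (p + q == n.+1)%N) (x : M p) :
  linear (fun y : N q => ctens_diffr e x y).
Proof.
case: q e => [|q] e; first by move=> a u v; rewrite scaler0 addr0.
exact: linear_comp (cmk_linearr (bideg_predr e) x) (HN.1 q).
Qed.

Lemma ctens_diff_spec n : linear (@ctens_diff R M N n) /\
  forall p q (e : (p + q == n.+1)%N) (x : M p) (y : N q), ctens_diff (cmk e x y) =
    ctens_diffl e x y + (-1) ^+ p *: ctens_diffr e x y.
Proof.
apply: (@cext_spec M N n.+1 (ctens_ob M N n) (fun g => let: CGen p q e x y := g in
    ctens_diffl e x y + (-1) ^+ p *: ctens_diffr e x y)) => p q e z; apply: linear_add.
- exact: ctens_diffl_linearr.
- exact: linear_comp (scale_linear Rc _) (ctens_diffr_linearr e z).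
- exact: ctens_diffl_linearl.
- exact: linear_comp (scale_linear Rc _) (ctens_diffr_linearl e z).
Qed.

Lemma complex_tensP : is_complex (complex_tens M N).
Proof.
split=> [n|n]; first exact: (ctens_diff_spec n).1.
have [L1 E1] := ctens_diff_spec n; have [L2 E2] := ctens_diff_spec n.+1.
apply: (cmk_eq (linear_zmod (linear_comp L1 L2)) (g := fun=> 0)) => [x y|p q e x y].
  by rewrite subrr.
rewrite E2 (linear_atD L1) (linear_scale L1).
have z1 m p' q' (e' : (p' + q' == m)%N) (y' : N q') : cmk e' (0 : M p') y' = 0.
  exact: linear_at0 (cmk_linearl e' y').
have z2 m p' q' (e' : (p' + q' == m)%N) (x' : M p') : cmk e' x' (0 : N q') = 0.
  exact: linear_at0 (cmk_linearr e' x').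
have dl p' e' (x' : M p'.+1) : ctens_diffl (n := n) (q := q) e' (cdiff x') y = 0.
  by case: p' e' x' => [|p'] e' x' //=; rewrite HM.2 z1.
have dr q' e' (y' : N q'.+1) : ctens_diffr (n := n) (p := p) e' x (cdiff y') = 0.
  by case: q' e' y' => [|q'] e' y' //=; rewrite HN.2 z2.
have L0 : ctens_diff (0 : ctens_ob M N n.+1) = 0 by exact: linear_at0 L1.
case: p e x dr => [|p] e x dr /=.
  rewrite L0 add0r expr0 scale1r; case: q e y dl dr => [|q] e y dl dr /=; first exact: L0.
  by rewrite E1 dr scaler0 addr0.
rewrite E1 dl add0r; case: q e y dl dr => [|q] e y dl dr /=; first by rewrite L0 !scaler0 addr0.
(* The two mixed terms dx (x) dy carry the signs (-1)^p and (-1)^(p+1) and cancel. *)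
rewrite E1 dr scaler0 addr0 exprS mulN1r scaleNr.
rewrite -[X in X - _]/((-1) ^+ p *: cmk _ _ _); apply/eqP; rewrite subr_eq0; apply/eqP.
by congr (_ *: _); exact: cmk_irr.
Qed.

End Differential.

Lemma complex_unitP : is_complex (complex_unit R).
Proof.
split=> [n a x y|//]; by rewrite /= scaler0 addr0.
Qed.

Lemma complex_tens_map_spec M M' N N' (f : forall n, M n -> M' n) (g : forall n, N n -> N' n) n :
    (forall n, linear (f n)) -> (forall n, linear (g n)) ->
  linear (complex_tens_map f g (n := n)) /\
  forall p q (e : (p + q == n)%N) (x : M p) (y : N q),
    complex_tens_map f g (n := n) (cmk e x y) = cmk e (f p x) (g q y).
Proof.
move=> fL gL; apply: (@cext_spec M N n (ctens_ob M' N' n) (fun c =>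
    let: CGen p q e x y := c in cmk e (f p x) (g q y))) => p q e z.
  exact: linear_comp (cmk_linearr e (f p z)) (gL q).
exact: linear_comp (cmk_linearl e (g q z)) (fL p).
Qed.

Section Assoc.
Variables (M N P : complex R) (n : nat).
Local Notation MN := (complex_tens M N).
Local Notation NP := (complex_tens N P).

Definition is_cmk3 (w : ctens_ob MN P n) : Prop :=
  exists p q r (e : (p + q + r == n)%N) (x : M p) (y : N q) (z : P r),
    w = cmk (M := MN) e (cmk (eqxx (p + q)%N) x y) z.

Lemma cmk3_span w : aspan is_cmk3 w.
Proof.
apply: aspan_bind (cmk_span w) => _ [s [r [e [u [z ->]]]]].
apply: (aspan_map (f := fun u : MN s => cmk (M := MN) e u z)) (cmk_span u).
  exact: linear_zmod (cmk_linearl (M := MN) e z).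
move=> _ [p [q [e' [x [y ->]]]]]; have E := eqP e'; subst s; apply: aspan_gen.
by exists p, q, r, e, x, y, z; rewrite (cmk_irr e' (eqxx _)).
Qed.

Definition is_cmk3r (w : ctens_ob M NP n) : Prop :=
  exists p q r (e : (p + (q + r) == n)%N) (x : M p) (y : N q) (z : P r),
    w = cmk (N := NP) e x (cmk (eqxx (q + r)%N) y z).

Lemma cmk3r_span w : aspan is_cmk3r w.
Proof.
apply: aspan_bind (cmk_span w) => _ [p [t [e [x [u ->]]]]].
apply: (aspan_map (f := fun u : NP t => cmk (N := NP) e x u)) (cmk_span u).
  exact: linear_zmod (cmk_linearr (N := NP) e x).
move=> _ [q [r [e' [y [z ->]]]]]; have E := eqP e'; subst t; apply: aspan_gen.
by exists p, q, r, e, x, y, z; rewrite (cmk_irr e' (eqxx _)).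
Qed.

Lemma cmk3_lift (V : lmodType R)
    (h : forall p q r, (p + q + r == n)%N -> M p -> N q -> P r -> V) :
    (forall p q r e x y, linear (@h p q r e x y)) ->
    (forall p q r e x z, linear (fun y => @h p q r e x y z)) ->
    (forall p q r e y z, linear (fun x => @h p q r e x y z)) ->
  exists f : ctens_ob MN P n -> V, linear f /\
    forall p q r (e : (p + q + r == n)%N) x y z,
      f (cmk (M := MN) e (cmk (eqxx (p + q)%N) x y) z) = @h p q r e x y z.
Proof.
move=> h3 h2 h1.
(* The inner degree s is p + q only up to a provable equality, while h asks for the degree equation
   in terms of p, q and r. *)
have E s r p q (e : (s + r == n)%N) (e' : (p + q == s)%N) : (p + q + r == n)%N.
  by rewrite (eqP e').
pose v s r (e : (s + r == n)%N) (z : P r) (g : cgen M N s) : V :=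
  let: CGen p q e' x y := g in h p q r (E s r p q e e') x y z.
have vP s r e z := @cext_spec M N s V (@v s r e z)
  (fun p q e' x => h2 p q r (E s r p q e e') x z)
  (fun p q e' y => h1 p q r (E s r p q e e') y z).
have [s r e u|s r e z|f [fL fE]] := @cmk_lift MN P n V
  (fun s r e (u : MN s) z => extend (@cgen_elt R M N s) (@v s r e z) u).
- move=> a z z'.
  pose g u := a *: extend (@cgen_elt R M N s) (v s r e z) u + extend (@cgen_elt R M N s)
    (v s r e z') u.
  have gB : zmod_morphism g.
    apply: zmod_morph_add; last exact: linear_zmod (vP _ _ _ _).1.
    exact: linear_zmod (linear_comp (scale_linear Rc a) (vP s r e z).1).
  apply: (cmk_eq (linear_zmod (vP _ _ _ _).1) gB) u => p q e' x y.
  by rewrite /g !(vP _ _ _ _).2 /v h3.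
- exact: (vP s r e z).1.
exists f; split=> // p q r e x y z; rewrite fE (vP _ _ _ _).2 /v.
by rewrite (bool_irrelevance (E _ _ _ _ _ _) e).
Qed.

Lemma cmk3r_lift (V : lmodType R)
    (h : forall p q r, (p + (q + r) == n)%N -> M p -> N q -> P r -> V) :
    (forall p q r e x y, linear (@h p q r e x y)) ->
    (forall p q r e x z, linear (fun y => @h p q r e x y z)) ->
    (forall p q r e y z, linear (fun x => @h p q r e x y z)) ->
  exists f : ctens_ob M NP n -> V, linear f /\
    forall p q r (e : (p + (q + r) == n)%N) x y z,
      f (cmk (N := NP) e x (cmk (eqxx (q + r)%N) y z)) = @h p q r e x y z.
Proof.
move=> h3 h2 h1.
have E p t q r (e : (p + t == n)%N) (e' : (q + r == t)%N) : (p + (q + r) == n)%N.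
  by rewrite (eqP e').
pose v p t (e : (p + t == n)%N) (x : M p) (g : cgen N P t) : V :=
  let: CGen q r e' y z := g in h p q r (E p t q r e e') x y z.
have vP p t e x := @cext_spec N P t V (@v p t e x)
  (fun q r e' y => h3 p q r (E p t q r e e') x y)
  (fun q r e' z => h2 p q r (E p t q r e e') x z).
have [p t e x|p t e u|f [fL fE]] := @cmk_lift M NP n V
  (fun p t e x (u : NP t) => extend (@cgen_elt R N P t) (@v p t e x) u).
- exact: (vP p t e x).1.
- move=> a x x'.
  pose g u := a *: extend (@cgen_elt R N P t) (v p t e x) u + extend (@cgen_elt R N P t)
    (v p t e x') u.
  have gB : zmod_morphism g.
    apply: zmod_morph_add; last exact: linear_zmod (vP _ _ _ _).1.
    exact: linear_zmod (linear_comp (scale_linear Rc a) (vP p t e x).1).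
  apply: (cmk_eq (linear_zmod (vP _ _ _ _).1) gB) u => q r e' y z.
  by rewrite /g !(vP _ _ _ _).2 /v h1.
exists f; split=> // p q r e x y z; rewrite fE (vP _ _ _ _).2 /v.
by rewrite (bool_irrelevance (E _ _ _ _ _ _) e).
Qed.

Lemma complex_assoc_spec : linear (@complex_assoc R M N P n) /\
  forall p q r (e : (p + q + r == n)%N) (e' : (p + (q + r) == n)%N) x y z,
    complex_assoc (cmk (M := MN) e (cmk (eqxx (p + q)%N) x y) z) =
    cmk (N := NP) e' x (cmk (eqxx (q + r)%N) y z).
Proof.
have [p q r e x y|p q r e x z|p q r e y z|f [fL fE]] := @cmk3_lift (ctens_ob M NP n)
  (fun p q r e x y z => cmk (N := NP) (bideg_assoc e) x (cmk (eqxx (q + r)%N) y z)).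
- exact: linear_comp (cmk_linearr (N := NP) _ x) (cmk_linearr _ y).
- exact: linear_comp (cmk_linearr (N := NP) _ x) (cmk_linearl _ z).
- exact: (cmk_linearl (N := NP)).
have E w : complex_assoc w = f w.
  apply: (extend_eq (linear_zmod fL)) => [[p q r e x y z]|w']; first exact: fE.
  apply: aspan_bind (cmk3_span w') => _ [p [q [r [e [x [y [z ->]]]]]]].
  by apply: aspan_gen; exists (CGen3 e x y z).
split=> [a u w|p q r e e' x y z]; rewrite !E ?fL ?fE //.
exact: cmk_irr.
Qed.

(* The degrees s and t are kept general, as p + (q + r) and p + q + r are not
   convertible. *)
Lemma complex_assocE s t p q r (e : (s + r == n)%N) (e' : (p + q == s)%N)
    (f : (p + t == n)%N) (f' : (q + r == t)%N) x y z :
  complex_assoc (cmk (M := MN) e (cmk e' x y) z) = cmk (N := NP) f x (cmk f' y z).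
Proof.
have [E E'] := (eqP e', eqP f'); subst s t.
by rewrite (cmk_irr e' (eqxx _)) (cmk_irr f' (eqxx _)) (complex_assoc_spec.2 _ _ _ e f).
Qed.

Lemma complex_assoc_inv :
  exists g, cancel (@complex_assoc R M N P n) g /\ cancel g (@complex_assoc R M N P n).
Proof.
have [aL aE] := complex_assoc_spec.
have E p q r (e : (p + (q + r) == n)%N) : (p + q + r == n)%N by rewrite -addnA.
have [p q r e x y|p q r e x z|p q r e y z|f [fL fE]] := @cmk3r_lift (ctens_ob MN P n)
  (fun p q r e x y z => cmk (M := MN) (E p q r e) (cmk (eqxx (p + q)%N) x y) z).
- exact: (cmk_linearr (M := MN)).
- exact: linear_comp (cmk_linearl (M := MN) _ z) (cmk_linearr _ x).
- exact: linear_comp (cmk_linearl (M := MN) _ z) (cmk_linearl _ y).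
exists f; split=> w.
  apply: (aspan_eq (linear_zmod (linear_comp fL aL)) (g := id)) (cmk3_span w) => //.
  move=> _ [p [q [r [e [x [y [z ->]]]]]]].
  by rewrite (aE _ _ _ _ (bideg_assoc e)) fE; exact: cmk_irr.
apply: (aspan_eq (linear_zmod (linear_comp aL fL)) (g := id)) (cmk3r_span w) => //.
by move=> _ [p [q [r [e [x [y [z ->]]]]]]]; rewrite fE (aE _ _ _ _ e).
Qed.

End Assoc.

Section Units.
Variables (M : complex R) (n : nat).
Local Notation U := (complex_unit R).

Lemma complex_unit_pos q (y : U q.+1) : y = 0.
Proof. exact: thinmx0. Qed.

(** A generator r (x) v in degree n only comes with a proof that the degree of v equals n, so r v
    has to be transported to M_n. *)
Let cast p (E : p = n) (x : M p) : M n := eq_rect p (fun i => M i : Type) x n E.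

Let cast_linear p (E : p = n) : linear (cast E).
Proof. by move=> a x y; rewrite /cast; case: n / E. Qed.

Let cast_id (E : n = n) x : cast E x = x.
Proof. by rewrite (eq_irrelevance E erefl). Qed.

Definition lunit_in (r : R) (x : M n) : ctens_ob U M n :=
  cmk (M := U) (p := 0) (eqxx n) (r : R^o) x.
Definition runit_in (x : M n) (r : R) : ctens_ob M U n :=
  cmk (N := U) (q := 0) (bideg_0r n) x (r : R^o).

Lemma lunit_span z : aspan (fun z => exists r x, z = lunit_in r x) z.
Proof.
apply: aspan_bind (cmk_span z) => _ [[|p] [q [e [r [x ->]]]]].
  have E : q = n := eqP e; subst q; apply: aspan_gen.
  by exists r, x; exact: cmk_irr.
rewrite [r]complex_unit_pos (linear_at0 (cmk_linearl (M := U) e x)).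
exact: aspan0.
Qed.

Lemma runit_span z : aspan (fun z => exists x r, z = runit_in x r) z.
Proof.
apply: aspan_bind (cmk_span z) => _ [p [[|q] [e [x [r ->]]]]].
  have E : p = n by rewrite -(eqP e) addn0.
  by subst p; apply: aspan_gen; exists x, r; exact: cmk_irr.
rewrite [r]complex_unit_pos (linear_at0 (cmk_linearr (N := U) e x)).
exact: aspan0.
Qed.

Lemma complex_lunit_spec : linear (@complex_lunit R M n) /\
  forall r x, complex_lunit (lunit_in r x) = r *: x.
Proof.
pose h p q (e : (p + q == n)%N) : U p -> M q -> M n :=
  match p return (p + q == n)%N -> U p -> M q -> M n with
  | 0 => fun e r x => (r : R) *: cast (eqP e : q = n) x
  | _.+1 => fun _ _ _ => 0
  end e.
have [p q e r|p q e x|f [fL fE]] := @cmk_lift U M n (M n) h.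
- case: p e r => [|p] e r; last by move=> a x y; rewrite scaler0 addr0.
  exact: linear_comp (scale_linear Rc r) (cast_linear _).
- case: p e => [|p] e; last by move=> a r r'; rewrite scaler0 addr0.
  by move=> a r r'; rewrite /h scalerDl scalerA.
have E z : complex_lunit z = f z.
  apply: (extend_eq (linear_zmod fL)) => [[r x]|w].
    by rewrite fE /h cast_id.
  apply: aspan_bind (lunit_span w) => _ [r [x ->]].
  by apply: aspan_gen; exists (r, x).
by split=> [a u w|r x]; rewrite !E ?fL // fE /h cast_id.
Qed.

Lemma complex_runit_spec : linear (@complex_runit R M n) /\
  forall r x, complex_runit (runit_in x r) = r *: x.
Proof.
have nE p (e : (p + 0 == n)%N) : p = n by rewrite -(eqP e) addn0.
pose h p q (e : (p + q == n)%N) : M p -> U q -> M n :=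
  match q return (p + q == n)%N -> M p -> U q -> M n with
  | 0 => fun e x r => (r : R) *: cast (nE p e) x
  | _.+1 => fun _ _ _ => 0
  end e.
have [p q e x|p q e r|f [fL fE]] := @cmk_lift M U n (M n) h.
- case: q e => [|q] e; last by move=> a r r'; rewrite scaler0 addr0.
  by move=> a r r'; rewrite /h scalerDl scalerA.
- case: q e r => [|q] e r; last by move=> a x y; rewrite scaler0 addr0.
  exact: linear_comp (scale_linear Rc r) (cast_linear _).
have E z : complex_runit z = f z.
  apply: (extend_eq (linear_zmod fL)) => [[x r]|w].
    by rewrite fE /h cast_id.
  apply: aspan_bind (runit_span w) => _ [x [r ->]].
  by apply: aspan_gen; exists (x, r).
by split=> [a u w|r x]; rewrite !E ?fL // fE /h cast_id.
Qed.

Lemma complex_lunitK : cancel (@complex_lunit R M n) (lunit_in 1).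
Proof.
have [L E] := complex_lunit_spec.
have iL : linear (lunit_in 1) by exact: (cmk_linearr (M := U) (p := 0) (eqxx n) (1 : R^o)).
move=> z; apply: (aspan_eq (linear_zmod (linear_comp iL L)) (g := fun z => z)) (lunit_span z) => //.
move=> _ [r [x ->]]; rewrite [complex_lunit _]E (linear_scale iL).
rewrite -(linear_scale (cmk_linearl (M := U) (p := 0) (eqxx n) x)).
by congr cmk; exact: mulr1.
Qed.

Lemma complex_runitK : cancel (@complex_runit R M n) (runit_in^~ 1).
Proof.
have [L E] := complex_runit_spec.
have iL : linear (runit_in^~ 1).
  exact: (cmk_linearl (N := U) (q := 0) (bideg_0r n) (1 : R^o)).
move=> z; apply: (aspan_eq (linear_zmod (linear_comp iL L)) (g := fun z => z)) (runit_span z) => //.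
move=> _ [x [r ->]]; rewrite [complex_runit _]E (linear_scale iL).
rewrite -(linear_scale (cmk_linearr (N := U) (q := 0) (bideg_0r n) x)).
by congr cmk; exact: mulr1.
Qed.

Lemma lunit_inK : cancel (lunit_in 1) (@complex_lunit R M n).
Proof. by move=> x; rewrite complex_lunit_spec.2 scale1r. Qed.

Lemma runit_inK : cancel (runit_in^~ 1) (@complex_runit R M n).
Proof. by move=> x; rewrite complex_runit_spec.2 scale1r. Qed.

End Units.

End ChainTensor.

Lemma chain_iso (R : pzRingType) (M N : complex R) (f : forall n, M n -> N n)
    (g : forall n, N n -> M n) :
    is_chain_map f -> (forall n, cancel (f n) (g n)) -> (forall n, cancel (g n) (f n)) ->
  @is_iso (chain_category R) M N f.
Proof.
move=> [fL fd] fg gf; split=> //; exists g; split.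
- split=> [n a x y|n x].
    by apply: (can_inj (fg n)); rewrite gf fL !gf.
  by apply: (can_inj (fg n)); rewrite gf fd gf.
- by apply: functional_extensionality_dep => n; apply/funext => x; exact: fg.
- by apply: functional_extensionality_dep => n; apply/funext => x; exact: gf.
Qed.

(** * The monoidal structure of the functor *)

Section MonoidalFunctor.
Variables (k : comPzRingType) (R : kalgebra k).
Hypothesis Rc : forall x y : R, x * y = y * x.
Implicit Types M N P : complex R.
Local Notation "x \ox y" := (cox x y) (at level 40, left associativity).
Local Notation F := (@QC_ob k R).
Local Notation U := (complex_unit R).

Lemma Qcox_span M N (z : comodule_tens (F M) (F N)) :
  aspan (fun z => exists p q (x : M p) (y : N q), z = Qj x \ox Qj y) z.
Proof.
apply: aspan_bind (cox_span z) => _ [u [v ->]].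
apply: (aspan_map (f := fun u => u \ox v)) (Qj_span u).
  exact: linear_zmod (cox_linearl v).
move=> _ [p [x ->]]; apply: (aspan_map (f := fun v => Qj x \ox v)) (Qj_span v).
  exact: cox_zmodr.
by move=> _ [q [y ->]]; apply: aspan_gen; exists p, q, x, y.
Qed.

Lemma Qcox_eq M N (V : zmodType) (f g : comodule_tens (F M) (F N) -> V) :
    zmod_morphism f -> zmod_morphism g ->
    (forall p q (x : M p) (y : N q), f (Qj x \ox Qj y) = g (Qj x \ox Qj y)) ->
  forall z, f z = g z.
Proof.
by move=> fB gB fg z; apply: (aspan_eq fB gB) (Qcox_span z) => _ [p [q [x [y ->]]]].
Qed.

Definition Qphi M N : comodule_tens (F M) (F N) -> F (complex_tens M N) :=
  extend (fun g : {p & M p} * {q & N q} =>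
      Qj (tagged g.1) \ox Qj (tagged g.2) : comodule_tens (F M) (F N))
    (fun g => Qj (cmk (eqxx (tag g.1 + tag g.2)%N) (tagged g.1) (tagged g.2)
        : complex_tens M N _)).

Definition Qphi0 (r : comodule_unit R) : F U := @Qj k R U 0 r.

Section Phi.
Variables M N : complex R.
Hypotheses (HM : is_complex M) (HN : is_complex N).
Local Notation MN := (complex_tens M N).
Let HMN : is_complex MN. Proof. exact: complex_tensP. Qed.
Let FM := @QC_comodule k R _ HM.
Let FN := @QC_comodule k R _ HN.
Let FMN := @QC_comodule k R _ HMN.
Local Notation phi := (@Qphi M N).

(** The degree is part of the type on the side of complexes but not in F (M (x) N), so elements
    whose degrees are equal without being convertible can be compared there. *)
Lemma Qj_irr n p q (e : (p + q == n)%N) (x : M p) (y : N q) :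
  Qj (cmk (eqxx (p + q)%N) x y : MN _) = Qj (cmk e x y : MN n) :> F MN.
Proof. by have E := eqP e; subst n; congr Qj; exact: cmk_irr. Qed.

Lemma Qphi_exists : exists f : comodule_tens (F M) (F N) -> F MN, linear f /\
  forall p q (x : M p) (y : N q), f (Qj x \ox Qj y) = Qj (cmk (eqxx (p + q)%N) x y : MN _).
Proof.
have jL n : linear (fun w : MN n => Qj w : F MN) by exact: Qj_linear.
(* The two arguments are lifted in turn: over F N for x fixed in M_p, then over F M for a fixed
   element of F N. *)
have f0 p (x : M p) : exists f : F N -> F MN, linear f /\
    forall q (y : N q), f (Qj y) = Qj (cmk (eqxx (p + q)%N) x y : MN _).
  apply: (QC_lift HN (h := fun q (y : N q) => Qj (cmk (eqxx (p + q)%N) x y : MN _))) => q.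
  exact: (linear_comp (jL (p + q)%N) (@cmk_linearr R M N _ p q (eqxx (p + q)%N) x)).
pose f p x := projT1 (cid (f0 p x)).
have fL p x : linear (f p x) by rewrite /f; case: cid => ? [].
have fE p x q (y : N q) : f p x (Qj y) = Qj (cmk (eqxx (p + q)%N) x y : MN _).
  by rewrite /f; case: cid => ? [].
have fl p v : linear (fun x => f p x v).
  move=> a x x'; pose g v := a *: f p x v + f p x' v.
  have gB : zmod_morphism g.
    apply: zmod_morph_add; last exact: linear_zmod (fL p x').
    exact: linear_zmod (linear_comp (scale_linear Rc a) (fL p x)).
  apply: (QC_eq (linear_zmod (fL p _)) gB) v => q y.
  by rewrite /g !fE cmk_linearl jL.
have g0 v : exists g : F M -> F MN, linear g /\ forall p (x : M p), g (Qj x) = f p x v.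
  by apply: (QC_lift HM (h := fun p x => f p x v)).
pose g v := projT1 (cid (g0 v)).
have gL v : linear (g v) by rewrite /g; case: cid => ? [].
have gE v p (x : M p) : g v (Qj x) = f p x v by rewrite /g; case: cid => ? [].
have [u a v v'|v|hL hE] := @cox_lift _ _ Rc (F M) (F N) FM (F MN) (fun u v => g v u).
- pose g2 u := a *: g v u + g v' u.
  have g2B : zmod_morphism g2.
    apply: zmod_morph_add; last exact: linear_zmod (gL v').
    exact: linear_zmod (linear_comp (scale_linear Rc a) (gL v)).
  by apply: (QC_eq (linear_zmod (gL _)) g2B) u => p x; rewrite /g2 !gE fL.
- exact: gL.
by eexists; split; [exact: hL|move=> p q x y; rewrite hE gE fE].
Qed.

Lemma Qphi_spec : linear phi /\
  forall n p q (e : (p + q == n)%N) (x : M p) (y : N q), phi (Qj x \ox Qj y) = Qj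
    (cmk e x y : MN n).
Proof.
have [f [fL fE]] := Qphi_exists.
have E z : phi z = f z.
  apply: (extend_eq (linear_zmod fL)) => [[[p x] [q y]]|w]; first exact: fE.
  apply: aspan_bind (Qcox_span w) => _ [p [q [x [y ->]]]].
  by apply: aspan_gen; exists (existT _ p x, existT _ q y).
by split=> [a u v|n p q e x y]; rewrite !E ?fL // fE -Qj_irr.
Qed.

Lemma Qphi_linear : linear phi. Proof. exact: Qphi_spec.1. Qed.
Lemma QphiE n p q (e : (p + q == n)%N) (x : M p) (y : N q) :
  phi (Qj x \ox Qj y) = Qj (cmk e x y : MN n).
Proof. exact: Qphi_spec.2. Qed.

(** The Leibniz rule of complexes in the form of that of [homog_tens]. The cases on degrees are
    those in the definitions of [Qjd] and of the differential, where terms that would leave degree 0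
    are 0. *)
Lemma Qphi_diff n m (x : M n) (y : N m) :
  Qjd (cmk (eqxx (n + m)%N) x y : MN _) =
  phi (Qjd x \ox Qj y) + (-1) ^+ n *: phi (Qj x \ox Qjd y) :> F MN.
Proof.
have pB := linear_zmod Qphi_linear; have jB i := @Qj_zmod k R MN i.
have dE i := (ctens_diff_spec Rc HM HN i).2.
have jD i (w w' : ctens_ob M N i) : @Qj k R MN i (w + w') = @Qj k R MN i w + @Qj k R MN i w'.
  exact: zmod_morphD (jB i) w w'.
have jZ i a (w : ctens_ob M N i) : @Qj k R MN i (a *: w) = a *: @Qj k R MN i w.
  exact: (linear_scale (@Qj_linear k R MN i) a w).
have z1 v : phi ((0 : F M) \ox v) = 0.
  by rewrite (linear_at0 (cox_linearl v)) zmod_morph0.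
have z2 u : phi (u \ox (0 : F N)) = 0 by rewrite (zmod_morph0 (cox_zmodr u)) zmod_morph0.
case: n x => [|n] x.
  rewrite [Qjd x]/(0 : F M) z1 add0r expr0 scale1r.
  case: m y => [|m] y; first by rewrite [Qjd y]/(0 : F N) z2.
  rewrite [Qjd y]/(Qj (cdiff y)) (QphiE (bideg_predr (eqxx (0 + m.+1)%N))).
  rewrite [LHS]/(@Qj k R MN m (ctens_diff (cmk (eqxx (0 + m.+1)%N) x y))).
  by rewrite dE /= add0r expr0 scale1r.
rewrite [Qjd x]/(Qj (cdiff x)) (QphiE (eqxx (n + m)%N)).
have D : @Qj k R MN (n + m) (ctens_diff (cmk (eqxx (n.+1 + m)%N) x y)) =
    @Qj k R MN (n + m) (@ctens_diffl R M N (n + m) n.+1 m (eqxx (n.+1 + m)%N) x y) +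
    (-1) ^+ n.+1 *: @Qj k R MN (n + m) (@ctens_diffr R M N (n + m) n.+1 m (eqxx (n.+1 + m)%N) x y).
  by rewrite -jZ -jD; congr Qj; exact: dE.
rewrite [LHS]D {D}.
congr (_ + _ *: _); first by congr Qj; exact: cmk_irr.
case: m y => [|m] y; first by rewrite [Qjd y]/(0 : F N) z2 (zmod_morph0 (jB _)).
by rewrite [Qjd y]/(Qj (cdiff y)) (QphiE (bideg_predr (eqxx (n.+1 + m.+1)%N))).
Qed.

(** Homogeneous elements of F M and F N are of the form [Qj], and on these [Qphi_diff] matches the
    Leibniz rules of the two tensor products. *)
Lemma Qphi_morph : is_comodule_map phi.
Proof.
apply: tens_comodule_map => //; first exact: Qphi_linear.
move=> n m u du v dv hu hv.
have Eu := QC_homog HM hu; have Ev := QC_homog HN hv.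
rewrite Eu in hu *; rewrite Ev in hv *.
rewrite (homog_uniq hu (Qj_homog HM _)) (homog_uniq hv (Qj_homog HN _)).
by rewrite (QphiE (eqxx (n + m)%N)) -Qphi_diff; exact: Qj_homog.
Qed.

Lemma Qphi_inv : exists g : F MN -> comodule_tens (F M) (F N), cancel phi g /\ cancel g phi.
Proof.
have h0 n : exists h : MN n -> comodule_tens (F M) (F N), linear h /\
    forall p q (e : (p + q == n)%N) x y, h (cmk e x y) = Qj x \ox Qj y.
  apply: (cmk_lift (h := fun p q _ x y => Qj x \ox Qj y)) => p q e z.
    exact: linear_comp (cox_linearr Rc FM _) (@Qj_linear _ _ _ _).
  exact: linear_comp (cox_linearl _) (@Qj_linear _ _ _ _).
pose h n := projT1 (cid (h0 n)).
have hL n : linear (h n) by rewrite /h; case: cid => ? [].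
have hE n p q (e : (p + q == n)%N) x y : h n (cmk e x y) = Qj x \ox Qj y.
  by rewrite /h; case: cid => ? [].
have [g [gL gE]] := QC_lift HMN hL.
exists g; split=> z.
  apply: (Qcox_eq (linear_zmod (linear_comp gL Qphi_linear)) (g := fun z => z)) z => //.
  by move=> p q x y; rewrite (QphiE (eqxx (p + q)%N)) gE hE.
apply: (QC_eq (linear_zmod (linear_comp Qphi_linear gL)) (g := fun z => z)) z => // n w.
rewrite gE; apply: (cmk_eq (linear_zmod (linear_comp Qphi_linear (hL n)))
  (@Qj_zmod k R MN n)) w => p q e x y.
by rewrite hE (QphiE e).
Qed.

Lemma Qphi_iso : @is_iso (comodule_category R) _ _ phi.
Proof.
have [g [pg gp]] := Qphi_inv.
apply: (@inverse_iso _ _ _ _ phi g) => //; [exact: comodule_tensP|exact: Qphi_morph].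
Qed.

End Phi.

Lemma Qphi0_linear : linear Qphi0.
Proof. exact: (@Qj_linear k R U 0). Qed.

Lemma Qphi0_morph : is_comodule_map Qphi0.
Proof.
have HU := complex_unitP R; have FU := @QC_comodule k R _ HU.
apply: comodule_mapP => //; [exact: comodule_unitP|exact: Qphi0_linear|].
move=> n r dr hr; have h0 := unit_homog (r : R).
have := homog_proj n h0; rewrite (homog_proj n hr) eqxx.
have [E|n0] := eqVneq n 0%N.
  subst n => _; rewrite (homog_uniq hr h0) (linear_at0 Qphi0_linear).
  exact: (@Qj_homog k R U HU 0).
(* The unit comodule is concentrated in degree 0, so a homogeneous element of another degree is
   0. *)
move=> r0; rewrite {}r0 in hr *.
have hz := homog0 n (coact_linear (comodule_unitP R)).
rewrite (homog_uniq hr hz) (linear_at0 Qphi0_linear).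
exact: homog0 (coact_linear FU).
Qed.

Lemma Qphi0_iso : @is_iso (comodule_category R) _ _ Qphi0.
Proof.
have HU := complex_unitP R; have FU := @QC_comodule k R _ HU.
apply: (@inverse_iso _ _ _ _ Qphi0 (@Qth k R U 0)) => //.
- exact: comodule_unitP.
- exact: Qphi0_morph.
- by move=> r; exact: (@QthK k R U HU 0%N r).
- move=> z; apply: (QC_eq (linear_zmod (linear_comp Qphi0_linear (Qth_linear HU 0)))
    (g := fun z => z)) z => // -[|n] x; first by rewrite QthK.
  by rewrite [x]complex_unit_pos !(zmod_morph0 (@Qj_zmod k R U _)) (linear_at0 (Qth_linear HU 0))
    (linear_at0 Qphi0_linear).
Qed.

(* A degreewise linear map f is a chain map as soon as it corresponds to a
   comodule map, here b a^-1. *)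
Lemma chain_map_criterion M N (X : comodule R) (a : X -> F M) (b : X -> F N)
    (f : forall n, M n -> N n) :
    is_complex M -> is_complex N -> is_comodule X ->
    is_comodule_map a -> is_comodule_map b -> (forall v, exists u, a u = v) ->
    (forall n, linear (f n)) ->
    (forall u, aspan (fun u => exists n w, a u = Qj w /\ b u = Qj (f n w)) u) ->
  is_chain_map f.
Proof.
move=> HM HN HX Ha Hb aS fL Xs; split=> // n x.
have [FM FN] := (@QC_comodule k R _ HM, @QC_comodule k R _ HN).
have ab m u : f m (Qth m (a u)) = Qth m (b u).
  have [tM tN] := (Qth_linear HM m, Qth_linear HN m).
  apply: (aspan_eq (linear_zmod (linear_comp (fL m) (linear_comp tM Ha.1)))
    (linear_zmod (linear_comp tN Hb.1))) (Xs u) => v [i [w [-> ->]]].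
  have [E|mi] := eqVneq m i; first by subst i; rewrite !QthK.
  by rewrite !Qth_ne // (linear_at0 (fL m)).
(* A preimage of [Qj x] may be replaced by its component of degree n + 1, as a commutes with the
   projections; a and b then both carry the differential of this component to that of its image. *)
have [u au] := aS (Qj x).
have hx := Qj_homog HM x; have hu := homog_component HX n.+1 u.
have au' : a (hproj n.+1 u) = Qj x.
  by rewrite -(comodule_map_comp_n _ _ HX FM Ha) au (homog_proj _ hx) eqxx.
have h1 := comodule_map_homog Ha hu; rewrite au' in h1.
have h2 := comodule_map_homog Hb hu.
have E := QC_homog HN h2; rewrite -ab au' QthK // in E; rewrite E in h2.
have := homog_uniq h2 (Qj_homog HN _) => /(congr1 (@Qth k R N n)).
by rewrite -ab (homog_uniq h1 hx) /Qjd !QthK.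
Qed.

End MonoidalFunctor.

(** * Coherence of the functor, and the monoidal category of complexes *)

Section MonoidalEquivalence.
Variables (k : comPzRingType) (R : kalgebra k).
Hypothesis Rc : forall x y : R, x * y = y * x.
Implicit Types M N P : complex R.
Local Notation "x \ox y" := (cox x y) (at level 40, left associativity).
Local Notation F := (@QC_ob k R).
Local Notation U := (complex_unit R).
Let HU : is_complex U := complex_unitP R.
Let FU : is_comodule (comodule_unit R) := comodule_unitP R.

Lemma iso_surj (X Y : comodule R) (f : X -> Y) :
  @is_iso (comodule_category R) X Y f -> forall y, exists x, f x = y.
Proof.
by move=> [_ [g [_ _ fg]]] y; exists (g y); exact: (congr1 (fun h => h y) fg).
Qed.

(** Serves to show that [phi_left] and its analogues for the units are onto, as
    [chain_map_criterion] demands. *)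
Lemma cox_map_surj (X X' Y Y' : comodule R) (f : X -> X') (g : Y -> Y') :
  is_comodule X -> is_comodule X' -> is_comodule_map f -> is_comodule_map g ->
  (forall x', exists x, f x = x') -> (forall y', exists y, g y = y') ->
  forall z, exists w, comodule_tens_map f g w = z :> comodule_tens X' Y'.
Proof.
move=> HX HX' Hf Hg fS gS z.
have [L E] := comodule_tens_map_spec Rc HX HX' Hf Hg; have B := linear_zmod L.
elim: (cox_span z) => [|_ _ _ [u <-] _ [v <-]|_ [x' [y' ->]]].
- by exists 0; rewrite (zmod_morph0 B).
- by exists (u + v); rewrite (zmod_morphD B).
- by have [[x <-] [y <-]] := (fS x', gS y'); exists (x \ox y); rewrite E.
Qed.

Section TensMap.
Variables (M M' N N' : complex R) (f : forall n, M n -> M' n) (g : forall n, N n -> N' n).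
Hypotheses (HM : is_complex M) (HM' : is_complex M').
Hypotheses (HN : is_complex N) (HN' : is_complex N').
Hypotheses (Hf : is_chain_map f) (Hg : is_chain_map g).
Let FM : is_comodule (F M) := QC_comodule HM.
Let FM' : is_comodule (F M') := QC_comodule HM'.
Let FN : is_comodule (F N) := QC_comodule HN.
Let FN' : is_comodule (F N') := QC_comodule HN'.
Let Ff : is_comodule_map (QC_map f : F M -> F M') := QC_map_comodule HM HM' Hf.
Let Fg : is_comodule_map (QC_map g : F N -> F N') := QC_map_comodule HN HN' Hg.

(** Through the isomorphisms [Qphi] the map corresponds to the product of the comodule maps F f and
    F g, so the criterion applies. *)
Lemma complex_tens_map_morph : is_chain_map (@complex_tens_map R M M' N N' f g).
Proof.
have sp n := complex_tens_map_spec n Hf.1 Hg.1.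
have [L E] := comodule_tens_map_spec Rc FM FM' Ff Fg.
have p1 := Qphi_morph Rc HM HN; have p2 := Qphi_morph Rc HM' HN'.
have t := comodule_tens_map_morph Rc FM FM' FN FN' Ff Fg.
have T1 := comodule_tensP Rc FM FN; have T2 := comodule_tensP Rc FM' FN'.
apply: (chain_map_criterion (complex_tensP Rc HM HN) (complex_tensP Rc HM' HN') T1 p1
  (comodule_map_comp T1 T2 (QC_comodule (complex_tensP Rc HM' HN')) p2 t)).
- exact: iso_surj (Qphi_iso Rc HM HN).
- by move=> n; exact: (sp n).1.
move=> u; apply: aspan_bind (Qcox_span u) => _ [p [q [x [y ->]]]].
apply: aspan_gen; exists (p + q)%N, (cmk (eqxx (p + q)%N) x y).
rewrite (QphiE Rc HM HN (eqxx (p + q)%N)); split=> //.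
by rewrite /comodule_comp E !QC_mapE // (QphiE Rc HM' HN' (eqxx (p + q)%N)) (sp _).2.
Qed.

Lemma Qphi_natural : 
  comodule_comp (@Qphi k R M' N') (comodule_tens_map (QC_map f : F M -> F M')
    (QC_map g : F N -> F N'))
  = comodule_comp (QC_map (@complex_tens_map R M M' N N' f g)) (@Qphi k R M N).
Proof.
have sp n := complex_tens_map_spec n Hf.1 Hg.1.
have [L E] := comodule_tens_map_spec Rc FM FM' Ff Fg.
have L1 := Qphi_linear Rc HM HN; have L2 := Qphi_linear Rc HM' HN'.
have fL := QC_map_linear (k := k) complex_tens_map_morph.
apply/funext; apply: (Qcox_eq (linear_zmod (linear_comp L2 L)) (linear_zmod (linear_comp fL L1))).
move=> p q x y; rewrite E !QC_mapE // (QphiE Rc HM' HN' (eqxx (p + q)%N)).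
rewrite (QphiE Rc HM HN (eqxx (p + q)%N)) QC_mapE //; last exact: complex_tens_map_morph.
by rewrite (sp _).2.
Qed.

End TensMap.

Section Assoc.
Variables (M N P : complex R).
Hypotheses (HM : is_complex M) (HN : is_complex N) (HP : is_complex P).
Let FM : is_comodule (F M) := QC_comodule HM.
Let FN : is_comodule (F N) := QC_comodule HN.
Let FP : is_comodule (F P) := QC_comodule HP.
Let HMN : is_complex (complex_tens M N) := complex_tensP Rc HM HN.
Let HNP : is_complex (complex_tens N P) := complex_tensP Rc HN HP.
Let FMN : is_comodule (F (complex_tens M N)) := QC_comodule HMN.
Let FNP : is_comodule (F (complex_tens N P)) := QC_comodule HNP.
Let H1 : is_complex (complex_tens (complex_tens M N) P) := complex_tensP Rc HMN HP.
Let H2 : is_complex (complex_tens M (complex_tens N P)) := complex_tensP Rc HM HNP.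
Let TMN := comodule_tensP Rc FM FN.
Let TNP := comodule_tensP Rc FN FP.
Let T1 := comodule_tensP Rc TMN FP.
Let T2 := comodule_tensP Rc FM TNP.
Let T3 := comodule_tensP Rc FMN FP.
Let T4 := comodule_tensP Rc FM FNP.

(** [phi_left] and [phi_right] are the two paths in the associativity axiom of a monoidal functor,
    with the associator of complexes left out. They also serve as the maps a and b of
    [chain_map_criterion], which shows that this associator is a chain map. *)
Definition phi_left : comodule_tens (comodule_tens (F M) (F N)) (F P) ->
    F (complex_tens (complex_tens M N) P) :=
  comodule_comp (@Qphi k R (complex_tens M N) P)
    (comodule_tens_map (@Qphi k R M N) (@comodule_idm k R (F P))).
Definition phi_right : comodule_tens (comodule_tens (F M) (F N)) (F P) ->
    F (complex_tens M (complex_tens N P)) :=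
  comodule_comp (comodule_comp (@Qphi k R M (complex_tens N P))
    (comodule_tens_map (@comodule_idm k R (F M)) (@Qphi k R N P)))
    (@comodule_assoc k R (F M) (F N) (F P)).

Let l1 := comodule_tens_map_morph Rc TMN FMN FP FP (Qphi_morph Rc HM HN) (comodule_map_id FP).
Let r1 := comodule_tens_map_morph Rc FM FM TNP FNP (comodule_map_id FM) (Qphi_morph Rc HN HP).

Lemma phi_left_morph : is_comodule_map phi_left.
Proof. exact: (comodule_map_comp T1 T3 (QC_comodule H1) (Qphi_morph Rc HMN HP) l1). Qed.

Lemma phi_right_morph : is_comodule_map phi_right.
Proof.
apply: (comodule_map_comp T1 T2 (QC_comodule H2) _ (comodule_assoc_morph Rc FM FN FP)).
exact: (comodule_map_comp T2 T4 (QC_comodule H2) (Qphi_morph Rc HM HNP) r1).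
Qed.

Lemma phi_leftE p q r (x : M p) (y : N q) (z : P r) :
  phi_left ((Qj x \ox Qj y : comodule_tens _ _) \ox Qj z) =
  Qj (cmk (M := complex_tens M N) (eqxx (p + q + r)%N) (cmk (eqxx (p + q)%N) x y) z
      : complex_tens (complex_tens M N) P _).
Proof.
have [_ E] := comodule_tens_map_spec Rc TMN FMN (Qphi_morph Rc HM HN) (comodule_map_id FP).
rewrite /phi_left /comodule_comp E (QphiE Rc HM HN (eqxx (p + q)%N)).
exact: (QphiE Rc HMN HP (eqxx (p + q + r)%N)).
Qed.

Lemma phi_rightE p q r (x : M p) (y : N q) (z : P r) :
  phi_right ((Qj x \ox Qj y : comodule_tens _ _) \ox Qj z) =
  Qj (complex_assoc (cmk (M := complex_tens M N) (eqxx (p + q + r)%N)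
      (cmk (eqxx (p + q)%N) x y) z) : complex_tens M (complex_tens N P) _).
Proof.
have [_ E] := comodule_tens_map_spec Rc FM FM (comodule_map_id FM) (Qphi_morph Rc HN HP).
have [_ Ea] := comodule_assoc_spec Rc (F P) FM FN.
rewrite /phi_right /comodule_comp Ea E (QphiE Rc HN HP (eqxx (q + r)%N)).
have e : (p + (q + r) == p + q + r)%N by rewrite addnA.
by rewrite ((complex_assoc_spec Rc M N P _).2 _ _ _ _ e) (QphiE Rc HM HNP e).
Qed.

Lemma Qcox3_span (w : comodule_tens (comodule_tens (F M) (F N)) (F P)) :
  aspan (fun w => exists p q r (x : M p) (y : N q) (z : P r),
    w = (Qj x \ox Qj y : comodule_tens _ _) \ox Qj z) w.
Proof.
apply: aspan_bind (cox_span w) => _ [u [v ->]].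
apply: (aspan_map (f := fun u => u \ox v)) (Qcox_span u).
  exact: linear_zmod (cox_linearl v).
move=> _ [p [q [x [y ->]]]].
apply: (aspan_map (f := fun v : F P => (Qj x \ox Qj y : comodule_tens _ _) \ox v)) (Qj_span v).
  exact: (cox_zmodr (Qj x \ox Qj y : comodule_tens _ _)).
by move=> _ [r [z ->]]; apply: aspan_gen; exists p, q, r, x, y, z.
Qed.

Lemma complex_assoc_morph : is_chain_map (@complex_assoc R M N P).
Proof.
apply: (chain_map_criterion H1 H2 T1 phi_left_morph phi_right_morph).
- move=> v; have [w <-] := iso_surj (Qphi_iso Rc HMN HP) v.
  have [u <-] := cox_map_surj TMN FMN (Qphi_morph Rc HM HN) (comodule_map_id FP)
    (iso_surj (Qphi_iso Rc HM HN)) (fun z => ex_intro _ z erefl) w.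
  by exists u.
- by move=> n; exact: (complex_assoc_spec Rc M N P n).1.
move=> u; apply: aspan_bind (Qcox3_span u) => _ [p [q [r [x [y [z ->]]]]]].
apply: aspan_gen; exists (p + q + r)%N; eexists; split; first exact: phi_leftE.
exact: phi_rightE.
Qed.

Lemma phi_coherence : comodule_comp (QC_map (@complex_assoc R M N P)) phi_left = phi_right.
Proof.
have L1 := phi_left_morph.1; have L2 := phi_right_morph.1.
have aM := complex_assoc_morph; have L3 := QC_map_linear (k := k) aM.
apply/funext => w.
apply: (aspan_eq (linear_zmod (linear_comp L3 L1)) (linear_zmod L2)) (Qcox3_span w).
move=> _ [p [q [r [x [y [z ->]]]]]].
by rewrite phi_leftE phi_rightE QC_mapE.
Qed.

Lemma complex_assoc_iso : @is_iso (chain_category R) _ _ (@complex_assoc R M N P).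
Proof.
pose g n := projT1 (cid (complex_assoc_inv Rc M N P n)).
apply: (@chain_iso R _ _ _ g); first exact: complex_assoc_morph.
  by move=> n; rewrite /g; case: cid => ? [].
by move=> n; rewrite /g; case: cid => ? [].
Qed.

End Assoc.

Section Units.
Variable M : complex R.
Hypothesis HM : is_complex M.
Let FM : is_comodule (F M) := QC_comodule HM.
Let FCU : is_comodule (F U) := QC_comodule HU.
Let HUM : is_complex (complex_tens U M) := complex_tensP Rc HU HM.
Let HMU : is_complex (complex_tens M U) := complex_tensP Rc HM HU.
Let TUM := comodule_tensP Rc FU FM.
Let TMU := comodule_tensP Rc FM FU.
Let TCUM := comodule_tensP Rc FCU FM.
Let TMCU := comodule_tensP Rc FM FCU.
Let phi0_morph := Qphi0_morph R.

Definition phi_unitl : comodule_tens (comodule_unit R) (F M) -> F (complex_tens U M) :=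
  comodule_comp (@Qphi k R U M) (comodule_tens_map (@Qphi0 k R) (@comodule_idm k R (F M))).
Definition phi_unitr : comodule_tens (F M) (comodule_unit R) -> F (complex_tens M U) :=
  comodule_comp (@Qphi k R M U) (comodule_tens_map (@comodule_idm k R (F M)) (@Qphi0 k R)).

Lemma phi_unitl_morph : is_comodule_map phi_unitl.
Proof.
apply: (comodule_map_comp TUM TCUM (QC_comodule HUM) (Qphi_morph Rc HU HM)).
exact: (comodule_tens_map_morph Rc FU FCU FM FM phi0_morph (comodule_map_id FM)).
Qed.

Lemma phi_unitr_morph : is_comodule_map phi_unitr.
Proof.
apply: (comodule_map_comp TMU TMCU (QC_comodule HMU) (Qphi_morph Rc HM HU)).
exact: (comodule_tens_map_morph Rc FM FM FU FCU (comodule_map_id FM) phi0_morph).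
Qed.

Lemma phi_unitlE (r : R) n (x : M n) :
  phi_unitl ((r : comodule_unit R) \ox Qj x) = Qj (lunit_in r x : complex_tens U M n).
Proof.
have [_ E] := comodule_tens_map_spec Rc FU FCU phi0_morph (comodule_map_id FM).
by rewrite /phi_unitl /comodule_comp E; exact: (QphiE Rc HU HM (p := 0) (eqxx n)).
Qed.

Lemma phi_unitrE (r : R) n (x : M n) :
  phi_unitr (Qj x \ox (r : comodule_unit R)) = Qj (runit_in x r : complex_tens M U n).
Proof.
have [_ E] := comodule_tens_map_spec Rc FM FM (comodule_map_id FM) phi0_morph.
by rewrite /phi_unitr /comodule_comp E; exact: (QphiE Rc HM HU (q := 0) (bideg_0r n)).
Qed.

Lemma unitl_span (w : comodule_tens (comodule_unit R) (F M)) :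
  aspan (fun w => exists (r : R) n (x : M n), w = (r : comodule_unit R) \ox Qj x) w.
Proof.
apply: aspan_bind (cox_span w) => _ [r [v ->]].
apply: (aspan_map (f := fun v : F M => r \ox v)) (Qj_span v); first exact: cox_zmodr.
by move=> _ [n [x ->]]; apply: aspan_gen; exists r, n, x.
Qed.

Lemma unitr_span (w : comodule_tens (F M) (comodule_unit R)) :
  aspan (fun w => exists (r : R) n (x : M n), w = Qj x \ox (r : comodule_unit R)) w.
Proof.
apply: aspan_bind (cox_span w) => _ [v [r ->]].
apply: (aspan_map (f := fun v : F M => v \ox r)) (Qj_span v).
  exact: linear_zmod (cox_linearl r).
by move=> _ [n [x ->]]; apply: aspan_gen; exists r, n, x.
Qed.

Lemma complex_lunit_morph : is_chain_map (@complex_lunit R M).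
Proof.
apply: (chain_map_criterion HUM HM TUM phi_unitl_morph (comodule_lunit_morph Rc FM)).
- move=> v; have [w <-] := iso_surj (Qphi_iso Rc HU HM) v.
  have [u <-] := cox_map_surj FU FCU phi0_morph (comodule_map_id FM)
    (iso_surj (Qphi0_iso R)) (fun z => ex_intro _ z erefl) w.
  by exists u.
- by move=> n; exact: (complex_lunit_spec Rc M n).1.
move=> u; apply: aspan_bind (unitl_span u) => _ [r [n [x ->]]].
apply: aspan_gen; exists n, (lunit_in r x); split; first exact: phi_unitlE.
rewrite (comodule_lunit_spec Rc (F M)).2 (complex_lunit_spec Rc M n).2.
exact: (esym (linear_scale (@Qj_linear k R M n) r x)).
Qed.

Lemma complex_runit_morph : is_chain_map (@complex_runit R M).
Proof.
apply: (chain_map_criterion HMU HM TMU phi_unitr_morph (comodule_runit_morph Rc FM)).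
- move=> v; have [w <-] := iso_surj (Qphi_iso Rc HM HU) v.
  have [u <-] := cox_map_surj FM FM (comodule_map_id FM) phi0_morph
    (fun z => ex_intro _ z erefl) (iso_surj (Qphi0_iso R)) w.
  by exists u.
- by move=> n; exact: (complex_runit_spec Rc M n).1.
move=> u; apply: aspan_bind (unitr_span u) => _ [r [n [x ->]]].
apply: aspan_gen; exists n, (runit_in x r); split; first exact: phi_unitrE.
rewrite (comodule_runit_spec Rc FM).2 (complex_runit_spec Rc M n).2.
exact: (esym (linear_scale (@Qj_linear k R M n) r x)).
Qed.

Lemma phi_unitl_coherence :
  comodule_comp (QC_map (@complex_lunit R M)) phi_unitl = @comodule_lunit k R (F M).
Proof.
have uM := complex_lunit_morph; have L := QC_map_linear (k := k) uM.
apply/funext => w; apply: (aspan_eq (linear_zmod (linear_comp L phi_unitl_morph.1))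
  (linear_zmod (comodule_lunit_spec Rc (F M)).1)) (unitl_span w) => _ [r [n [x ->]]].
rewrite phi_unitlE QC_mapE // (comodule_lunit_spec Rc (F M)).2 (complex_lunit_spec Rc M n).2.
exact: (linear_scale (@Qj_linear k R M n) r x).
Qed.

Lemma phi_unitr_coherence :
  comodule_comp (QC_map (@complex_runit R M)) phi_unitr = @comodule_runit k R (F M).
Proof.
have uM := complex_runit_morph; have L := QC_map_linear (k := k) uM.
apply/funext => w; apply: (aspan_eq (linear_zmod (linear_comp L phi_unitr_morph.1))
  (linear_zmod (comodule_runit_spec Rc FM).1)) (unitr_span w) => _ [r [n [x ->]]].
rewrite phi_unitrE QC_mapE // (comodule_runit_spec Rc FM).2 (complex_runit_spec Rc M n).2.
exact: (linear_scale (@Qj_linear k R M n) r x).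
Qed.

End Units.

Lemma chain_monoidal : is_monoidal (chain_mon_data R).
Proof.
split; [split|split|split| |]; rewrite /=.
- by move=> M N HM HN; exact: complex_tensP.
- by move=> M M' N N' f g HM HM' HN HN' Hf Hg; exact: complex_tens_map_morph.
- move=> M N HM HN; apply: functional_extensionality_dep => n; apply/funext.
  have [L E] := complex_tens_map_spec n (chain_map_id HM).1 (chain_map_id HN).1.
  by apply: (cmk_eq (linear_zmod L) (g := fun z => z)).
- move=> M M' M'' N N' N'' f' f g' g HM HM' HM'' HN HN' HN'' Hf' Hf Hg' Hg.
  apply: functional_extensionality_dep => n; apply/funext.
  have [L1 E1] := complex_tens_map_spec n Hf.1 Hg.1.
  have [L2 E2] := complex_tens_map_spec n Hf'.1 Hg'.1.
  have [L3 E3] := complex_tens_map_spec n (chain_map_comp HM HM' HM'' Hf' Hf).1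
    (chain_map_comp HN HN' HN'' Hg' Hg).1.
  apply: (cmk_eq (linear_zmod L3) (linear_zmod (linear_comp L2 L1))) => p q e x y.
  by rewrite E3 E1 E2.
- exact: HU.
- by move=> M N P HM HN HP; exact: complex_assoc_iso.
- move=> M HM; apply: chain_iso; first exact: complex_lunit_morph.
    by move=> n; exact: complex_lunitK.
  by move=> n; exact: lunit_inK.
- move=> M HM; apply: chain_iso; first exact: complex_runit_morph.
    by move=> n; exact: complex_runitK.
  by move=> n; exact: runit_inK.
- move=> M M' N N' P P' f g h HM HM' HN HN' HP HP' Hf Hg Hh.
  apply: functional_extensionality_dep => n; apply/funext => w.
  have Hfg := complex_tens_map_morph HM HM' HN HN' Hf Hg.
  have Hgh := complex_tens_map_morph HN HN' HP HP' Hg Hh.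
  have sp m := complex_tens_map_spec m Hf.1 Hg.1.
  have sp' m := complex_tens_map_spec m Hg.1 Hh.1.
  have [L1 E1] := complex_tens_map_spec n Hfg.1 Hh.1.
  have [L2 E2] := complex_tens_map_spec n Hf.1 Hgh.1.
  have La := (complex_assoc_spec Rc M N P n).1.
  have Lb := (complex_assoc_spec Rc M' N' P' n).1.
  apply: (aspan_eq (linear_zmod (linear_comp Lb L1)) (linear_zmod (linear_comp L2 La)))
    (cmk3_span w) => _ [p [q [r [e [x [y [z ->]]]]]]].
  have e' : (p + (q + r) == n)%N by rewrite addnA.
  rewrite E1 (sp _).2 !(complex_assocE Rc e (eqxx (p + q)%N) e' (eqxx (q + r)%N)).
  by rewrite E2 (sp' _).2.
- move=> M N f HM HN Hf; apply: functional_extensionality_dep => n; apply/funext => w.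
  have [L1 E1] := complex_tens_map_spec n (chain_map_id HU).1 Hf.1.
  have [La Ea] := complex_lunit_spec Rc M n; have [Lb Eb] := complex_lunit_spec Rc N n.
  apply: (aspan_eq (linear_zmod (linear_comp Lb L1)) (linear_zmod (linear_comp (Hf.1 n) La)))
    (lunit_span w) => _ [r [x ->]].
  by rewrite Ea (linear_scale (Hf.1 n)) -Eb; congr complex_lunit; exact: E1.
- move=> M N f HM HN Hf; apply: functional_extensionality_dep => n; apply/funext => w.
  have [L1 E1] := complex_tens_map_spec n Hf.1 (chain_map_id HU).1.
  have [La Ea] := complex_runit_spec Rc M n; have [Lb Eb] := complex_runit_spec Rc N n.
  apply: (aspan_eq (linear_zmod (linear_comp Lb L1)) (linear_zmod (linear_comp (Hf.1 n) La)))
    (runit_span w) => _ [x [r ->]].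
  by rewrite Ea (linear_scale (Hf.1 n)) -Eb; congr complex_runit; exact: E1.
- move=> M N P Q HM HN HP HQ; apply: functional_extensionality_dep => n; apply/funext => w.
  have a1 := complex_assoc_morph HM HN HP; have a2 := complex_assoc_morph HN HP HQ.
  have [L1 E1] := complex_tens_map_spec n a1.1 (chain_map_id HQ).1.
  have [L2 E2] := complex_tens_map_spec n (chain_map_id HM).1 a2.1.
  have La := (complex_assoc_spec Rc (complex_tens M N) P Q n).1.
  have Lb := (complex_assoc_spec Rc M N (complex_tens P Q) n).1.
  have Lc := (complex_assoc_spec Rc M (complex_tens N P) Q n).1.
  pose f w := complex_assoc (complex_assoc w : complex_tens (complex_tens M N) (complex_tens P Q)
    n).
  pose g w := complex_tens_map (@chain_idm R M) (@complex_assoc R N P Q) (n := n)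
    (complex_assoc (complex_tens_map (@complex_assoc R M N P) (@chain_idm R Q) (n := n) w)).
  have fB : zmod_morphism f by exact: linear_zmod (linear_comp Lb La).
  have gB : zmod_morphism g by exact: linear_zmod (linear_comp L2 (linear_comp Lc L1)).
  apply: (aspan_eq fB gB) (cmk3_span w) => _ [i [r [s [e [u [z [v ->]]]]]]].
  (* [cmk3_span] leaves u in degree i of M (x) N; writing u through pure tensors then fixes i = p +
     q. *)
  pose h u := cmk (M := complex_tens (complex_tens M N) P) e
    (cmk (M := complex_tens M N) (eqxx (i + r)%N) u z) v : ctens_ob _ Q n.
  have hB : zmod_morphism h.
    apply: linear_zmod; exact: (linear_comp (cmk_linearl (M := complex_tens (complex_tens M N) P)
      e v)
      (cmk_linearl (M := complex_tens M N) (eqxx (i + r)%N) z)).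
  apply: (aspan_eq (zmod_morph_comp fB hB) (zmod_morph_comp gB hB)) (cmk_span u).
  move=> _ [p [q [e' [x [y ->]]]]]; have E := eqP e'; subst i.
  have e1 : (p + q + (r + s) == n)%N by rewrite addnA.
  have e2 : (p + (q + r + s) == n)%N by rewrite !addnA.
  have e3 : (q + (r + s) == q + r + s)%N by rewrite addnA.
  have e4 : (p + (q + r) == p + q + r)%N by rewrite addnA.
  rewrite /f /g /h E1.
  rewrite (complex_assocE Rc e (eqxx _) e1 (eqxx (r + s)%N)).
  rewrite (complex_assocE Rc e1 e' e2 e3).
  rewrite (complex_assocE Rc (eqxx (p + q + r)%N) e' e4 (eqxx (q + r)%N)).
  rewrite (complex_assocE Rc e e4 e2 (eqxx (q + r + s)%N)) E2.
  by rewrite (complex_assocE Rc (eqxx (q + r + s)%N) (eqxx (q + r)%N) e3 (eqxx (r + s)%N)).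
- move=> M N HM HN; apply: functional_extensionality_dep => n; apply/funext => w.
  have l := complex_lunit_morph HN; have r := complex_runit_morph HM.
  have [L1 E1] := complex_tens_map_spec n (chain_map_id HM).1 l.1.
  have [L2 E2] := complex_tens_map_spec n r.1 (chain_map_id HN).1.
  have La := (complex_assoc_spec Rc M U N n).1.
  pose f w := complex_tens_map (@chain_idm R M) (@complex_lunit R N) (n := n) (complex_assoc w).
  have fB : zmod_morphism f by exact: linear_zmod (linear_comp L1 La).
  apply: (aspan_eq fB (linear_zmod L2)) (cmk_span w) => _ [p [q [e [u [y ->]]]]].
  have hB := linear_zmod (cmk_linearl (M := complex_tens M U) e y).
  apply: (aspan_eq (zmod_morph_comp fB hB) (zmod_morph_comp (linear_zmod L2) hB)) (runit_span u).
  move=> _ [x [a ->]]; rewrite /f E2 (complex_runit_spec Rc M p).2.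
  rewrite (complex_assocE Rc e (bideg_0r p) e (eqxx q : (0 + q == q)%N)) E1.
  rewrite [complex_lunit _]((complex_lunit_spec Rc N q).2 a y).
  by rewrite (linear_scale (cmk_linearl e y)) (linear_scale (cmk_linearr e x)).
Qed.

Theorem QC_monoidal_equivalence :
  is_monoidal_equivalence (chain_mon_data R) (comodule_mon_data R) (QC_functor R).
Proof.
split; [exact: chain_monoidal|exact: comodule_monoidal|exact: QC_equivalence|].
exists (@Qphi k R), (@Qphi0 k R); split.
- exact: QC_functorP.
- by move=> M N HM HN; exact: Qphi_iso.
- exact: Qphi0_iso.
- by move=> M M' N N' f g HM HM' HN HN' Hf Hg; exact: Qphi_natural.
split.
- by move=> M N P HM HN HP; exact: phi_coherence.
- by move=> M HM; exact: phi_unitl_coherence.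
- by move=> M HM; exact: phi_unitr_coherence.
Qed.

End MonoidalEquivalence.

Theorem corollary3p4p14 (k : comPzRingType) (R : kalgebra k) :
  is_equivalence (QC_functor R) /\
  ((forall x y : R, x * y = y * x) ->
   is_monoidal_equivalence (chain_mon_data R) (comodule_mon_data R) (QC_functor R)).
Proof. by split=> [|Rc]; [exact: QC_equivalence|exact: QC_monoidal_equivalence]. Qed.
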